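(* Let $C_1,\dots,C_n$ be $n$ copulas. (1) If $C_1$ generates an exponentially $\rho$-mixing stationary Markov chain, then any convex combination $\sum_{k=1}^n a_kC_k$ (with $a_k\ge0$, $\sum_{k=1}^n a_k=1$) that contains $C_1$ (i.e. $a_1\ne0$) generates exponentially $\rho$-mixing stationary Markov chains. (2) If $C_2$ generates an absolutely regular stationary Markov chain and $C_1$ generates an exponentially $\rho$-mixing stationary Markov chain, then any convex combination $\sum_{k=1}^n a_kC_k$ (with $a_k\ge 0$, $\sum_{k=1}^n a_k=1$) containing $C_1$ and $C_2$ (i.e. $a_1\ne0$ and $a_2\neq0$) generates geometrically ergodic and exponentially $\rho$-mixing stationary Markov chains.
   Context: A (2-)copula is a function $C:[0,1]^2\to[0,1]$ that is the joint cumulative distribution function of two random variables each uniform on $[0,1]$; a convex combination of copulas is a copula. A stationary Markov chain $(X_m)_{m\in\mathbb Z}$ is generated by $C$ if its one-dimensional marginal distribution is uniform on $[0,1]$ and $(X_m,X_{m+1})$ has joint distribution function $C$, i.e. $P(X_{m+1}\le y\mid X_m=x)=\partial C(x,y)/\partial x$ for almost every $x$. For $\sigma$-fields $\mathscr A,\mathscr B$ put $\beta(\mathscr A,\mathscr B)=\mathbb E\sup_{B\in\mathscr B}|P(B|\mathscr A)-P(B)|$ and $\rho(\mathscr A,\mathscr B)=\sup\{\mathrm{corr}(f,g): f\in L^2(\mathscr A), g\in L^2(\mathscr B)\}$; $\beta_m,\rho_m$ are these coefficients with $\mathscr A=\sigma(X_i,i\le0)$, $\mathscr B=\sigma(X_i,i\ge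 m)$. The chain is absolutely regular ($\beta$-mixing) if $\beta_m\to0$. It is exponentially $\rho$-mixing if $\rho_m\le K r^m$ for all $m\ge1$ for some $K<\infty$, $r\in(0,1)$. The chain is geometrically ergodic if there are $b\in(0,1)$ and a function $W$ with $\mathbb E(W(X_0))<\infty$ such that for all $m\in\mathbb N$ and almost every $x$, $\sup_{B}|P(X_m\in B|X_0=x)-P(X_m\in B)|\le b^mW(x)$, the supremum being over Borel sets $B$; this is equivalent to exponential decay of $\beta_m$. *)

(* Defs.v *)
From HB Require Import structures.
From mathcomp Require Import all_boot all_order all_algebra.
From mathcomp Require Import all_classical all_reals all_analysis.
From mathcomp Require Import measurable_realfun.

Set Implicit Arguments.
Unset Strict Implicit.
Unset Printing Implicit Defensive.

Import Order.TTheory GRing.Theory Num.Theory.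
Import numFieldNormedType.Exports.

Local Open Scope classical_set_scope.
Local Open Scope ring_scope.

Section sigma_fields.
Context d (T : measurableType d) (R : realType) (P : probability T R).
(* In this section F, G stand for sub-sigma-fields of T. *)
Implicit Types (F G : set (set T)) (A B : set T) (S : set (T -> \bar R)).

Definition measurable_wrt F (f : T -> R) : Prop :=
  forall D : set R, measurable D -> F (f @^-1` D).

(* p is a version of the conditional probability P(B | F). *)
Definition is_cond_prob F B (p : T -> R) : Prop :=
  [/\ measurable_wrt F p,
      P.-integrable setT (EFin \o p) &
      forall A, F A -> (\int[P]_(w in A) (p w)%:E = P (B `&` A))%E].

Definition is_ess_supremum S (s : T -> \bar R) : Prop :=
  [/\ measurable_fun setT s,
      forall f, S f -> {ae P, forall w, (f w <= s w)%E} &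
      forall s', measurable_fun setT s' ->
        (forall f, S f -> {ae P, forall w, (f w <= s' w)%E}) ->
        {ae P, forall w, (s w <= s' w)%E}].

Definition ess_supremum S : T -> \bar R :=
  xget (cst +oo%E) [set s | is_ess_supremum S s].

(* Conditional probabilities are only defined up to null sets, so the supremum
   over the (in general uncountable) sigma-field G in
   E sup_{B in G} |P(B | F) - P(B)| is the lattice supremum of a family of
   random variables modulo null sets, i.e. the essential supremum. *)
Definition beta_coef F G : \bar R :=
  (\int[P]_w ess_supremum
     [set f : T -> \bar R | exists B p, [/\ G B, is_cond_prob F B p &
        f = (fun w => `| (p w)%:E - P B |)] ] w)%E.

(* Equals 0 when one of the variables is a.s. constant. *)
Definition corr (f g : T -> R) : R :=
  fine (covariance P f g) /
    (Num.sqrt (fine ('V_P[f])%E) * Num.sqrt (fine ('V_P[g])%E)).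

Definition L2 F (f : T -> R) : Prop :=
  measurable_wrt F f /\ f \in Lfun P 2%:E.

Definition rho_coef F G : \bar R :=
  ereal_sup [set r | exists f g, [/\ L2 F f, L2 G g & r = (corr f g)%:E]].

End sigma_fields.

Section copulas.
Context (R : realType).

Definition uniform01 d (T : measurableType d) (P : probability T R)
    (X : {RV P >-> R}) : Prop :=
  forall A : set R, measurable A ->
    distribution P X A = uniform_prob (@ltr01 R) A.

(* C is the joint distribution function of (X, Y) on the unit square; what
   C : R -> R -> R does outside of the unit square is irrelevant. *)
Definition joint_cdf01 d (T : measurableType d) (P : probability T R)
    (X Y : {RV P >-> R}) (C : R -> R -> R) : Prop :=
  forall x y, 0 <= x <= 1 -> 0 <= y <= 1 ->
    P [set w | X w <= x /\ Y w <= y] = (C x y)%:E.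

Definition is_copula (C : R -> R -> R) : Prop :=
  exists d (T : measurableType d) (P : probability T R) (U V : {RV P >-> R}),
    [/\ uniform01 U, uniform01 V & joint_cdf01 U V C].

End copulas.

Record process (R : realType) := Process {
  process_disp : measure_display ;
  process_space : measurableType process_disp ;
  process_prob : probability process_space R ;
  process_var :> int -> {RV process_prob >-> R} }.

Section chains.
Context (R : realType).
Implicit Types (X : process R) (C : R -> R -> R) (Q : process R -> Prop).

Definition sigma_of X (J : set int) : set (set (process_space X)) :=
  <<s \bigcup_(i in J) preimage_set_system setT (X i) measurable >>.
Arguments sigma_of X J : clear implicits.

Definition stationary X : Prop :=
  forall (k : nat) (t : 'I_k -> int) (B : 'I_k -> set R) (h : int),
    (forall i, measurable (B i)) ->
    process_prob X (\bigcap_(i in setT) (X (t i) @^-1` B i)) =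
    process_prob X (\bigcap_(i in setT) (X (t i + h) @^-1` B i)).

(* P(X_{m+1} in B | X_i, i <= m) = P(X_{m+1} in B | X_m) a.s. *)
Definition markov_property X : Prop :=
  forall (m : int) (B : set R), measurable B ->
    exists p,
      is_cond_prob (process_prob X) (sigma_of X [set m])
        (X (m + 1) @^-1` B) p /\
      is_cond_prob (process_prob X) (sigma_of X [set i | i <= m])
        (X (m + 1) @^-1` B) p.

Definition generated_by C X : Prop :=
  [/\ stationary X, markov_property X,
      forall m : int, uniform01 (X m) &
      forall m : int, joint_cdf01 (X m) (X (m + 1)) C].

Definition beta_mix X (m : nat) : \bar R :=
  beta_coef (process_prob X)
    (sigma_of X [set i | i <= 0]) (sigma_of X [set i | m%:Z <= i]).

Definition rho_mix X (m : nat) : \bar R :=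
  rho_coef (process_prob X)
    (sigma_of X [set i | i <= 0]) (sigma_of X [set i | m%:Z <= i]).

Definition absolutely_regular X : Prop :=
  beta_mix X m @[m --> \oo] --> 0%E.

Definition exp_rho_mixing X : Prop :=
  exists K r : R, 0 < r < 1 /\
    forall m : nat, (1 <= m)%N -> (rho_mix X m <= (K * r ^+ m)%:E)%E.

(* k is a regular version of the conditional law P(X_m in . | X_0 = x). *)
Definition is_cond_law X (m : nat) (k : R.-pker R ~> R) : Prop :=
  forall A B : set R, measurable A -> measurable B ->
    process_prob X (X 0 @^-1` A `&` X m%:Z @^-1` B) =
    (\int[distribution (process_prob X) (X 0%R)]_(x in A) k x B)%E.

Definition geometrically_ergodic X : Prop :=
  exists (b : R) (W : R -> R),
    [/\ 0 < b < 1,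
        measurable_fun setT W,
        (process_prob X).-integrable setT (fun w => (W (X 0 w))%:E) &
        forall m : nat, exists2 k : R.-pker R ~> R, is_cond_law X m k &
          {ae distribution (process_prob X) (X 0), forall x,
            (ereal_sup [set `| k x B - process_prob X (X m%:Z%R @^-1` B) |
                       | B in measurable] <= (b ^+ m * W x)%:E)%E}].

Definition generates_a C Q : Prop := exists X, generated_by C X /\ Q X.

Definition generates C Q : Prop :=
  (exists X, generated_by C X) /\ (forall X, generated_by C X -> Q X).

End chains.

(* Main.v *)
From HB Require Import structures.
Require Import Defs.
From mathcomp Require Import all_boot all_order all_algebra.
From mathcomp Require Import all_classical all_reals all_analysis.
From mathcomp Require Import measurable_realfun ring lra zify.

Set Implicit Arguments.
Unset Strict Implicit.
Unset Printing Implicit Defensive.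

Import Order.TTheory GRing.Theory Num.Theory.
Import numFieldNormedType.Exports.

Local Open Scope classical_set_scope.
Local Open Scope ring_scope.

(** Write U for the uniform law on [0,1].  The one-step transition operator of a
    chain generated by a copula, k phi x = E(phi(X_1) | X_0 = x), acts on bounded
    measurable functions, preserves the integral against U and contracts the
    mean-square norm.  Conditioning is linear in the copula, so the chain of
    sum_i a_i C_i has the operator k = sum_i a_i k_i.  Both parts of the theorem are
    statements about such operators.

    Correlations.  rho_m is the norm of k^m on functions of mean zero.  In one
    direction (rho_contraction) correlate (k^m phi)(X_0) with phi(X_m).  In the
    other (bounded_decorrelation), the regression of a variable of the past on X_m
    is contracted by duality and, by the Markov property, is all that the future
    sees of the past.  If k_1^m has norm l < 1 on mean-zero functions, then k^m
    differs from a_1^m k_1^m by an operator of norm at most 1 - a_1^m, so k^m has norm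
    at most 1 - a_1^m (1 - l) < 1 there, and the powers of k decay geometrically
    (gapped_mixture).  This proves (1).

    Regularity.  If the chain of C_2 is absolutely regular, then for some N its
    N-step law is at total variation distance less than 1 from independence; the
    Hahn decomposition then extracts from this law a nonzero part with a bounded
    density q (common_part), that is, a lower bound k_2^N >= Q on nonnegative
    functions, where Q is the integral operator with kernel q
    (absolutely_regular_minorant).  Hence k^N >= a_2^N Q.  The operator Q maps
    the mean-square norm to the uniform norm, while the remainder k^N - a_2^N Q decays
    geometrically on nonnegative functions because k has a spectral gap and Q is
    not zero.
    Expanding k^(jN) along this splitting turns the mean-square decay of k into
    pointwise bounds |k^m f (x)| <= v_m(x), valid for all f of mean zero with |f| <= 1
    and with the integrals of the v_m geometrically small (minorization_bound).  With f
    a centred indicator this is geometric ergodicity, with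
    W = sum_m b^(-m) v_m (geometric_weight).

    Everything above is about one operator, whereas the theorem quantifies over
    all chains generated by the mixture and also asserts that one exists.  Every
    copula is represented by a map f such that f(x, u), with u uniform, has the
    conditional law of X_1 given X_0 = x (disintegration, copula_transition).
    Any chain generated by the copula then has the operator of f as
    transition operator (generated_mkv).  Conversely, since one uniform
    variable can be split into independent uniform variables
    (uniform_splitting), such maps can be iterated, mixed, and used to drive
    a two-sided chain, forwards with f and backwards with the map of the
    reversed chain (transition_generates). *)

(** * Bounded measurable functions and the mean-square norm *)

Section bounded_measurable.
Context d (T : measurableType d) (R : realType).
Implicit Types f g : T -> R.

(** Operators act on everywhere defined functions and not on classes modulo null
    sets, so that pointwise inequalities between operators make sense. *)
Definition bm f := measurable_fun setT f /\ exists M : R, forall x, `|f x| <= M.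

Lemma bm_cst (c : R) : bm (cst c).
Proof. by split; [exact: measurable_cst|exists `|c|]. Qed.

Lemma bmD f g : bm f -> bm g -> bm (fun x => f x + g x).
Proof.
move=> [mf [M fM]] [mg [N gN]]; split; first exact: measurable_funD.
by exists (M + N) => x; rewrite (le_trans (ler_normD _ _))// lerD.
Qed.

Lemma bmM f g : bm f -> bm g -> bm (fun x => f x * g x).
Proof.
move=> [mf [M fM]] [mg [N gN]]; split; first exact: measurable_funM.
by exists (M * N) => x; rewrite normrM ler_pM.
Qed.

Lemma bmZ (c : R) f : bm f -> bm (fun x => c * f x).
Proof. by move=> bf; apply: bmM => //; exact: bm_cst. Qed.

Lemma bmN f : bm f -> bm (fun x => - f x).
Proof.
move=> /(bmZ (-1)); congr bm; by apply/funext => x; rewrite mulN1r.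
Qed.

Lemma bmB f g : bm f -> bm g -> bm (fun x => f x - g x).
Proof. by move=> bf /bmN; exact: bmD. Qed.

Lemma bm_norm f : bm f -> bm (fun x => `|f x|).
Proof.
move=> [mf [M fM]]; split; first exact: measurableT_comp.
by exists M => x; rewrite normr_id.
Qed.

Lemma bm_sqr f : bm f -> bm (fun x => f x ^+ 2).
Proof. by move=> bf; exact: bmM. Qed.

Lemma bm_indic (A : set T) : measurable A -> bm (\1_A).
Proof.
move=> mA; split; first exact: measurable_indic.
by exists 1 => x; rewrite indicE; case: (_ \in _); rewrite ?normr1// normr0.
Qed.

End bounded_measurable.
Arguments bm_cst {d T R} c.

Lemma bm_comp d1 d2 (T1 : measurableType d1) (T2 : measurableType d2)
    (R : realType) (f : T2 -> R) (g : T1 -> T2) :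
  measurable_fun setT g -> bm f -> bm (f \o g).
Proof.
move=> mg [mf [M fM]]; split; first exact: measurableT_comp.
by exists M => x; exact: fM.
Qed.

Section l2.
Context d (T : measurableType d) (R : realType) (P : probability T R).
Implicit Types f g : T -> R.

Lemma bm_integrable f : bm f -> P.-integrable setT (EFin \o f).
Proof.
move=> [mf [M fM]]; apply: measurable_bounded_integrable => //.
  by rewrite -ge0_fin_numE// fin_num_measure.
exists M; split; first by rewrite num_real.
by move=> y My x _ /=; rewrite (le_trans (fM x))// ltW.
Qed.

Definition sqint f :=
  measurable_fun setT f /\ P.-integrable setT (fun x => (f x ^+ 2)%:E).

Lemma bm_sqint f : bm f -> sqint f.
Proof.
by move=> bf; split; [case: bf|exact: (bm_integrable (bm_sqr bf))].
Qed.

Lemma sqint_mul f g : sqint f -> sqint g ->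
  P.-integrable setT (fun x => (f x * g x)%:E).
Proof.
move=> [mf f2] [mg g2].
apply: (@le_integrable _ _ _ P setT measurableT _
  (fun x => (f x ^+ 2 + g x ^+ 2)%:E)).
- by apply/measurable_EFinP; exact: measurable_funM.
- move=> x _ /=; rewrite lee_fin normrM.
  rewrite (ger0_norm (addr_ge0 (sqr_ge0 _) (sqr_ge0 _))).
  rewrite -(real_normK (num_real (f x))) -(real_normK (num_real (g x))).
  have := normr_ge0 (f x); have := normr_ge0 (g x); nra.
- exact: (integrableD measurableT f2 g2).
Qed.

Lemma sqint1 : sqint (cst 1).
Proof. exact/bm_sqint/bm_cst. Qed.

Lemma sqint_int f : sqint f -> P.-integrable setT (EFin \o f).
Proof.
move=> sf; have := sqint_mul sf sqint1.
by congr (P.-integrable setT _); apply/funext => x/=; rewrite mulr1.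
Qed.

Lemma sqintZ c f : sqint f -> sqint (fun x => c * f x).
Proof.
move=> [mf f2]; split; first exact: measurable_funM.
have := integrableZl measurableT (c ^+ 2) f2.
by congr (P.-integrable setT _); apply/funext => x/=; rewrite exprMn -EFinM.
Qed.

Lemma sqintD f g : sqint f -> sqint g -> sqint (fun x => f x + g x).
Proof.
move=> sf sg; split; first by apply: measurable_funD; [case: sf|case: sg].
have h := sqint_mul sf sg.
have [_ f2] := sf; have [_ g2] := sg.
have := integrableD measurableT (integrableD measurableT f2 g2)
  (integrableZl measurableT 2 h).
congr (P.-integrable setT _); apply/funext => x/=.
by rewrite -EFinM -!EFinD; congr EFin; ring.
Qed.

Lemma sqintB f g : sqint f -> sqint g -> sqint (fun x => f x - g x).
Proof.
move=> sf /(sqintZ (-1)) sg; have := sqintD sf sg.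
by congr sqint; apply/funext => x; rewrite mulN1r.
Qed.

Definition n2 f := Num.sqrt (\int[P]_x (f x ^+ 2)).

Lemma n2_ge0 f : 0 <= n2 f. Proof. exact: sqrtr_ge0. Qed.

Lemma sqr_n2 f : n2 f ^+ 2 = \int[P]_x (f x ^+ 2).
Proof. by rewrite sqr_sqrtr// Rintegral_ge0// => x _; exact: sqr_ge0. Qed.

Let discriminant (a b c : R) : 0 <= a -> 0 <= c ->
  (forall t, 0 <= a - 2 * t * b + t ^+ 2 * c) -> b ^+ 2 <= a * c.
Proof.
move=> a0; rewrite le_eqVlt => /predU1P[<-|c0] h.
  rewrite mulr0; have [->|b0] := eqVneq b 0; first by rewrite expr0n.
  have := h ((a + 1) / (2 * b)).
  have -> : a - 2 * ((a + 1) / (2 * b)) * b + ((a + 1) / (2 * b)) ^+ 2 * 0 = -1.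
    by field.
  lra.
have := h (b / c).
have -> : a - 2 * (b / c) * b + (b / c) ^+ 2 * c = a - b ^+ 2 / c.
  by field; rewrite gt_eqF.
by rewrite subr_ge0 ler_pdivrMr.
Qed.

Lemma cauchy_schwarz_sqr f g : sqint f -> sqint g ->
  (\int[P]_x (f x * g x)) ^+ 2 <=
  (\int[P]_x (f x ^+ 2)) * (\int[P]_x (g x ^+ 2)).
Proof.
move=> sf sg; apply: discriminant.
- by apply: Rintegral_ge0 => x _; exact: sqr_ge0.
- by apply: Rintegral_ge0 => x _; exact: sqr_ge0.
move=> t.
have fg := sqint_mul sf sg; have [_ f2] := sf; have [_ g2] := sg.
have -> : \int[P]_x (f x ^+ 2) - 2 * t * \int[P]_x (f x * g x) +
    t ^+ 2 * \int[P]_x (g x ^+ 2) = \int[P]_x ((f x - t * g x) ^+ 2).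
  rewrite -!RintegralZl// -RintegralB//; last first.
    exact: (integrableZl measurableT (2 * t) fg).
  rewrite -RintegralD//.
  - by apply: eq_Rintegral => x _; ring.
  - exact: (integrableB measurableT f2 (integrableZl measurableT (2 * t) fg)).
  - exact: (integrableZl measurableT (t ^+ 2) g2).
by apply: Rintegral_ge0 => x _; exact: sqr_ge0.
Qed.

Lemma cauchy_schwarz f g : sqint f -> sqint g ->
  `|\int[P]_x (f x * g x)| <= n2 f * n2 g.
Proof.
move=> sf sg; rewrite -ler_sqr ?nnegrE ?mulr_ge0 ?n2_ge0//.
by rewrite real_normK ?num_real// exprMn !sqr_n2; exact: cauchy_schwarz_sqr.
Qed.

Lemma n2D f g : sqint f -> sqint g ->
  n2 (fun x => f x + g x) <= n2 f + n2 g.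
Proof.
move=> sf sg; rewrite -ler_sqr ?nnegrE ?addr_ge0 ?n2_ge0//.
have fg := sqint_mul sf sg; have [_ f2] := sf; have [_ g2] := sg.
rewrite sqr_n2 sqrrD !sqr_n2.
have -> : \int[P]_x ((f x + g x) ^+ 2) = \int[P]_x (f x ^+ 2) +
    2 * \int[P]_x (f x * g x) + \int[P]_x (g x ^+ 2).
  rewrite -!RintegralZl// -RintegralD//; last first.
    exact: (integrableZl measurableT 2 fg).
  rewrite -RintegralD//.
  - by apply: eq_Rintegral => x _; ring.
  - exact: (integrableD measurableT f2 (integrableZl measurableT 2 fg)).
rewrite lerD2r lerD2l mulr2n.
have := le_trans (ler_norm _) (cauchy_schwarz sf sg); lra.
Qed.

Lemma n2Z c f : sqint f -> n2 (fun x => c * f x) = `|c| * n2 f.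
Proof.
move=> [_ f2]; rewrite /n2 -sqrtr_sqr -sqrtrM ?sqr_ge0//; congr Num.sqrt.
by rewrite -RintegralZl//; apply: eq_Rintegral => x _; rewrite exprMn.
Qed.

Lemma le_n2 f g : sqint f -> sqint g -> (forall x, `|f x| <= `|g x|) ->
  n2 f <= n2 g.
Proof.
move=> [_ f2] [_ g2] fg; apply: ler_wsqrtr; apply: le_Rintegral => // x _.
by rewrite -(real_normK (num_real (f x))) -(real_normK (num_real (g x))) ler_sqr ?nnegrE.
Qed.

Lemma n2_norm f : n2 (fun x => `|f x|) = n2 f.
Proof.
by congr Num.sqrt; apply: eq_Rintegral => x _; rewrite real_normK ?num_real.
Qed.

Lemma Rintegral_cstP (c : R) : \int[P]_x c = c.
Proof. by rewrite Rintegral_cst//= (@probability_setT _ _ _ P)/= mulr1. Qed.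

Lemma n2_cst (c : R) : n2 (fun=> c) = `|c|.
Proof. by rewrite /n2 Rintegral_cstP sqrtr_sqr. Qed.

Lemma norm_Rintegral_le_n2 f : sqint f -> `|\int[P]_x f x| <= n2 f.
Proof.
move=> sf; have := cauchy_schwarz sf sqint1.
rewrite (n2_cst 1) normr1 mulr1; congr (`|_| <= _).
by apply: eq_Rintegral => x _; rewrite mulr1.
Qed.

(** The mean is the best constant approximation: centring subtracts the square of
    the mean from the second moment. *)
Lemma n2_center f : sqint f -> n2 (fun x => f x - \int[P]_y f y) <= n2 f.
Proof.
move=> sf; set c := \int[P]_y f y; apply: ler_wsqrtr.
have f1 := sqint_int sf; have [_ f2] := sf.
have -> : \int[P]_x ((f x - c) ^+ 2) = \int[P]_x (f x ^+ 2) - c ^+ 2.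
  transitivity (\int[P]_x (f x ^+ 2 - (2 * c * f x - c ^+ 2))).
    by apply: eq_Rintegral => x _; ring.
  rewrite RintegralB//; last first.
    exact: (integrableB measurableT (integrableZl measurableT (2 * c) f1)
      (bm_integrable (bm_cst (c ^+ 2)))).
  rewrite RintegralB//; last 2 first.
    exact: (integrableZl measurableT (2 * c) f1).
    exact: (bm_integrable (bm_cst (c ^+ 2))).
  by rewrite RintegralZl// Rintegral_cstP -/c; ring.
by rewrite gerBl sqr_ge0.
Qed.

End l2.

(** * Positive and Markov operators *)
Section geometric.
Context (R : realType).

Lemma bernoulli_lb (x : R) n : 0 <= x <= 1 -> 1 - n%:R * x <= (1 - x) ^+ n.
Proof.
move=> /andP[x0 x1]; elim: n => [|n ih]; first by rewrite mul0r subr0 expr0.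
rewrite exprS; apply: (@le_trans _ _ ((1 - x) * (1 - n%:R * x))).
  rewrite -subr_ge0 -natr1.
  have -> : (1 - x) * (1 - n%:R * x) - (1 - (n%:R + 1) * x) = n%:R * x ^+ 2.
    by ring.
  by rewrite mulr_ge0// sqr_ge0.
by rewrite ler_wpM2l// subr_ge0.
Qed.

Lemma bernoulli_ub (x : R) n : 0 <= x -> 1 + n%:R * x <= (1 + x) ^+ n.
Proof.
move=> x0; elim: n => [|n ih]; first by rewrite mul0r addr0 expr0.
rewrite exprS; apply: (@le_trans _ _ ((1 + x) * (1 + n%:R * x))).
  rewrite -subr_ge0 -natr1.
  have -> : (1 + x) * (1 + n%:R * x) - (1 + (n%:R + 1) * x) = n%:R * x ^+ 2.
    by ring.
  by rewrite mulr_ge0// sqr_ge0.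
by rewrite ler_wpM2l// addr_ge0.
Qed.

(** Contraction every m steps is exponential decay: the rate r is chosen by
    Bernoulli's inequality so that r^m exceeds the factor l, and K absorbs the
    first m terms. *)
Lemma geometric_of_step (m : nat) (l : R) : (0 < m)%N -> 0 <= l < 1 ->
  exists K r : R, [/\ 0 <= K, 0 < r < 1 &
    forall u : nat -> R, (forall n, 0 <= u n) -> (forall n, u n.+1 <= u n) ->
      (forall n, u (n + m)%N <= l * u n) -> forall n, u n <= K * r ^+ n * u 0%N].
Proof.
move=> m0 /andP[l0 l1].
have mR : 0 < m%:R :> R by rewrite ltr0n.
have mR1 : 1 <= m%:R :> R by rewrite ler1n.
pose l' := (1 + l) / 2; pose x := (1 - l') / m%:R; pose r := 1 - x.
have l'0 : 0 < l' by rewrite /l'; lra.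
have l'1 : l' < 1 by rewrite /l'; lra.
have ll' : l <= l' by rewrite /l'; lra.
have x0 : 0 < x by rewrite divr_gt0// subr_gt0.
have x1 : x < 1 by rewrite ltr_pdivrMr// mul1r; lra.
have r01 : 0 < r < 1 by rewrite /r; lra.
have /andP[r0 r1] := r01.
have rm : l' <= r ^+ m.
  have := @bernoulli_lb x m; rewrite (ltW x0) (ltW x1) => /(_ isT).
  by apply: le_trans; rewrite /x mulrC divfK ?gt_eqF//; lra.
exists (r ^+ m)^-1, r; split => //; first by rewrite invr_ge0 exprn_ge0// ltW.
move=> u u0 ud us.
have udm n : u n <= u 0%N by elim: n => // n; exact/le_trans/ud.
elim/ltn_ind => n ih; have [nm|mn] := ltnP n m.
  rewrite (le_trans (udm n))// ler_peMl// mulrC ler_pdivlMr ?exprn_gt0// mul1r.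
  by apply: ler_wiXn2l; [exact: ltW|exact: ltW|exact: ltnW].
rewrite -(subnK mn); apply: (le_trans (us _)).
apply: (@le_trans _ _ (r ^+ m * u (n - m)%N)).
  by rewrite ler_wpM2r// (le_trans ll').
have /ih h : (n - m < n)%N by rewrite ltn_subrL m0 (leq_trans m0).
have rm0 : 0 <= r ^+ m by rewrite exprn_ge0// ltW.
apply: (le_trans (ler_wpM2l rm0 h)).
by rewrite exprD [r ^+ (n - m) * _]mulrC !mulrA [r ^+ m * _]mulrC.
Qed.

(** A linear prefactor is absorbed by a slightly larger rate. *)
Lemma linear_geometric (t : R) : 0 < t < 1 ->
  exists K r : R, [/\ 0 <= K, 0 < r < 1 & forall n, n.+1%:R * t ^+ n <= K * r ^+ n].
Proof.
move=> /andP[t0 t1]; pose e := (1 - t) / 2.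
have e0 : 0 < e by rewrite /e; lra.
exists e^-1, ((1 + e) * t); split; first by rewrite invr_ge0 ltW.
  apply/andP; split; first by rewrite mulr_gt0//; lra.
  by rewrite /e; nra.
move=> n; rewrite exprMn mulrA ler_wpM2r ?exprn_ge0 ?(ltW t0)//.
rewrite mulrC ler_pdivlMr//.
have := @bernoulli_ub e n (ltW e0); apply: le_trans.
by rewrite -natr1 mulrDl addrC mul1r lerD2r /e; lra.
Qed.

(** The floor costs a constant factor and a change of rate. *)
Lemma divn_geometric (t : R) (N : nat) : 0 < t < 1 -> (0 < N)%N ->
  exists K r : R, [/\ 0 <= K, 0 < r < 1 & forall n, t ^+ (n %/ N) <= K * r ^+ n].
Proof.
move=> /andP[t0 t1] N0.
have tl : 0 <= t < 1 by rewrite ltW.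
have [K [r [K0 r01 h]]] := geometric_of_step N0 tl.
exists K, r; split => // n.
have := h (fun n => t ^+ (n %/ N)); rewrite div0n expr0 => /(_ _ _ _ n).
rewrite mulr1; apply=> [i|i|i]; first by rewrite exprn_ge0// ltW.
  by apply: ler_wiXn2l; [exact: ltW|exact: ltW|exact: leq_div2r].
by rewrite divnDr// divnn N0 addn1 exprS.
Qed.

End geometric.

Section operators.
Context d (T : measurableType d) (R : realType) (P : probability T R).
Implicit Types (f g : T -> R) (S k : (T -> R) -> T -> R).
Notation n2 := (n2 P).

Record posop S : Prop := {
  posop_bm : forall f, bm f -> bm (S f) ;
  posop_lin : forall a f g, bm f -> bm g ->
    S (fun x => a * f x + g x) = (fun x => a * S f x + S g x) ;
  posop_ge0 : forall f, bm f -> (forall x, 0 <= f x) -> forall x, 0 <= S f x }.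

(** [markov_int] says that P is stationary for the operator. *)
Record markov_op k : Prop := {
  markov_posop :> posop k ;
  markov_one : k (cst 1) = cst 1 ;
  markov_int : forall f, bm f -> \int[P]_x k f x = \int[P]_x f x }.

Lemma posopD S f g : posop S -> bm f -> bm g ->
  S (fun x => f x + g x) = (fun x => S f x + S g x).
Proof.
move=> pS bf bg; have := posop_lin pS 1 bf bg.
by under eq_fun do rewrite mul1r; under [in RHS]eq_fun do rewrite mul1r.
Qed.

Lemma posop0 S : posop S -> S (cst 0) = cst 0.
Proof.
move=> pS; have b0 : bm (cst 0 : T -> R) := bm_cst 0.
have := posopD pS b0 b0.
have -> : (fun x : T => cst 0 x + cst 0 x) = cst 0 :> (T -> R).
  by apply/funext => x /=; rewrite addr0.
by move=> /(congr1 (fun h x => h x - S (cst 0) x)) /funeqP h; apply/funext => x;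
  have := h x; rewrite subrr addrK.
Qed.

Lemma posopZ S (a : R) f : posop S -> bm f ->
  S (fun x => a * f x) = (fun x => a * S f x).
Proof.
move=> pS bf; have := posop_lin pS a bf (bm_cst 0).
rewrite posop0//= => h; transitivity (S (fun x => a * f x + cst 0 x)).
  by congr (S _); apply/funext => x; rewrite addr0.
by rewrite h; apply/funext => x; rewrite addr0.
Qed.

Lemma posopB S f g : posop S -> bm f -> bm g ->
  S (fun x => f x - g x) = (fun x => S f x - S g x).
Proof.
move=> pS bf bg; transitivity (S (fun x => f x + (-1) * g x)).
  by congr (S _); apply/funext => x; rewrite mulN1r.
rewrite posopD ?posopZ//; last exact: bmZ.
by apply/funext => x; rewrite mulN1r.
Qed.

Lemma posop_le S f g : posop S -> bm f -> bm g -> (forall x, f x <= g x) ->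
  forall x, S f x <= S g x.
Proof.
move=> pS bf bg fg x; rewrite -subr_ge0.
have := posop_ge0 pS (bmB bg bf); rewrite posopB//; apply => y.
by rewrite subr_ge0.
Qed.

(** Both f and -f are below |f|. *)
Lemma posop_norm S f : posop S -> bm f -> forall x, `|S f x| <= S (fun y => `|f y|) x.
Proof.
move=> pS bf x; have bn := bm_norm bf.
rewrite ler_norml; apply/andP; split.
  rewrite lerNl -[leLHS]mulN1r -[X in X <= _]/((fun x => (-1) * S f x) x).
  rewrite -posopZ//; apply: posop_le => // [|y]; first exact: bmZ.
  by rewrite mulN1r -normrN ler_norm.
by apply: posop_le => // y; exact: ler_norm.
Qed.

Lemma posop_iter S n : posop S -> posop (iter n S).
Proof.
move=> pS; elim: n => [|n [ib il i0]]; first by split.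
split=> [f bf|a f g bf bg|f bf f0 x] /=.
- exact/(posop_bm pS)/ib.
- by rewrite il// (posop_lin pS)//; exact: ib.
- by apply: (posop_ge0 pS) => [|y]; [exact: ib|exact: i0].
Qed.

Lemma markov_iter k n : markov_op k -> markov_op (iter n k).
Proof.
move=> mk; split; first exact/posop_iter/mk.
  by elim: n => //= n ->; rewrite markov_one.
move=> f bf; elim: n => //= n <-; rewrite (markov_int mk)//.
exact: (posop_bm (posop_iter n mk)).
Qed.

Lemma markov_cst k (c : R) : markov_op k -> k (cst c) = cst c.
Proof.
move=> mk; transitivity (k (fun x => c * cst 1 x)).
  by congr k; apply/funext => x; rewrite mulr1.
rewrite posopZ ?markov_one//; [|exact: mk|exact: bm_cst].
by apply/funext => x /=; rewrite mulr1.
Qed.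

(** Expand the nonnegative function (f - c)^2 under k, with c the value of k f at
    the point. *)
Lemma markov_jensen k f : markov_op k -> bm f ->
  forall x, k f x ^+ 2 <= k (fun y => f y ^+ 2) x.
Proof.
move=> mk bf x; set c := k f x.
have bc : bm (fun y => -2 * c * f y + cst (c ^+ 2) y).
  by apply: bmD; [exact: bmZ|exact: bm_cst].
have := @posop_ge0 _ mk (fun y => 1 * f y ^+ 2 + (-2 * c * f y + cst (c ^+ 2) y)).
rewrite (posop_lin mk)//; last exact: bm_sqr.
rewrite (posop_lin mk)//; last exact: bm_cst.
rewrite markov_cst// => /(_ _ _ x).
have -> : 1 * k (fun x => f x ^+ 2) x + (-2 * c * k f x + cst (c ^+ 2) x) =
  k (fun x => f x ^+ 2) x - c ^+ 2 by rewrite /cst -/c; ring.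
rewrite subr_ge0; apply.
  by apply: bmD => //; apply: bmZ; exact: bm_sqr.
move=> y; have -> : 1 * f y ^+ 2 + (-2 * c * f y + cst (c ^+ 2) y) = (f y - c) ^+ 2.
  by rewrite /cst; ring.
exact: sqr_ge0.
Qed.

(** Jensen's inequality and stationarity. *)
Lemma markov_n2 k f : markov_op k -> bm f -> n2 (k f) <= n2 f.
Proof.
move=> mk bf; apply: ler_wsqrtr; rewrite -(markov_int mk (bm_sqr bf)).
have bkf := posop_bm mk bf; have bkf2 := posop_bm mk (bm_sqr bf).
apply: le_Rintegral => //.
- exact: bm_integrable (bm_sqr bkf).
- exact: bm_integrable bkf2.
- by move=> x _; exact: markov_jensen.
Qed.

(** Spectral gap: exponential decay of the powers on mean-zero functions. *)
Definition gapped k := exists K r : R, [/\ 0 <= K, 0 < r < 1 &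
  forall n f, bm f -> \int[P]_x f x = 0 -> n2 (iter n k f) <= K * r ^+ n * n2 f].

Lemma gapped_of_step k m (l : R) : markov_op k -> (0 < m)%N -> 0 <= l < 1 ->
  (forall f, bm f -> \int[P]_x f x = 0 -> n2 (iter m k f) <= l * n2 f) ->
  gapped k.
Proof.
move=> mk m0 l01 h; have [K [r [K0 r01 H]]] := geometric_of_step m0 l01.
exists K, r; split => // n f bf f0.
have bi i : bm (iter i k f) by exact: (posop_bm (markov_iter i mk)).
apply: (H (fun i => n2 (iter i k f))) => i; first exact: n2_ge0.
  exact: (markov_n2 mk (bi i)).
by rewrite addnC iterD; apply: h => //; rewrite (markov_int (markov_iter i mk)).
Qed.

(** Telescoping: k^(m+1) - a^(m+1) k1^(m+1) is
    (k^m - a^m k1^m) k + a^m k1^m (k - a k1), of norm at most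
    (1 - a^m) + a^m (1 - a). *)
Lemma mixture_iter k k1 (a : R) : markov_op k -> markov_op k1 -> 0 <= a <= 1 ->
  (forall f, bm f -> n2 (fun x => k f x - a * k1 f x) <= (1 - a) * n2 f) ->
  forall m f, bm f ->
  n2 (fun x => iter m k f x - a ^+ m * iter m k1 f x) <= (1 - a ^+ m) * n2 f.
Proof.
move=> mk mk1 /andP[a0 a1] h; elim=> [|m ih] f bf.
  rewrite expr0 subrr mul0r (_ : (fun x => _) = cst 0) ?n2_cst ?normr0//.
  by apply/funext => x /=; rewrite mul1r subrr.
have pm := markov_iter m mk; have pm1 := markov_iter m mk1.
have bkf := posop_bm mk bf; have bk1f := posop_bm mk1 bf.
have bD : bm (fun x => k f x - a * k1 f x) by apply: bmB => //; exact: bmZ.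
have -> : (fun x => iter m.+1 k f x - a ^+ m.+1 * iter m.+1 k1 f x) =
  (fun x => (iter m k (k f) x - a ^+ m * iter m k1 (k f) x) +
            a ^+ m * iter m k1 (fun y => k f y - a * k1 f y) x).
  rewrite (posopB pm1)//; last exact: bmZ.
  rewrite (posopZ _ pm1)//; apply/funext => x.
  by rewrite !iterSr exprS; ring.
have am0 : 0 <= a ^+ m by rewrite exprn_ge0.
have am1 : a ^+ m <= 1 by rewrite exprn_ile1.
have bE := posop_bm pm1 bD.
apply: (le_trans (n2D _ _)).
- apply: bm_sqint; apply: bmB; first exact: (posop_bm pm).
  by apply: bmZ; exact: (posop_bm pm1).
- by apply: bm_sqint; exact: bmZ.
rewrite n2Z; last exact: bm_sqint.
rewrite ger0_norm//.
have h1 : n2 (fun x => iter m k (k f) x - a ^+ m * iter m k1 (k f) x) <=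
    (1 - a ^+ m) * n2 f.
  apply: (le_trans (ih _ bkf)); rewrite ler_wpM2l ?subr_ge0//.
  exact: markov_n2.
have h2 : a ^+ m * n2 (iter m k1 (fun y => k f y - a * k1 f y)) <=
    a ^+ m * ((1 - a) * n2 f).
  rewrite ler_wpM2l//; apply: le_trans (h _ bf).
  exact: markov_n2.
by apply: (le_trans (lerD h1 h2)); rewrite exprS le_eqVlt; apply/orP; left;
  apply/eqP; ring.
Qed.

(** A component with a spectral gap gives one to the mixture: of the m-step
    operator, a share a^m contracts by l and the rest does not expand. *)
Lemma gapped_mixture k k1 (a l : R) m : markov_op k -> markov_op k1 ->
  0 < a <= 1 ->
  (forall f, bm f -> n2 (fun x => k f x - a * k1 f x) <= (1 - a) * n2 f) ->
  (0 < m)%N -> 0 <= l < 1 ->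
  (forall f, bm f -> \int[P]_x f x = 0 -> n2 (iter m k1 f) <= l * n2 f) ->
  gapped k.
Proof.
move=> mk mk1 /andP[a0 a1] h m0 /andP[l0 l1] hl.
have am0 : 0 < a ^+ m by rewrite exprn_gt0.
have am1 : a ^+ m <= 1 by rewrite exprn_ile1// ltW.
apply: (@gapped_of_step _ m (1 - a ^+ m + a ^+ m * l)) => //.
  by apply/andP; split; nra.
move=> f bf f0.
have a01 : 0 <= a <= 1 by rewrite ltW.
have b1 := posop_bm (markov_iter m mk) bf.
have b2 := posop_bm (markov_iter m mk1) bf.
have -> : iter m k f = (fun x => (iter m k f x - a ^+ m * iter m k1 f x) +
    a ^+ m * iter m k1 f x) by apply/funext => x; rewrite subrK.
apply: (le_trans (n2D _ _)).
- by apply: bm_sqint; apply: bmB => //; exact: bmZ.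
- by apply: bm_sqint; exact: bmZ.
rewrite mulrDl; apply: lerD; first exact: mixture_iter.
rewrite n2Z; last exact: bm_sqint.
by rewrite gtr0_norm// -mulrA ler_wpM2l ?hl// ltW.
Qed.

End operators.

(** * A minorized operator with a spectral gap *)
Section minorization.
Context d (T : measurableType d) (R : realType) (P : probability T R).
Implicit Types (f g : T -> R).
Notation n2 := (n2 P).
Variables (k : (T -> R) -> T -> R) (Q : (T -> R) -> T -> R) (N : nat) (M : R).
Hypotheses (mk : markov_op P k) (gk : gapped P k) (N0 : (0 < N)%N).
Hypotheses (pQ : posop Q) (M0 : 0 <= M).
Hypothesis QM : forall f, bm f -> forall x, `|Q f x| <= M * n2 f.
Hypothesis Q1 : 0 < \int[P]_x Q (cst 1) x.
Let S f x := iter N k f x - Q f x.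
Hypothesis pS : posop S.

Let mkN : markov_op P (iter N k) := markov_iter N mk.
Let pkN : posop (iter N k) := mkN.

Let S_le f : bm f -> (forall x, 0 <= f x) -> forall x, S f x <= iter N k f x.
Proof. by move=> bf f0 x; rewrite /S gerBl; exact: posop_ge0. Qed.

Let n2S f : bm f -> n2 (S f) <= n2 f.
Proof.
move=> bf; have bnf := bm_norm bf.
apply: (@le_trans _ _ (n2 (iter N k (fun x => `|f x|)))); last first.
  by rewrite -[leRHS]n2_norm; exact: markov_n2.
apply: le_n2.
- exact/bm_sqint/(posop_bm pS).
- exact/bm_sqint/(posop_bm pkN).
move=> x; apply: (le_trans (posop_norm pS bf x)).
by apply: le_trans (ler_norm _); exact: S_le.
Qed.

Let s := n2 (S (cst 1)).

(** Since 0 <= S 1 <= 1, the squared norm of S 1 is at most its integral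
    1 - int Q 1. *)
Let s1 : s < 1.
Proof.
have b1 : bm (cst 1 : T -> R) := bm_cst 1.
have bS1 := posop_bm pS b1; have bQ1 := posop_bm pQ b1.
have S1E x : S (cst 1) x = 1 - Q (cst 1) x by rewrite /S (markov_one mkN).
have Q0 x : 0 <= Q (cst 1) x by exact: posop_ge0.
have S0 x : 0 <= S (cst 1) x by exact: posop_ge0.
rewrite -(sqrtr1 R) ltr_sqrt//; apply: (@le_lt_trans _ _ (\int[P]_x (S (cst 1) x))).
  apply: le_Rintegral => //.
  - exact: bm_integrable (bm_sqr bS1).
  - exact: bm_integrable bS1.
  - move=> x _; rewrite expr2 ler_piMl//.
    by rewrite S1E gerBl.
have -> : \int[P]_x S (cst 1) x = \int[P]_x (1 - Q (cst 1) x).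
  by apply: eq_Rintegral => x _; exact: S1E.
rewrite RintegralB//; last 2 first.
  exact: bm_integrable (bm_cst 1).
  exact: bm_integrable bQ1.
by rewrite Rintegral_cstP ltrBlDr ltrDl.
Qed.

Let P_decay : exists K r : R, [/\ 0 <= K, 0 < r < 1 &
  forall j f, bm f -> \int[P]_x f x = 0 -> n2 (iter j (iter N k) f) <= K * r ^+ j * n2 f].
Proof.
have [K [r [K0 r01 h]]] := gk; exists K, r; split => // j f bf f0.
have -> : iter j (iter N k) f = iter (j * N) k f.
  by elim: j => //= j ->; rewrite mulSn iterD.
apply: (le_trans (h _ _ bf f0)); rewrite ler_wpM2r ?n2_ge0// ler_wpM2l//.
have /andP[r0 r1] := r01.
by apply: ler_wiXn2l; [exact: ltW|exact: ltW|exact: leq_pmulr].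
Qed.

Let iterS_le j f : bm f -> (forall x, 0 <= f x) ->
  forall x, iter j S f x <= iter j (iter N k) f x.
Proof.
move=> bf f0; elim: j => // j ih x /=.
have b1 := posop_bm (posop_iter j pS) bf.
have b2 := posop_bm (posop_iter j pkN) bf.
apply: (@le_trans _ _ (S (iter j (iter N k) f) x)); first exact: posop_le.
by apply: S_le => // y; exact: (posop_ge0 (posop_iter j pkN)).
Qed.

(** Write f as its mean m plus g.  After one application of S, the constant part
    is multiplied in norm by s < 1; S^j is bounded by the j-th power of k^N, which
    has made g as small as needed. *)
Let S_step : exists (j : nat) (e : R), 0 <= e < 1 /\
  forall f, bm f -> (forall x, 0 <= f x) -> n2 (iter j.+1 S f) <= e * n2 f.
Proof.
have [K [r [K0 /andP[r0 r1] h]]] := P_decay.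
have s0 : 0 <= s := n2_ge0 _ _.
have [j jle] : exists j, K * r ^+ j <= (1 - s) / 2.
  have : (K * r ^+ n) @[n --> \oo] --> K * 0.
    by apply: cvgMr; apply: cvg_expr; rewrite ger0_norm// ltW.
  rewrite mulr0 => /cvgrPdist_le /(_ ((1 - s) / 2)).
  have -> : 0 < (1 - s) / 2 by have := s1; lra.
  move=> /(_ isT) [j _ /(_ j (leqnn _))] /=.
  rewrite sub0r normrN => jle; exists j; exact: le_trans (ler_norm _) jle.
exists j, (s + (1 - s) / 2); split; first by have := s1; lra.
move=> f bf f0; set m := \int[P]_x f x.
have m0 : 0 <= m by apply: Rintegral_ge0.
pose g x := f x - m.
have bg : bm g by apply: bmB => //; exact: (bm_cst m).
have g0 : \int[P]_x g x = 0.
  rewrite RintegralB//; last 2 first.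
    exact: bm_integrable bf.
    exact: (bm_integrable P (bm_cst m)).
  by rewrite Rintegral_cstP subrr.
have pj := markov_iter j mkN.
have bPg := posop_bm pj bg.
have Pf : iter j (iter N k) f = (fun x => m * cst 1 x + iter j (iter N k) g x).
  transitivity (iter j (iter N k) (fun x => m * cst 1 x + g x)).
    by congr (iter _ _ _); apply/funext => x; rewrite /g mulr1 addrC subrK.
  rewrite (posop_lin pj)//; last exact: bm_cst.
  by rewrite (markov_one pj).
have bPf := posop_bm pj bf.
have b1 : bm (cst 1 : T -> R) := bm_cst 1.
have bSj := posop_bm (posop_iter j pS) bf.
apply: (@le_trans _ _ (n2 (S (iter j (iter N k) f)))).
  apply: le_n2.
  - exact/bm_sqint/(posop_bm pS).
  - exact/bm_sqint/(posop_bm pS).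
  move=> x /=; rewrite ger0_norm; last first.
    by apply: (posop_ge0 pS) => // y; exact: (posop_ge0 (posop_iter j pS)).
  apply: le_trans (ler_norm _); apply: posop_le => // y; exact: iterS_le.
rewrite Pf (posop_lin pS)//; apply: (le_trans (n2D _ _)).
- by apply: bm_sqint; apply: bmZ; exact: (posop_bm pS).
- by apply: bm_sqint; exact: (posop_bm pS).
rewrite n2Z; last exact/bm_sqint/(posop_bm pS).
rewrite ger0_norm// mulrDl mulrC lerD//.
  rewrite ler_wpM2l//.
  exact: le_trans (ler_norm _) (norm_Rintegral_le_n2 (bm_sqint _ bf)).
apply: (le_trans (n2S bPg)); apply: (le_trans (h j g bg g0)).
apply: ler_pM => //; first by rewrite mulr_ge0// exprn_ge0// ltW.
  exact: n2_ge0.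
exact: n2_center (bm_sqint _ bf).
Qed.

Let S_decay : exists K r : R, [/\ 0 <= K, 0 < r < 1 &
  forall n f, bm f -> (forall x, 0 <= f x) -> n2 (iter n S f) <= K * r ^+ n * n2 f].
Proof.
have [j [e [e01 h]]] := S_step.
have [K [r [K0 r01 H]]] := geometric_of_step (ltn0Sn j) e01.
exists K, r; split => // n f bf f0.
have bi i : bm (iter i S f) by exact: (posop_bm (posop_iter i pS)).
apply: (H (fun i => n2 (iter i S f))) => i; first exact: n2_ge0.
  exact: (n2S (bi i)).
rewrite addnC iterD; apply: h => // x.
exact: (posop_ge0 (posop_iter i pS)).
Qed.

(** Apply k^N = S + Q repeatedly to a mean-zero f with |f| <= 1.  The part where Q
    acts last is uniformly small, because Q is controlled by the mean-square norm
    of the preceding iterate, which decays; the rest is S applied to the preceding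
    bound.  This gives bounds w_j that do not depend on f:
    w_0 = 1 and w_{j+1} = S w_j + M K r^j.  Their integrals decay because S itself decays on
    nonnegative functions. *)
Lemma minorization_bound : exists v : nat -> T -> R,
  [/\ forall m, bm (v m), forall m x, 0 <= v m x,
      exists K r : R, [/\ 0 <= K, 0 < r < 1 &
        forall m, \int[P]_x v m x <= K * r ^+ m] &
      forall m f, bm f -> \int[P]_x f x = 0 -> (forall x, `|f x| <= 1) ->
        forall x, `|iter m k f x| <= v m x].
Proof.
have [Kp [rp [Kp0 /andP[rp0 rp1] Hp]]] := P_decay.
have [Ks [rs [Ks0 /andP[rs0 rs1] Hs]]] := S_decay.
pose c j := M * (Kp * rp ^+ j).
have c0 j : 0 <= c j by rewrite /c !mulr_ge0// exprn_ge0// ltW.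
pose w := fix w j : T -> R := if j is i.+1 then fun x => S (w i) x + c i
                              else cst 1.
have wS j : w j.+1 = (fun x => S (w j) x + c j) by [].
have bw j : bm (w j).
  elim: j => [|j ih]; first exact: (bm_cst 1).
  by rewrite wS; apply: bmD; [exact: (posop_bm pS)|exact: (bm_cst (c j))].
have w0 j x : 0 <= w j x.
  elim: j x => [|j ih] x; first exact: ler01.
  by rewrite wS addr_ge0//; exact: (posop_ge0 pS).
pose t := Num.max rp rs.
have t01 : 0 < t < 1 by rewrite /t lt_max rp0 gt_max rp1 rs1.
have /andP[t0 t1] := t01.
pose A := Ks + M * Kp * Ks / t.
have A0 : 0 <= M * Kp * Ks / t by rewrite divr_ge0 ?(ltW t0)// !mulr_ge0.
have rst i : rs ^+ i <= t ^+ i.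
  by apply: lerXn2r; rewrite ?nnegrE ?(ltW rs0) ?(ltW t0)// /t le_max lexx orbT.
have rpt i : rp ^+ i <= t ^+ i.
  by apply: lerXn2r; rewrite ?nnegrE ?(ltW rp0) ?(ltW t0)// /t le_max lexx.
(* The powers of S are carried along since w_{j+1} contains S w_j; the factor j.+1
   counts the terms of the expansion of w_j. *)
have Hw j i : n2 (iter i S (w j)) <= A * j.+1%:R * t ^+ (i + j).
  elim: j i => [|j ih] i.
    rewrite addn0 mulr1; have := @Hs i (cst 1) (bm_cst 1) (fun=> ler01).
    rewrite (n2_cst P (1 : R)) normr1 mulr1 => /le_trans; apply.
    by apply: ler_pM => //; [rewrite exprn_ge0// ltW|rewrite lerDl].
  have pi := posop_iter i pS.
  have bSw := posop_bm pS (bw j).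
  have -> : iter i S (w j.+1) =
      (fun x => iter i.+1 S (w j) x + c j * iter i S (cst 1) x).
    rewrite wS; transitivity (iter i S (fun x => c j * cst 1 x + S (w j) x)).
      by congr (iter _ _ _); apply/funext => x; rewrite /= mulr1 addrC.
    rewrite (posop_lin pi)//; last exact: bm_cst.
    by apply/funext => x; rewrite iterSr addrC.
  have b1 := posop_bm pi (bm_cst 1).
  apply: (le_trans (n2D _ _)).
  - by apply: bm_sqint; rewrite iterSr; exact: (posop_bm pi).
  - by apply: bm_sqint; exact: bmZ.
  rewrite n2Z; last exact: bm_sqint.
  rewrite ger0_norm//.
  have h1 := ih i.+1.
  have h2 : c j * n2 (iter i S (cst 1)) <= M * Kp * Ks / t * t ^+ (i + j.+1).
    have := @Hs i (cst 1) (bm_cst 1) (fun=> ler01).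
    rewrite (n2_cst P (1 : R)) normr1 mulr1 => /(ler_wpM2l (c0 j)) /le_trans; apply.
    have -> : M * Kp * Ks / t * t ^+ (i + j.+1) = (M * Kp * Ks) * (t ^+ j * t ^+ i).
      rewrite addnS exprS exprD; field; exact: lt0r_neq0.
    have -> : c j * (Ks * rs ^+ i) = (M * Kp * Ks) * (rp ^+ j * rs ^+ i).
      by rewrite /c; ring.
    by rewrite ler_wpM2l ?mulr_ge0// ler_pM ?exprn_ge0// ltW.
  apply: (le_trans (lerD h1 h2)).
  rewrite addSnnS -mulrDl ler_wpM2r ?exprn_ge0 ?(ltW t0)//.
  by rewrite -[j.+2%:R]natr1 mulrDr mulr1 lerD2l /A lerDr.
exists (fun m => w (m %/ N)%N); split => //.
  have [K1 [r1 [K10 r101 h1]]] := linear_geometric t01.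
  have [K2 [r2 [K20 r201 h2]]] := divn_geometric r101 N0.
  have A00 : 0 <= A by rewrite addr_ge0.
  exists (A * (K1 * K2)), r2; split=> // [|m]; first by rewrite !mulr_ge0.
  apply: (le_trans (ler_norm _)).
  apply: (le_trans (norm_Rintegral_le_n2 (bm_sqint _ (bw _)))).
  have := Hw (m %/ N)%N 0%N; rewrite add0n => /le_trans; apply.
  rewrite -!mulrA ler_wpM2l//; apply: (le_trans (h1 _)).
  by rewrite ler_wpM2l.
move=> m f bf f0 f1 x.
have main j g : bm g -> \int[P]_x g x = 0 -> (forall x, `|g x| <= 1) ->
    forall x, `|iter j (iter N k) g x| <= w j x.
  move=> bg g0 g1; elim: j => [|j ih] y; first exact: g1.
  set h := iter j (iter N k) g.
  have bh : bm h by exact: (posop_bm (posop_iter j pkN)).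
  have -> : iter j.+1 (iter N k) g y = S h y + Q h y by rewrite /S subrK.
  rewrite wS (le_trans (ler_normD _ _))// lerD//.
    apply: (le_trans (posop_norm pS bh y)).
    by apply: posop_le => //; exact: bm_norm.
  apply: (le_trans (QM bh y)); rewrite ler_wpM2l//.
  apply: (le_trans (Hp j g bg g0)); rewrite ler_piMr//.
    by rewrite mulr_ge0// exprn_ge0// ltW.
  rewrite -[leRHS](normr1 R) -(n2_cst P (1 : R)); apply: le_n2.
  - exact: bm_sqint.
  - exact: bm_sqint (bm_cst 1).
  - by move=> z; rewrite normr1.
have mkr := markov_iter (m %% N)%N mk.
have -> : iter m k f x = iter (m %/ N)%N (iter N k) (iter (m %% N)%N k f) x.
  have -> : forall j g, iter j (iter N k) g = iter (j * N) k g.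
    by elim=> //= j ih g; rewrite mulSn iterD ih.
  by rewrite -iterD -divn_eq.
have bkf := posop_bm mkr bf.
apply: main => // [|y]; first by rewrite (markov_int mkr).
apply: (le_trans (posop_norm mkr bf y)).
rewrite -[leRHS]/(cst 1 y) -(markov_cst 1 mkr).
by apply: (posop_le mkr) => //; [exact: bm_norm|exact: bm_cst].
Qed.

End minorization.

(** * Densities *)
Section weighted_measure.
Local Open Scope ereal_scope.
Context d (T : measurableType d) (R : realType) (mu : {measure set T -> \bar R}).
Variables (g : T -> R) (g0 : forall x, (0 <= g x)%R) (mg : measurable_fun setT g).

(** The measure of density g.  The two properties of g are arguments so that the
    measure structure can be attached to the function. *)
Definition wmeas (g0 : forall x, (0 <= g x)%R) (mg : measurable_fun setT g)
  (A : set T) := \int[mu]_(x in A) (g x)%:E.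
Local Notation wm := (wmeas g0 mg).

Let wm0 : wm set0 = 0. Proof. by rewrite /wmeas integral_set0. Qed.

Let wm_ge0 A : 0 <= wm A.
Proof. by apply: integral_ge0 => x _; rewrite lee_fin. Qed.

Let wm_sigma_additive : semi_sigma_additive wm.
Proof.
move=> /= F mF tF mUF; rewrite /wmeas; apply: cvg_toP.
  apply: ereal_nondecreasing_is_cvgn => m n mn.
  apply: lee_sum_nneg_natr => // k _ _.
  by apply: integral_ge0 => x _; rewrite lee_fin.
rewrite ge0_integral_bigcup//=; last by move=> x _; rewrite lee_fin.
exact/measurable_EFinP/measurable_funTS.
Qed.

HB.instance Definition _ := isMeasure.Build _ _ _ wm wm0 wm_ge0 wm_sigma_additive.

Import HBNNSimple.

Let integral_wmeas_nnsfun (f : {nnsfun T >-> R}) :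
  \int[wm]_x (f x)%:E = \int[mu]_x ((f x)%:E * (g x)%:E).
Proof.
under [LHS]eq_integral do rewrite fimfunE -fsumEFin//.
rewrite [LHS]ge0_integral_fsum//; last 2 first.
  - by move=> r; exact/measurable_EFinP/measurableT_comp.
  - by move=> n x _; rewrite EFinM nnfun_muleindic_ge0.
under [RHS]eq_integral.
  move=> x xD; rewrite fimfunE -fsumEFin// ge0_mule_fsuml; last first.
    by move=> r; rewrite EFinM nnfun_muleindic_ge0.
  over.
rewrite [RHS]ge0_integral_fsum//; last 2 first.
  - move=> r; apply: emeasurable_funM => //.
      by apply/measurable_EFinP; do 2 apply/measurableT_comp => //.
    exact/measurable_EFinP.
  - move=> n x _; apply: mule_ge0; last by rewrite lee_fin.
    by rewrite EFinM nnfun_muleindic_ge0.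
apply: eq_fsbigr => r _; rewrite integralZl_indic_nnsfun// integral_indic//.
rewrite setIT.
under [RHS]eq_integral do rewrite EFinM -muleA.
have [r0|r0] := leP 0%R r; last first.
  rewrite preimage_nnfun0// measure0 mule0 integral0_eq// => x _.
  by rewrite indic0 mul0e mule0.
rewrite ge0_integralZl//; last 2 first.
  - apply: emeasurable_funM; [exact/measurable_EFinP/measurable_indic|exact/measurable_EFinP].
  - by move=> x _; apply: mule_ge0; rewrite lee_fin.
congr (_ * _); rewrite -[LHS]/(\int[mu]_(x in _) (g x)%:E) integral_mkcond.
apply: eq_integral => x _.
by rewrite patchE indicE; case: ifPn => _; rewrite ?mul1e ?mul0e.
Qed.

(** By simple functions and monotone convergence. *)
Lemma integral_wmeas (f : T -> \bar R) :
  (forall x, 0 <= f x) -> measurable_fun setT f ->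
  \int[wm]_x f x = \int[mu]_x (f x * (g x)%:E).
Proof.
move=> f0 mf; pose f_ := nnsfun_approx measurableT mf.
transitivity (lim (\int[wm]_x (f_ n x)%:E @[n --> \oo])).
  rewrite -monotone_convergence//=.
  - apply: eq_integral => ? /[!inE] xD; apply/esym/cvg_lim => //=.
    exact: cvg_nnsfun_approx.
  - by move=> n; exact/measurable_EFinP/measurable_funTS.
  - by move=> n ? _; rewrite lee_fin.
  - by move=> ? _ ? ? mn; rewrite lee_fin; exact/lefP/nd_nnsfun_approx.
transitivity (lim (\int[mu]_x ((f_ n x)%:E * (g x)%:E) @[n --> \oo])).
  by apply: congr_lim; apply/funext => n /=; exact: integral_wmeas_nnsfun.
rewrite -monotone_convergence//=.
- apply: eq_integral => x _; apply/cvg_lim => //=.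
  by apply: cvgeZr => //; exact: cvg_nnsfun_approx.
- move=> n; apply: emeasurable_funM; last exact/measurable_EFinP.
  exact/measurable_EFinP/measurable_funTS.
- by move=> n x _; apply: mule_ge0; rewrite lee_fin.
- move=> x _ a b ab; rewrite lee_wpmul2r ?lee_fin//.
  exact/lefP/nd_nnsfun_approx.
Qed.

End weighted_measure.

Section sub_sigma.
Context d (T : measurableType d) (R : realType) (P : probability T R).
Variables (G F : set (set T)).
Hypotheses (mG : G `<=` measurable) (GI : setI_closed G) (GT : G setT).
Hypothesis FG : F `<=` <<s G >>.

Let GsT := g_sigma_algebraType G.

Let sGm : <<s G >> `<=` measurable.
Proof. exact: (smallest_sub (@sigma_algebra_measurable _ T) mG). Qed.

Lemma measurable_wrt_measurable (f : T -> R) : measurable_wrt F f ->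
  measurable_fun setT f.
Proof. by move=> mf _ Y mY; rewrite setTI; apply: sGm; apply: FG; exact: mf. Qed.

(** Two finite measures that agree on a pi-system agree on the sigma-field G' it
    generates; the integral of an F-measurable function is that of the image
    measure under the identity onto (T, G'), which only remembers this restriction. *)
Lemma eq_integral_sub_sigma (m1 m2 : {measure set T -> \bar R}) (f : T -> R) :
  measurable_wrt F f -> (forall x, 0 <= f x) -> (m1 setT < +oo)%E ->
  (forall A, G A -> m1 A = m2 A) ->
  (\int[m1]_x (f x)%:E = \int[m2]_x (f x)%:E)%E.
Proof.
move=> mf f0 m1oo m12.
have m12s A : <<s G >> A -> m1 A = m2 A.
  apply: (@g_sigma_algebra_measure_unique _ R T G mG (fun=> setT)) => //.
  by apply/seteqP; split => // x _; exists 0%N.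
have mid : measurable_fun setT (id : T -> GsT).
  by move=> _ Y mY; rewrite setTI preimage_id; exact: (sGm mY).
have mfG : measurable_fun setT (f : GsT -> R).
  by move=> _ Y mY; rewrite setTI; apply: FG; exact: mf.
have h (m : {measure set T -> \bar R}) :
    (\int[m]_x (f x)%:E = \int[pushforward m (id : T -> GsT)]_x (f x)%:E)%E.
  rewrite [RHS]ge0_integral_pushforward//=; first exact/measurable_EFinP.
  by move=> x _; rewrite lee_fin.
rewrite !h; apply: eq_measure_integral => A mA _.
by rewrite /pushforward /= m12s.
Qed.

Let eq_ge0 (g1 g2 f : T -> R) : bm g1 -> bm g2 ->
  (forall x, 0 <= g1 x) -> (forall x, 0 <= g2 x) ->
  (forall A, G A -> \int[P]_(x in A) g1 x = \int[P]_(x in A) g2 x) ->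
  measurable_wrt F f -> (forall x, 0 <= f x) ->
  \int[P]_x (f x * g1 x) = \int[P]_x (f x * g2 x).
Proof.
move=> b1 b2 g10 g20 h mf f0.
have [mg1 _] := b1; have [mg2 _] := b2.
have mfT := measurable_wrt_measurable mf.
have fin (g : T -> R) A : bm g -> measurable A ->
    (\int[P]_(x in A) (g x)%:E = (\int[P]_(x in A) g x)%:E)%E.
  move=> bg mA; rewrite /Rintegral fineK//.
  by apply: integrable_fin_num => //; apply: (integrableS measurableT) => //;
    exact: bm_integrable.
congr fine.
transitivity (\int[wmeas P g10 mg1]_x (f x)%:E)%E.
  rewrite (integral_wmeas _ g10 mg1)//.
  exact/measurable_EFinP.
transitivity (\int[wmeas P g20 mg2]_x (f x)%:E)%E; last first.
  rewrite (integral_wmeas _ g20 mg2)//.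
  exact/measurable_EFinP.
apply: eq_integral_sub_sigma => //.
  by rewrite [ltLHS](fin g1)// ltry.
by move=> A GA; rewrite [LHS](fin g1) ?[RHS](fin g2) ?h//; exact: mG.
Qed.

(** Shifted by a constant, the densities g1 and g2 become nonnegative and define
    measures that agree on the pi-system; f is split into its positive and negative
    parts. *)
Lemma eq_Rintegral_sub_sigma (g1 g2 f : T -> R) : bm g1 -> bm g2 ->
  (forall A, G A -> \int[P]_(x in A) g1 x = \int[P]_(x in A) g2 x) ->
  measurable_wrt F f -> P.-integrable setT (EFin \o f) ->
  \int[P]_x (f x * g1 x) = \int[P]_x (f x * g2 x).
Proof.
move=> b1 b2 h mf fi.
have [mg1 [c1 gc1]] := b1; have [mg2 [c2 gc2]] := b2.
have mfT := measurable_wrt_measurable mf.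
pose c := Num.max c1 c2.
have bc (g : T -> R) : bm g -> bm (fun x => g x + c).
  by move=> bg; apply: bmD => //; exact: (bm_cst c).
have g10 x : 0 <= g1 x + c.
  have := gc1 x; have : c1 <= c by rewrite /c le_max lexx.
  by rewrite ler_norml => ? /andP[? ?]; lra.
have g20 x : 0 <= g2 x + c.
  have := gc2 x; have : c2 <= c by rewrite /c le_max lexx orbT.
  by rewrite ler_norml => ? /andP[? ?]; lra.
have int_A (g : T -> R) A : bm g -> measurable A -> P.-integrable A (EFin \o g).
  by move=> bg mA; apply: (integrableS measurableT) => //; exact: bm_integrable.
have hc A : G A ->
    \int[P]_(x in A) (g1 x + c) = \int[P]_(x in A) (g2 x + c).
  move=> GA; have mA := mG GA.
  rewrite !RintegralD ?h//.
  - exact: int_A.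
  - exact: (int_A _ _ (bm_cst c)).
  - exact: int_A.
  - exact: (int_A _ _ (bm_cst c)).
have mul (u g : T -> R) : P.-integrable setT (EFin \o u) -> bm g ->
    P.-integrable setT (EFin \o (fun x => u x * g x)).
  move=> ui [mg [M gM]].
  have := @integrableMl _ _ _ P setT measurableT (EFin \o u) g ui mg.
  apply => //; exists M; split; first by rewrite num_real.
  by move=> y My x _ /=; rewrite (le_trans (gM x))// ltW.
pose fp x := Num.max (f x) 0; pose fm x := Num.max (- f x) 0.
have fE x : f x = fp x - fm x.
  rewrite /fp /fm; case: (leP (f x) 0) => f0.
    by rewrite max_l ?oppr_ge0// opprK add0r.
  by rewrite max_r ?subr0// oppr_le0 ltW.
have fp0 x : 0 <= fp x by rewrite /fp le_max lexx orbT.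
have fm0 x : 0 <= fm x by rewrite /fm le_max lexx orbT.
have max_wrt (u : T -> R) : (u = f \/ u = (fun x => - f x)) ->
    measurable_wrt F (fun x => Num.max (u x) 0) /\
    P.-integrable setT (EFin \o (fun x => Num.max (u x) 0)).
  move=> uf.
  have mu : measurable_fun setT (u : T -> R).
    by case: uf => ->//; exact: measurableT_comp.
  have umax (D : set R) : (fun x => Num.max (u x) 0) @^-1` D =
     f @^-1` ((fun y => Num.max (if `[< u = f >] then y else - y) 0) @^-1` D).
    apply/seteqP; split => x /=; case: asboolP => [->//|nuf];
      by case: uf => // ->.
  split.
    move=> D mD; rewrite umax; apply: mf.
    have mh : measurable_fun setT
        (fun y : R => Num.max (if `[< u = f >] then y else - y) 0).
      by apply: measurable_maxr => //; case: asboolP => // _; exact: oppr_measurable.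
    by rewrite -[X in measurable X]setTI; exact: mh.
  apply: le_integrable fi => //.
    by apply/measurable_EFinP; exact: measurable_maxr.
  move=> x _ /=; rewrite lee_fin.
  have key (y : R) : `|Num.max y 0| <= `|y|.
    by case: (leP y 0) => // _; rewrite normr0.
  by rewrite (le_trans (key _))//; case: uf => ->//; rewrite normrN.
have [mfp ifp] := max_wrt f (or_introl erefl).
have [mfm ifm] := max_wrt _ (or_intror erefl).
have hp := eq_ge0 (bc _ b1) (bc _ b2) g10 g20 hc mfp fp0.
have hm := eq_ge0 (bc _ b1) (bc _ b2) g10 g20 hc mfm fm0.
have split_int (g : T -> R) : bm g -> \int[P]_x (f x * g x) =
   (\int[P]_x (fp x * (g x + c)) - \int[P]_x (fm x * (g x + c))) -
   \int[P]_x (f x * c).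
  move=> bg; rewrite -RintegralB//; [|exact: (mul fp _ ifp (bc _ bg))|
    exact: (mul fm _ ifm (bc _ bg))].
  rewrite -RintegralB//; last exact: (mul f _ fi (bm_cst c)).
    by apply: eq_Rintegral => x _; rewrite fE; ring.
  exact: (integrableB measurableT (mul fp _ ifp (bc _ bg))
    (mul fm _ ifm (bc _ bg))).
by rewrite (split_int _ b1) (split_int _ b2) hp hm.
Qed.

End sub_sigma.

Section bounded_density.
Context d (T : measurableType d) (R : realType) (mu : probability T R).

(** The Radon-Nikodym density can exceed M only on a null set, because nu is at
    most M mu on the very set where it does; there it is truncated at M. *)
Lemma bounded_density (nu : {measure set T -> \bar R}) (M : R) : 0 <= M ->
  (forall A, measurable A -> (nu A <= M%:E * mu A)%E) ->
  exists h : T -> R, [/\ measurable_fun setT h, forall x, 0 <= h x <= M &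
    forall A, measurable A -> nu A = (\int[mu]_(x in A) (h x)%:E)%E].
Proof.
move=> M0 numu.
have nuoo : (nu setT < +oo)%E.
  by apply: (le_lt_trans (numu _ measurableT)); rewrite probability_setT mule1 ltry.
pose nu' := mfrestr measurableT nuoo.
have nu'E A : nu' A = nu A by rewrite /nu' /mfrestr /mrestr setIT.
have dom : nu' `<< mu.
  apply/null_content_dominatesP => A mA muA0; rewrite nu'E; apply/eqP.
  by rewrite eq_le measure_ge0 andbT (le_trans (numu _ mA))// muA0 mule0.
have [f [f0 ffin fint fE]] := radon_nikodym_sigma_finite dom.
have nuE A : measurable A -> nu A = (\int[mu]_(x in A) f x)%E.
  by move=> mA; rewrite -fE//; exact/esym/nu'E.
pose g x := fine (f x).
have gE x : (g x)%:E = f x by rewrite /g fineK.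
have gEf : EFin \o g = f by apply/funext => x /=; exact: gE.
have g0 x : 0 <= g x by rewrite -lee_fin gE.
have mg : measurable_fun setT g.
  by apply/measurable_EFinP; rewrite gEf; exact: measurable_int fint.
pose E := [set x | M < g x].
have mE : measurable E.
  have := mg measurableT _ (measurable_itv `]M, +oo[).
  by congr measurable; apply/seteqP; split => x /=; rewrite in_itv/= andbT => //;
    case.
have gintE : mu.-integrable E (EFin \o g).
  by rewrite gEf; exact: integrableS fint.
have intE : (\int[mu]_(x in E) `|(g x - M)%:E| = 0)%E.
  apply/eqP; rewrite eq_le; apply/andP; split; last exact: integral_ge0.
  under eq_integral => x xE.
    rewrite gee0_abs; last by move: xE; rewrite inE lee_fin subr_ge0 => /ltW.
    rewrite EFinB; over.
  rewrite integralB//; last exact: finite_measure_integrable_cst.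
  rewrite integral_cst// -[X in (X - _)%E]/(\int[mu]_(x in E) (EFin \o g) x)%E gEf.
  rewrite -nuE// sube_le0; exact: numu.
have aeE : mu E = 0%E.
  have := (ae_eq_integral_abs mu mE _).1 intE.
  have mgM : measurable_fun E (fun x => (g x - M)%:E).
    apply/measurable_EFinP/measurable_funTS; exact: measurable_funB.
  move=> /(_ mgM) [B [mB muB EB]]; apply/eqP; rewrite eq_le measure_ge0 andbT -muB.
  apply: le_measure; rewrite ?inE// => x Ex; apply: EB => /= /(_ Ex) [] /eqP.
  by rewrite subr_eq0 => /eqP gM; move: Ex; rewrite /E /= gM ltxx.
exists (fun x => Num.min (g x) M); split.
- exact: measurable_minr.
- by move=> x; rewrite le_min g0 M0 ge_min lexx orbT.
move=> A mA; rewrite nuE//; apply: ae_eq_integral => //.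
- exact: measurable_funTS (measurable_int _ fint).
- by apply/measurable_EFinP/measurable_funTS; exact: measurable_minr.
exists E; split => // x /= /not_implyP[_]; apply: contra_notP => nEx.
rewrite -gE; congr EFin; rewrite min_l//.
by rewrite leNgt; apply/negP.
Qed.

End bounded_density.

(** * A countable algebra that tests inequalities between measures *)
Section countable_algebra.
Context (R : realType).

(** Boolean formulas over rational rays; trees of unexpected arity denote the empty
    set. *)
Fixpoint ray_formula (t : GenTree.tree rat) : set R :=
  match t with
  | GenTree.Leaf q => `]-oo, ratr q[
  | GenTree.Node _ [:: t1] => ~` ray_formula t1
  | GenTree.Node _ [:: t1; t2] => ray_formula t1 `|` ray_formula t2
  | _ => set0
  end.

(** Uncountably many almost sure inequalities, one for each Borel set, reduce to the
    countably many ones indexed by this enumeration. *)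
Definition ray_algebra (n : nat) : set R :=
  if unpickle n is Some t then ray_formula t else set0.

Lemma ray_algebra_pickle t : ray_algebra (pickle t) = ray_formula t.
Proof. by rewrite /ray_algebra pickleK. Qed.

Lemma ray_formula_measurable : forall t, measurable (ray_formula t).
Proof.
fix ih 1 => -[q|n [|t1 [|t2 [|t3 l]]]] //=.
- by apply: measurableC; exact: ih.
- by apply: measurableU; exact: ih.
Qed.

Lemma ray_algebra_measurable n : measurable (ray_algebra n).
Proof.
by rewrite /ray_algebra; case: unpickle => // t; exact: ray_formula_measurable.
Qed.

Let symdiff (A B : set R) := (A `\` B) `|` (B `\` A).

Let m_symdiff (A B : set R) : measurable A -> measurable B ->
  measurable (symdiff A B).
Proof. by move=> mA mB; apply: measurableU; exact: measurableD. Qed.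

Section approximation.
Variable m : {measure set R -> \bar R}.
Hypothesis moo : (m setT < +oo)%E.

Let approximable (B : set R) := measurable B /\
  forall e : R, 0 < e -> exists t, (m (symdiff B (ray_formula t)) < e%:E)%E.

Let le_m (A B : set R) : measurable A -> measurable B -> A `<=` B ->
  (m A <= m B)%E.
Proof. by move=> mA mB AB; apply: le_measure => //; rewrite inE. Qed.

Let approximable_formula t : approximable (ray_formula t).
Proof.
split; first exact: ray_formula_measurable.
move=> e e0; exists t.
by rewrite /symdiff setDv setUid measure0 lte_fin.
Qed.

Let approximableC B : approximable B -> approximable (~` B).
Proof.
move=> [mB aB]; split; first exact: measurableC.
move=> e /aB[t te]; exists (GenTree.Node 0 [:: t]) => /=.
by rewrite /symdiff !setDE !setCK setIC [X in _ `|` X]setIC -!setDE setUC.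
Qed.

Let approximableU A B : approximable A -> approximable B -> approximable (A `|` B).
Proof.
move=> [mA aA] [mB aB]; split; first exact: measurableU.
move=> e e0; have e20 : 0 < e / 2 by rewrite divr_gt0.
have [s se] := aA _ e20; have [t te] := aB _ e20.
exists (GenTree.Node 0 [:: s; t]) => /=.
have ms := ray_formula_measurable s; have mt := ray_formula_measurable t.
apply: (@le_lt_trans _ _ (m (symdiff A (ray_formula s) `|` symdiff B (ray_formula t)))).
  apply: le_m.
  - by apply: m_symdiff; exact: measurableU.
  - by apply: measurableU; exact: m_symdiff.
  - by rewrite /symdiff => x /=; tauto.
apply: (@le_lt_trans _ _ (m (symdiff A (ray_formula s)) + m (symdiff B (ray_formula t)))%E).
  by apply: measureU2; exact: m_symdiff.
by rewrite [e]splitr EFinD lteD.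
Qed.

Let approximable_bigcup (F : nat -> set R) :
  (forall n, approximable (F n)) -> approximable (\bigcup_n F n).
Proof.
move=> aF; have mF n : measurable (F n) by case: (aF n).
have mU : measurable (\bigcup_n F n) by exact: bigcup_measurable.
split => // e e0; have e20 : 0 < e / 2 by rewrite divr_gt0.
pose G n := \big[setU/set0]_(i < n) F i.
have aG n : approximable (G n).
  rewrite /G; elim: n => [|n ih]; last by rewrite big_ord_recr/=; exact: approximableU.
  by rewrite big_ord0; exact: (approximable_formula (GenTree.Node 0 [::])).
have mG n : measurable (G n) by case: (aG n).
pose H n := (\bigcup_n F n) `\` G n.
have mH n : measurable (H n) by exact: measurableD.
have H0 : \bigcap_n H n = set0.
  rewrite -subset0 => x Hx; have [[n _ Fnx] _] := Hx 0%N I.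
  have [_] := Hx n.+1 I; apply.
  by rewrite /G big_ord_recr/=; right.
have cH : m (H n) @[n --> \oo] --> m (\bigcap_n H n).
  apply: nonincreasing_cvg_mu => //.
  - by apply: le_lt_trans moo; exact: le_m.
  - by rewrite H0.
  move=> a b ab; apply/subsetPset; apply: setDS.
  by move=> x; rewrite /G -!bigcup_mkord => -[i /= ia Fix]; exists i => //=;
    exact: leq_trans ab.
have [n Hn] : exists n, (m (H n) < (e / 2)%:E)%E.
  move: cH; rewrite H0 measure0 => cH.
  have : \forall n \near \oo, (m (H n) < (e / 2)%:E)%E.
    by apply: (cH [set u | (u < (e / 2)%:E)%E]); apply: open_ereal_lt'; rewrite lte_fin.
  by case=> N _ /(_ N (leqnn _)); exists N.
have [t te] := (aG n).2 _ e20; exists t.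
have mt := ray_formula_measurable t.
apply: (@le_lt_trans _ _ (m (H n `|` symdiff (G n) (ray_formula t)))).
  apply: le_m.
  - exact: m_symdiff.
  - by apply: measurableU => //; exact: m_symdiff.
  move=> x [[Ux nt]|[tx nU]].
    by have [Gx|nGx] := pselect (G n x); [right; left|left].
  right; right; split => //; apply: contra_not nU.
  by rewrite /G -bigcup_mkord => -[i _ Fi]; exists i.
apply: (@le_lt_trans _ _ (m (H n) + m (symdiff (G n) (ray_formula t)))%E).
  by apply: measureU2 => //; exact: m_symdiff.
by rewrite [e]splitr EFinD lteD.
Qed.

Let approximable_measurable (B : set R) : measurable B -> approximable B.
Proof.
have mE : (measurable : set (set R)) = <<s @RGenInftyO.G R >>.
  exact: (@RGenInftyO.measurableE R).
rewrite mE => mB; apply: mB; split.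
  split; [exact: (approximable_formula (GenTree.Node 0 [::]))| |].
    by move=> A aA; rewrite setTD; exact: approximableC.
  by move=> F aF; exact: approximable_bigcup.
move=> _ [x ->].
pose F n := if (unpickle n : option rat) is Some q then
  (if ratr q <= x then `]-oo, ratr q[%classic else set0) else set0 : set R.
have -> : `]-oo, x[%classic = \bigcup_n F n.
  apply/seteqP; split => y /=; rewrite in_itv/=.
    move=> yx; have [q] := rat_in_itvoo yx.
    rewrite in_itv/= => /andP[yq qx]; exists (pickle q); first exact: I.
    by rewrite /F pickleK (ltW qx)/= in_itv/=.
  move=> [n _]; rewrite /F; case: unpickle => // q; case: ifPn => // qx.
  by rewrite /= in_itv/= => /lt_le_trans; exact.
apply: approximable_bigcup => n; rewrite /F.
case: unpickle => [q|]; last exact: (approximable_formula (GenTree.Node 0 [::])).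
case: ifP => _; last exact: (approximable_formula (GenTree.Node 0 [::])).
exact: (approximable_formula (GenTree.Leaf q)).
Qed.

(** The sets that can be approximated by formulas form a sigma-field containing the
    rays. *)
Lemma ray_algebra_approx (B : set R) (e : R) : measurable B -> 0 < e ->
  exists n, (m (B `\` ray_algebra n) < e%:E)%E /\
            (m (ray_algebra n `\` B) < e%:E)%E.
Proof.
move=> mB e0; have [_ /(_ _ e0)[t te]] := approximable_measurable mB.
have mt := ray_formula_measurable t.
exists (pickle t); rewrite ray_algebra_pickle; split; apply: le_lt_trans te;
  apply: le_m; rewrite /symdiff; try exact: measurableD; try exact: m_symdiff.
  by left.
by right.
Qed.

End approximation.

(** Approximate B for the measure m1 + m2. *)
Lemma ray_algebra_le (m1 m2 : {measure set R -> \bar R}) (c : R) :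
  (m1 setT < +oo)%E -> (m2 setT < +oo)%E ->
  (forall n, (m1 (ray_algebra n) <= m2 (ray_algebra n) + c%:E)%E) ->
  forall B, measurable B -> (m1 B <= m2 B + c%:E)%E.
Proof.
move=> m1oo m2oo h B mB; apply/lee_addgt0Pr => e e0.
have e20 : 0 < e / 2 by rewrite divr_gt0.
have moo : (measure_add m1 m2 setT < +oo)%E.
  by rewrite measure_addE lte_add_pinfty.
have [n [n1 n2]] := ray_algebra_approx moo mB e20.
set E := ray_algebra n in n1 n2; have mE := ray_algebra_measurable n.
rewrite -[X in (X < _)%E]/(measure_add m1 m2 _) measure_addE in n1.
rewrite -[X in (X < _)%E]/(measure_add m1 m2 _) measure_addE in n2.
have m1BE : (m1 (B `\` E) <= (e / 2)%:E)%E.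
  by apply/ltW; apply: le_lt_trans n1; rewrite leeDl.
have m2EB : (m2 (E `\` B) <= (e / 2)%:E)%E.
  by apply/ltW; apply: le_lt_trans n2; rewrite leeDr.
have m1B : (m1 B <= m1 E + m1 (B `\` E))%E.
  apply: (@le_trans _ _ (m1 (E `|` (B `\` E)))); last first.
    by apply: measureU2 => //; exact: measurableD.
  apply: le_measure; rewrite ?inE//.
    by apply: measurableU => //; exact: measurableD.
  by move=> x Bx; have [Ex|nEx] := pselect (E x); [left|right].
have m2E : (m2 E <= m2 B + m2 (E `\` B))%E.
  apply: (@le_trans _ _ (m2 (B `|` (E `\` B)))); last first.
    by apply: measureU2 => //; exact: measurableD.
  apply: le_measure; rewrite ?inE//.
    by apply: measurableU => //; exact: measurableD.
  by move=> x Ex; have [Bx|nBx] := pselect (B x); [left|right].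
apply: (le_trans m1B); apply: (le_trans (leeD (h n) m1BE)).
apply: (@le_trans _ _ (m2 B + m2 (E `\` B) + c%:E + (e / 2)%:E)%E).
  by rewrite leeD2r// leeD2r.
apply: (@le_trans _ _ (m2 B + (e / 2)%:E + c%:E + (e / 2)%:E)%E).
  by rewrite leeD2r// leeD2r// leeD2l.
by rewrite -!addeA leeD2l// -!EFinD lee_fin; lra.
Qed.

End countable_algebra.

(** * Disintegration and splitting of uniform variables *)
Section uniform_law.
Context (R : realType).

Definition borel_id (x : measurableTypeR R) : R := x.

Let measurable_borel_id : measurable_fun setT borel_id.
Proof. by move=> _ Y mY; rewrite setTI. Qed.

HB.instance Definition _ := isMeasurableFun.Build _ _ (measurableTypeR R) R
  borel_id measurable_borel_id.

(** [uniform_prob] lives on the Lebesgue-measure copy of the real line; its image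
    under the identity is the same law for the default Borel structure. *)
Definition U : probability R R := distribution (uniform_prob (@ltr01 R)) borel_id.

Lemma U_E A : U A = uniform_prob (@ltr01 R) A. Proof. by []. Qed.

Lemma U_itv (a : R) : 0 <= a <= 1 -> U `]-oo, a]%classic = a%:E.
Proof.
move=> /andP[a0 a1].
rewrite U_E /uniform_prob integral_uniform_pdf.
have -> : `]-oo, a]%classic `&` `[0, 1]%classic = `[0, a]%classic :> set R.
  apply/seteqP; split => x /=; rewrite !in_itv/=.
    by move=> [xa /andP[-> _]].
  by move=> /andP[x0 xa]; rewrite xa x0 (le_trans xa).
rewrite (eq_integral (fun=> 1%:E)); last first.
  move=> x; rewrite inE/= in_itv/= => /andP[x0 xa].
  by rewrite /uniform_pdf x0 (le_trans xa)//= subr0 invr1.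
rewrite integral_cst//= mul1e lebesgue_measure_itv/= lte_fin.
move: a0; rewrite le_eqVlt => /predU1P[<-|->]; first by rewrite ltxx.
by rewrite -EFinD subr0.
Qed.

Lemma U01 : U `[0, 1]%classic = 1%E.
Proof. by rewrite U_E /uniform_prob integral_uniform_pdf1. Qed.

End uniform_law.
Arguments U : simpl never.

Section null_sets.
Context d (T : measurableType d) (R : realType) (P : probability T R).

Lemma measurable_lt_fun (g1 g2 : T -> R) :
  measurable_fun setT g1 -> measurable_fun setT g2 ->
  measurable [set x | g1 x < g2 x].
Proof. by move=> m1 m2; have := measurable_fun_ltr m1 m2 => /(_ measurableT [set true] I); rewrite setTI. Qed.

(** On N the integrand g1 - g2 is positive, yet its integral is not. *)
Lemma null_of_le_integral (g1 g2 : T -> R) :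
  P.-integrable setT (EFin \o g1) -> P.-integrable setT (EFin \o g2) ->
  let N := [set x | g2 x < g1 x] in
  (\int[P]_(x in N) (g1 x)%:E <= \int[P]_(x in N) (g2 x)%:E)%E -> P N = 0%E.
Proof.
move=> i1 i2 N h.
have m1 : measurable_fun setT g1 by apply/measurable_EFinP; exact: measurable_int i1.
have m2 : measurable_fun setT g2 by apply/measurable_EFinP; exact: measurable_int i2.
have mN : measurable N by exact: measurable_lt_fun.
have i1N : P.-integrable N (EFin \o g1) by exact: integrableS i1.
have i2N : P.-integrable N (EFin \o g2) by exact: integrableS i2.
have int0 : (\int[P]_(x in N) `|(g1 x - g2 x)%:E| = 0)%E.
  apply/eqP; rewrite eq_le; apply/andP; split; last exact: integral_ge0.
  under eq_integral => x xN.
    rewrite gee0_abs; last by move: xN; rewrite inE lee_fin subr_ge0 => /ltW.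
    rewrite EFinB; over.
  rewrite integralB// sube_le0//.
have := (ae_eq_integral_abs P mN _).1 int0.
have mg : measurable_fun N (fun x => (g1 x - g2 x)%:E).
  by apply/measurable_EFinP/measurable_funTS; exact: measurable_funB.
move=> /(_ mg) [B [mB PB NB]]; apply/eqP; rewrite eq_le measure_ge0 andbT -PB.
apply: le_measure; rewrite ?inE// => x Nx; apply: NB => /= /(_ Nx) [] /eqP.
by rewrite subr_eq0 => /eqP gg; move: Nx; rewrite /N /= gg ltxx.
Qed.

End null_sets.

Section infimum.
Context d (T : measurableType d) (R : realType).

Lemma inf_seq_lt (h : nat -> R) (b y : R) : (forall n, b <= h n) ->
  inf (range h) < y <-> exists n, h n < y.
Proof.
move=> hb; have hi : has_inf (range h).
  by split; [exists (h 0%N), 0%N|exists b => _ [n _ <-]].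
split=> [|[n hny]].
  by move=> /(inf_lt hi.1)[_ [n _ <-] hy]; exists n.
by apply: le_lt_trans hny; apply: ge_inf; [exact: hi.2|exists n].
Qed.

Lemma measurable_inf_seq (h : nat -> T -> R) (b : R) :
  (forall n, measurable_fun setT (h n)) -> (forall n x, b <= h n x) ->
  measurable_fun setT (fun x => inf (range (h ^~ x))).
Proof.
move=> mh hb; have mE : (measurable : set (set R)) = <<s @RGenInftyO.G R >>.
  exact: (@RGenInftyO.measurableE R).
apply: (measurability _ mE) => _ [_ [y ->] <-]; rewrite setTI.
have -> : (fun x => inf (range (h ^~ x))) @^-1` `]-oo, y[%classic =
    \bigcup_n [set x | h n x < y].
  apply/seteqP; split => x /=; rewrite in_itv/=.
    by move=> /(inf_seq_lt _ (hb ^~ x)) [n]; exists n.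
  by move=> [n _ hn]; apply/(inf_seq_lt _ (hb ^~ x)); exists n.
apply: bigcup_measurable => n _.
exact: measurable_lt_fun (measurable_cst y).
Qed.

End infimum.

Lemma eq_measure_rays (R : realType) (m1 m2 : {measure set R -> \bar R}) :
  (m1 setT < +oo)%E -> (forall y, m1 `]-oo, y[%classic = m2 `]-oo, y[%classic) ->
  forall B, measurable B -> m1 B = m2 B.
Proof.
move=> moo h B mB; have mE : (measurable : set (set R)) = <<s @RGenInftyO.G R >>.
  exact: (@RGenInftyO.measurableE R).
apply: (measure_unique (@RGenInftyO.G R) (fun n => `]-oo, n%:R[%classic)) => //.
- move=> _ _ [x ->] [y ->]; exists (Num.min x y).
  by apply/seteqP; split => z /=; rewrite !in_itv/= lt_min => /andP.
- by move=> n; exists n%:R.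
- apply/seteqP; split => // x _; exists (Num.truncn x).+1 => //=.
  by rewrite in_itv/= truncnS_gt.
- by move=> _ [y ->]; exact: h.
- move=> n; apply: le_lt_trans moo; apply: le_measure; rewrite ?inE//.
Qed.

(** The running maximum of the rationals below y, in the order of an
    enumeration. *)
Lemma rat_cofinal (R : realType) (y : R) : 0 < y -> exists s : nat -> rat,
  [/\ s 0%N = 0, forall n, ratr (s n) < y, forall n, s n <= s n.+1 &
      forall q, ratr q < y -> exists n, q <= s n].
Proof.
move=> y0.
pose s := fix s n : rat := if n is m.+1 then
    if (unpickle m : option rat) is Some q then
      if ratr q < y then Num.max q (s m) else s m
    else s m
  else 0.
have sS n : s n.+1 = if (unpickle n : option rat) is Some q then
      if ratr q < y then Num.max q (s n) else s n
    else s n by [].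
exists s; split => // [n|n|q qy].
- elim: n => [|n ih]; first by rewrite /= rmorph0.
  rewrite sS; case: unpickle => // q; case: ifP => // qy.
  by case: (leP q (s n)).
- rewrite sS; case: unpickle => // q; case: ifP => // qy.
  by rewrite le_max lexx orbT.
- by exists (pickle q).+1; rewrite sS pickleK qy le_max lexx.
Qed.

Section disintegration.
Context dS (S : measurableType dS) (R : realType) (mu : probability S R).
Context d (T : measurableType d) (P : probability T R).
Variables (X : T -> S) (Y : T -> R).
Hypotheses (mX : measurable_fun setT X) (mY : measurable_fun setT Y).
Hypothesis law_X : forall A, measurable A -> P (X @^-1` A) = mu A.
Hypothesis Y01 : P (Y @^-1` `[0, 1]%classic) = 1%E.

Let mXA A : measurable A -> measurable (X @^-1` A).
Proof. by move=> mA; rewrite -[X in measurable X]setTI; exact: mX. Qed.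

Let mYB B : measurable B -> measurable (Y @^-1` B).
Proof. by move=> mB; rewrite -[X in measurable X]setTI; exact: mY. Qed.

Let le_P A B : measurable A -> measurable B -> A `<=` B -> (P A <= P B)%E.
Proof. by move=> mA mB AB; apply: le_measure => //; rewrite inE. Qed.

(** A version of P(Y <= q | X), for one rational q. *)
Let cdf_density (q : rat) : exists h : S -> R,
  [/\ measurable_fun setT h, forall x, 0 <= h x <= 1 &
    forall A, measurable A ->
    P (X @^-1` A `&` Y @^-1` `]-oo, ratr q]%classic) = (\int[mu]_(x in A) (h x)%:E)%E].
Proof.
have mq : measurable (Y @^-1` `]-oo, ratr q]%classic) by exact: mYB.
have := @bounded_density _ S R mu (pushforward (mrestr P mq) X) 1 ler01.
apply => A mA; rewrite mul1e -law_X//.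
rewrite -[leLHS]/(P (X @^-1` A `&` Y @^-1` `]-oo, ratr q]%classic)).
apply: le_P => //.
- by apply: measurableI => //; exact: mXA.
- exact: mXA.
Qed.

(** Countably many null sets are discarded to make the conditional distribution
    functions monotone in q simultaneously. *)
Let cdf_family : exists F : rat -> S -> R,
  [/\ forall q, measurable_fun setT (F q), forall q x, 0 <= F q x <= 1,
      forall q q' x, q <= q' -> F q x <= F q' x &
      forall q A, measurable A ->
      P (X @^-1` A `&` Y @^-1` `]-oo, ratr q]%classic) =
      (\int[mu]_(x in A) (F q x)%:E)%E].
Proof.
have [h hP] := choice cdf_density.
have mh q : measurable_fun setT (h q) by case: (hP q).
have h01 q x : 0 <= h q x <= 1 by case: (hP q).
have hE q A : measurable A -> P (X @^-1` A `&` Y @^-1` `]-oo, ratr q]%classic) =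
    (\int[mu]_(x in A) (h q x)%:E)%E by move=> mA; case: (hP q) => _ _; exact.
have bh q : bm (h q).
  by split=> //; exists 1 => x; have /andP[h0 h1] := h01 q x; rewrite ger0_norm.
pose N (q q' : rat) := [set x | h q' x < h q x].
have mN q q' : measurable (N q q') by exact: measurable_lt_fun.
have N0 q q' : q <= q' -> mu (N q q') = 0%E.
  move=> qq'; apply: null_of_le_integral.
  - exact: bm_integrable (bh q).
  - exact: bm_integrable (bh q').
  rewrite -(hE q _ (mN q q')) -(hE q' _ (mN q q')); apply: le_P.
  - by apply: measurableI; [exact: mXA|exact: mYB].
  - by apply: measurableI; [exact: mXA|exact: mYB].
  apply: setIS => w /=; rewrite !in_itv/= => /le_trans; apply.
  by rewrite ler_rat.
pose Zn n := if (unpickle n : option (rat * rat)) is Some p then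
  if p.1 <= p.2 then N p.1 p.2 else set0 else set0.
pose Z := \bigcup_n Zn n.
have mZn n : measurable (Zn n).
  by rewrite /Zn; case: unpickle => // p; case: ifP.
have mZ : measurable Z by exact: bigcup_measurable.
have Z0 : mu Z = 0%E.
  apply/eqP; rewrite eq_le measure_ge0 andbT.
  apply: (le_trans (measure_sigma_subadditive mu mZn mZ (@subset_refl _ Z))).
  rewrite eseries0// => n _ _; rewrite /Zn.
  by case: unpickle => [p|]; rewrite ?measure0//; case: ifP; rewrite ?measure0// => /N0.
have [e eE] : exists e : S -> bool, forall x, (e x <-> Z x).
  by exists (fun x => `[< Z x >]) => x; split => /asboolP.
have me : measurable_fun setT e.
  apply: (measurable_fun_bool true); rewrite setTI.
  suff -> : e @^-1` [set true] = Z by [].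
  by apply/seteqP; split => x /=; rewrite -eE /is_true.
exists (fun q x => if e x then 1 else h q x); split => [q|q x|q q' x qq'|q A mA].
- by apply: measurable_fun_ifT.
- by case: ifP => // _; rewrite ler01 lexx.
- case: ifPn => // nex; rewrite leNgt; apply/negP => hq.
  move/negP: nex; apply; apply/eE; exists (pickle (q, q')); first exact: I.
  by rewrite /Zn pickleK qq'.
- rewrite hE//; apply: ae_eq_integral => //.
  + by apply/measurable_EFinP/measurable_funTS; exact: mh.
  + by apply/measurable_EFinP/measurable_funTS; exact: measurable_fun_ifT.
  exists Z; split => // x /= /not_implyP[_]; apply: contra_notP => nZ.
  by case: ifPn => // /eE.
Qed.

(** f(x, u) is the quantile of order u of the conditional law of Y given X = x.
    It is the infimum of the rationals q of [0,1] with u <= F q x, so f(x, u) < y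
    exactly when u <= F q x for some rational q < y. *)
Lemma disintegration : exists2 f : S * R -> R, measurable_fun setT f &
  forall A B, measurable A -> measurable B ->
    P (X @^-1` A `&` Y @^-1` B) = (mu \x @U R)%E [set z | A z.1 /\ B (f z)].
Proof.
have [F [mF F01 Fmono FE]] := cdf_family.
pose c n (z : S * R) : R := if (unpickle n : option rat) is Some q then
  if (0 <= ratr q :> R) && (ratr q <= 1 :> R) && (z.2 <= F q z.1) then ratr q else 1 else 1.
have c01 n z : 0 <= c n z <= 1.
  rewrite /c; case: unpickle => [q|]; last by rewrite ler01 lexx.
  by case: ifP => [/andP[]//|_]; rewrite ler01 lexx.
have mc n : measurable_fun setT (c n).
  rewrite /c; case: unpickle => [q|]; last exact: measurable_cst.
  apply: measurable_fun_ifT => //; apply: measurable_and => //.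
  apply: measurable_fun_ler; first exact: measurable_snd.
  by apply: measurableT_comp => //; exact: mF.
pose f z := inf (range (c ^~ z)).
have mf : measurable_fun setT f.
  by apply: (@measurable_inf_seq _ _ _ _ 0) => // n z; have /andP[] := c01 n z.
have cb z n : 0 <= c n z by have /andP[] := c01 n z.
exists f => // A B mA mB.
have mXAs : measurable (X @^-1` A) by exact: mXA.
have mAT : measurable (A `*` [set: R]) by exact: measurableX.
pose m1 := pushforward (mrestr P mXAs) Y.
pose m2 := pushforward (mrestr (mu \x @U R)%E mAT) f.
have m1E B' : m1 B' = P (X @^-1` A `&` Y @^-1` B').
  by rewrite /m1 /pushforward /mrestr setIC.
have m2E B' : m2 B' = (mu \x @U R)%E [set z | A z.1 /\ B' (f z)].
  rewrite /m2 /pushforward /mrestr; congr ((mu \x @U R)%E _).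
  by apply/seteqP; split => -[x u] /=; tauto.
rewrite -m1E -m2E; move: B mB; apply: eq_measure_rays.
  by rewrite [ltLHS]m1E -ge0_fin_numE// fin_num_measure// setIT.
move=> y; rewrite [LHS]m1E [RHS]m2E.
have mfy : measurable [set z | A z.1 /\ `]-oo, y[%classic (f z)].
  have -> : [set z | A z.1 /\ `]-oo, y[%classic (f z)] =
    (A `*` [set: R]) `&` (f @^-1` `]-oo, y[%classic).
    by apply/seteqP; split => -[x u] /=; tauto.
  by apply: measurableI => //; rewrite -[X in measurable X]setTI; exact: mf.
have mYy (V : set R) : measurable V -> measurable (X @^-1` A `&` Y @^-1` V).
  by move=> mV; apply: measurableI => //; exact: mYB.
have Yout (V : set R) : measurable V -> V `&` `[0, 1]%classic = set0 ->
    P (Y @^-1` V) = 0%E.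
  move=> mV V01.
  have mV' := mYB mV.
  pose I01 : set R := `[0, 1]%classic.
  have mI01 : measurable (Y @^-1` I01) by apply: mYB; exact: measurable_itv.
  have : (P (Y @^-1` V) + P (Y @^-1` I01) <= 1)%E.
    rewrite -measureU//; last by rewrite -preimage_setI V01 preimage_set0.
    by apply: probability_le1; exact: measurableU.
  rewrite Y01 -leeBrDr// subee// => h.
  by apply/eqP; rewrite eq_le h measure_ge0.
(* Outside of ]0,1] both sides are trivial, as f and Y take values in [0,1]. *)
have [y0|y0] := leP y 0.
  have -> : [set z | A z.1 /\ `]-oo, y[%classic (f z)] = set0.
    apply/seteqP; split => // -[x u] /= [_]; rewrite in_itv/=.
    by move=> /(inf_seq_lt _ (cb _)) [n]; rewrite ltNge (le_trans y0).
  rewrite measure0; apply/eqP; rewrite eq_le measure_ge0 andbT.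
  rewrite -(Yout `]-oo, y[%classic)//.
    by apply: le_P; [exact: mYy|exact: mYB|exact: subIsetr].
  rewrite -subset0 => t [/=]; rewrite !in_itv/= => ty /andP[t0 _].
  by move: (lt_le_trans ty y0); rewrite ltNge t0.
have [y1|y1] := ltP 1 y.
  have -> : [set z | A z.1 /\ `]-oo, y[%classic (f z)] = A `*` [set: R].
    apply/seteqP; split => -[x u] /=; first by case.
    move=> [Ax _]; split => //; rewrite in_itv/=.
    apply/(inf_seq_lt _ (cb _)); exists 0%N; apply: le_lt_trans y1.
    by have /andP[] := c01 0%N (x, u).
  transitivity (P (X @^-1` A)); last first.
    rewrite law_X// product_measure1E// [X in (_ * X)%E](_ : _ = 1%E) ?mule1//.
    exact: probability_setT.
  apply/eqP; rewrite eq_le; apply/andP; split.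
    by apply: le_P => //; exact: mYy.
  have mC : measurable (Y @^-1` (~` `]-oo, y[%classic)) by apply: mYB; exact: measurableC.
  rewrite [leLHS](_ : _ = P ((X @^-1` A `&` Y @^-1` `]-oo, y[%classic) `|`
     (X @^-1` A `&` Y @^-1` (~` `]-oo, y[%classic)))); last first.
    by rewrite -setIUr preimage_setC setUv setIT.
  apply: (@le_trans _ _ (P (X @^-1` A `&` Y @^-1` `]-oo, y[%classic) +
     P (X @^-1` A `&` Y @^-1` (~` `]-oo, y[%classic)))%E).
    by apply: measureU2; [exact: mYy|apply: mYy; exact: measurableC].
  rewrite -[leRHS]adde0 leeD2l//.
  rewrite -(Yout (~` `]-oo, y[%classic))//.
  - by apply: le_P; [apply: mYy; exact: measurableC|exact: mC|exact: subIsetr].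
  - exact: measurableC.
  rewrite -subset0 => t [/=]; rewrite !in_itv/= => ty /andP[_ t1].
  by apply: ty; exact: le_lt_trans y1.
(* Along rationals increasing to y, both events increase and have equal measure. *)
have [s [s0 sy smono scof]] := rat_cofinal y0.
have s_mono : {homo s : n m / (n <= m)%N >-> n <= m}.
  by apply: homo_leq => //; exact: le_trans.
have s_ge0 n : 0 <= s n by rewrite -s0 s_mono.
pose E n := [set z : S * R | A z.1 /\ z.2 <= F (s n) z.1].
pose D n := X @^-1` A `&` Y @^-1` `]-oo, ratr (s n)]%classic.
have mE n : measurable (E n).
  have -> : E n = (A `*` [set: R]) `&` [set z | z.2 <= F (s n) z.1].
    by apply/seteqP; split => [[x u] [Ax ux]|[x u] [[Ax _] ux]].
  apply: measurableI => //.
  have := measurable_fun_ler (measurable_snd : measurable_fun setT (@snd S R))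
    (measurableT_comp (mF (s n)) measurable_fst).
  by move=> /(_ measurableT [set true] I); rewrite setTI.
have mD n : measurable (D n) by exact: mYy.
have ED n : (mu \x @U R)%E (E n) = P (D n).
  rewrite /D FE// [LHS]/product_measure1 integral_mkcond /=; symmetry.
  rewrite integral_mkcond; apply: eq_integral => x _.
  rewrite !patchE in_setT; have [Ax|nAx] := pselect (A x).
    rewrite mem_set// -(U_itv (F01 (s n) x)); congr (U R _).
    apply/seteqP; split => u; rewrite /xsection/= in_itv/=.
      by move=> uF; exact/mem_set.
    by move=> /set_mem[].
  rewrite memNset//; have E0 : xsection (E n) x = set0.
    by rewrite -subset0 => u; rewrite /xsection/= => /set_mem[].
  by rewrite /= E0 measure0.
have cE : (mu \x @U R)%E (E n) @[n --> \oo] --> (mu \x @U R)%E (\bigcup_n E n).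
  apply: nondecreasing_cvg_mu => //; first exact: bigcup_measurable.
  move=> n m nm; apply/subsetPset => z [Az zF]; split => //.
  by rewrite (le_trans zF)// Fmono// s_mono.
have cD : P (D n) @[n --> \oo] --> P (\bigcup_n D n).
  apply: nondecreasing_cvg_mu => //; first exact: bigcup_measurable.
  move=> n m nm; apply/subsetPset; apply: setIS => w /=; rewrite !in_itv/=.
  by move=> /le_trans; apply; rewrite ler_rat s_mono.
have cDE : (mu \x @U R)%E (\bigcup_n E n) = P (\bigcup_n D n).
  have cE' : P (D n) @[n --> \oo] --> (mu \x @U R)%E (\bigcup_n E n).
    by apply: cvg_trans cE; apply: near_eq_cvg; apply: nearW => n; exact: ED.
  exact: (cvg_unique _ cE' cD).
have -> : [set z | A z.1 /\ `]-oo, y[%classic (f z)] = \bigcup_n E n.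
  apply/seteqP; split => [[x u] /= [Ax]|[x u] [n _ [/= Ax uF]]].
    rewrite in_itv/= => /(inf_seq_lt _ (cb _)) [n].
    rewrite /c; case: unpickle => [q|]; last by rewrite ltNge y1.
    case: ifP => [/andP[_ /= uF] qy|_]; last by rewrite ltNge y1.
    have [m qs] := scof _ qy; exists m => //; split => //=.
    by rewrite (le_trans uF)// Fmono.
  split => //; rewrite in_itv/=; apply/(inf_seq_lt _ (cb _)).
  exists (pickle (s n)); rewrite /c pickleK /= uF.
  have s0R : 0 <= ratr (s n) :> R by rewrite ler0q.
  by rewrite s0R (le_trans (ltW (sy n)) y1)/=.
rewrite cDE; have -> : \bigcup_n D n = X @^-1` A `&` Y @^-1` `]-oo, y[%classic.
  rewrite -setI_bigcupr; congr (_ `&` _); apply/seteqP; split => w.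
    by move=> [n _ /=]; rewrite !in_itv/= => /le_lt_trans; apply.
  rewrite /= in_itv/= => wy.
  have [Yw|Yw] := ltP (Y w) 0.
    by exists 0%N => //=; rewrite in_itv/= s0 rmorph0 ltW.
  have [q] := rat_in_itvoo wy; rewrite in_itv/= => /andP[Yq qy].
  have [m qs] := scof _ qy; exists m => //=; rewrite in_itv/=.
  by rewrite (le_trans (ltW Yq))// ler_rat.
by [].
Qed.

End disintegration.

(** A point z of the plane is determined by the answers to the questions
    z.1 <= q and z.2 <= q, with q rational; these answers are stored as the
    ternary digits 0 and 2 of a point of the Cantor set, from which they
    can be read without ambiguity. *)
Section digits.
Context (R : realType).

(** The default 2 makes the question trivial for points of the unit square. *)
Definition nth_rat (n : nat) : R :=
  if (unpickle n : option rat) is Some q then ratr q else 2.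

Definition cut_bit (z : R * R) (i : nat) : bool :=
  (if odd i then z.2 else z.1) <= nth_rat i./2.

Definition ternary (b : nat -> bool) (n : nat) : R :=
  \sum_(i < n) (if b i then 2 / 3 ^+ i.+1 else 0).

(** The sum of the series of digits, as an infimum of upper bounds. *)
Definition encode (z : R * R) : R :=
  inf (range (fun n => ternary (cut_bit z) n + (3 ^+ n)^-1)).

(** The number formed by the first n digits of c, each digit being recovered from
    what remains to be encoded. *)
Fixpoint residue (c : R) (n : nat) : R :=
  if n is m.+1 then
    residue c m +
    (if (3 ^+ m)^-1 / 2 <= c - residue c m then 2 / 3 ^+ m.+1 else 0)
  else 0.

Definition read_bit (c : R) (n : nat) : bool := (3 ^+ n)^-1 / 2 <= c - residue c n.

(** A coordinate is the infimum of the rationals that were found to be above it. *)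
Definition decode_coord (j : bool) (c : R) : R :=
  inf (range (fun n => if read_bit c (j + n.*2)
                       then Num.max 0 (Num.min (nth_rat n) 1) else 1)).

Definition decode (c : R) : R * R := (decode_coord false c, decode_coord true c).

Let expi n : (3 ^+ n)^-1 = 3 * (3 ^+ n.+1)^-1 :> R.
Proof. by rewrite exprS invfM mulrA divff ?mul1r. Qed.

Let exp_gt0 n : 0 < (3 ^+ n)^-1 :> R.
Proof. by rewrite invr_gt0 exprn_gt0. Qed.

Let ternaryS b n : 
  ternary b n.+1 = ternary b n + (if b n then 2 / 3 ^+ n.+1 else 0).
Proof. by rewrite /ternary big_ord_recr. Qed.

Let ternary_incr b n m : (n <= m)%N -> ternary b n <= ternary b m.
Proof.
elim: m => [|m ih]; first by rewrite leqn0 => /eqP ->.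
rewrite leq_eqVlt => /predU1P[->//|]; rewrite ltnS => /ih /le_trans; apply.
by rewrite ternaryS lerDl; have := exp_gt0 m.+1; case: (b m); nra.
Qed.

Let ternary_decr b n m : (n <= m)%N ->
  ternary b m + (3 ^+ m)^-1 <= ternary b n + (3 ^+ n)^-1.
Proof.
elim: m => [|m ih]; first by rewrite leqn0 => /eqP ->.
rewrite leq_eqVlt => /predU1P[->//|]; rewrite ltnS => /ih; apply: le_trans.
rewrite ternaryS [X in _ <= _ + X]expi; have := exp_gt0 m.+1.
by case: (b m) => /=; lra.
Qed.

Let ternary_lb b n m : ternary b n <= ternary b m + (3 ^+ m)^-1.
Proof.
have [nm|/ltnW mn] := leqP n m.
  by rewrite (le_trans (ternary_incr b nm))// lerDl ltW.
by apply: le_trans (ternary_decr b mn); rewrite lerDl ltW.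
Qed.

Let encode_lb z n : ternary (cut_bit z) n <= encode z.
Proof.
apply: lb_le_inf; first by exists (ternary (cut_bit z) 0 + (3 ^+ 0)^-1), 0%N.
by move=> _ [m _ <-]; exact: ternary_lb.
Qed.

Let encode_ub z n : encode z <= ternary (cut_bit z) n + (3 ^+ n)^-1.
Proof.
apply: ge_inf; last by exists n.
by exists (ternary (cut_bit z) 0) => _ [m _ <-]; exact: ternary_lb.
Qed.

Lemma encode01 z : 0 <= encode z <= 1.
Proof.
have := encode_lb z 0; have := encode_ub z 0.
by rewrite /ternary big_ord0 expr0 invr1 add0r => -> ->.
Qed.

Lemma measurable_encode : measurable_fun setT encode.
Proof.
apply: (@measurable_inf_seq _ _ _
  (fun n z => ternary (cut_bit z) n + (3 ^+ n)^-1) 0) => [n|n z].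
  apply: measurable_funD => //; apply: measurable_sum => i.
  apply: measurable_fun_ifT => //; apply: measurable_fun_ler => //.
  by case: (odd i); [exact: measurable_snd|exact: measurable_fst].
by have := ternary_lb (cut_bit z) 0 n; rewrite {1}/ternary big_ord0.
Qed.

Lemma read_bit_encode z n : read_bit (encode z) n = cut_bit z n.
Proof.
have bitE m : residue (encode z) m = ternary (cut_bit z) m ->
    read_bit (encode z) m = cut_bit z m.
  rewrite /read_bit => ->; have lb := encode_lb z m.+1; have ub := encode_ub z m.+1.
  rewrite ternaryS in lb ub; have e0 := exp_gt0 m.+1; rewrite (expi m).
  case: (cut_bit z m) lb ub => /= lb ub; first by lra.
  by apply/negbTE; rewrite -ltNge; lra.
apply: (bitE); elim: n => [|n ih]; first by rewrite /ternary big_ord0.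
by rewrite ternaryS/= -(bitE n ih) /read_bit ih.
Qed.

Let measurable_residue n : measurable_fun setT (residue ^~ n).
Proof.
elim: n => [|n ih] /=; first exact: measurable_cst.
apply: measurable_funD => //.
apply: measurable_fun_ifT => //; apply: measurable_fun_ler => //.
by apply: measurable_funB.
Qed.

Lemma measurable_decode : measurable_fun setT decode.
Proof.
suff h j : measurable_fun setT (decode_coord j) by apply: measurable_fun_pair.
apply: (@measurable_inf_seq _ _ _ (fun n c => if read_bit c (j + n.*2)
  then Num.max 0 (Num.min (nth_rat n) 1) else 1) 0) => [n|n c].
  apply: measurable_fun_ifT => //; apply: measurable_fun_ler => //.
  by apply: measurable_funB => //; exact: measurable_residue.
by case: ifP => // _; rewrite le_max lexx.
Qed.

Let decode_coordE j z : 0 <= (if j then z.2 else z.1) <= 1 ->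
  decode_coord j (encode z) = if j then z.2 else z.1.
Proof.
set x := if j then z.2 else z.1 => /andP[x0 x1].
pose h n : R := if read_bit (encode z) (j + n.*2)
  then Num.max 0 (Num.min (nth_rat n) 1) else 1.
have hE n : h n = if x <= nth_rat n then Num.max 0 (Num.min (nth_rat n) 1) else 1.
  rewrite /h read_bit_encode /cut_bit oddD odd_double addbF half_bit_double /x.
  by case: (j).
have hx n : x <= h n.
  by rewrite hE; case: ifP => // xq; rewrite le_max le_min xq x1 orbT.
apply/eqP; rewrite eq_le; apply/andP; split; last first.
  apply: lb_le_inf; first by exists (h 0%N), 0%N.
  by move=> _ [n _ <-]; exact: hx.
rewrite leNgt; apply/negP => xd.
have [q] := rat_in_itvoo xd; rewrite in_itv/= => /andP[xq qd].
have : decode_coord j (encode z) <= h (pickle q).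
  apply: ge_inf; last by exists (pickle q).
    by exists x => _ [n _ <-]; exact: hx.
rewrite hE /nth_rat pickleK (ltW xq) max_r; last first.
  by rewrite le_min ler01 (le_trans x0 (ltW xq)).
by rewrite le_min leNgt qd.
Qed.

Lemma decodeK z : 0 <= z.1 <= 1 -> 0 <= z.2 <= 1 -> decode (encode z) = z.
Proof.
by case: z => x y hx hy; rewrite /decode (@decode_coordE false)// (@decode_coordE true).
Qed.

End digits.

Section splitting.
Context (R : realType).

(** The law of an encoded pair of independent uniform variables is the image of U
    under its quantile function, which is [disintegration] over a one-point
    space. *)
Lemma uniform_splitting : exists2 G : R -> R * R, measurable_fun setT G &
  forall E, measurable E -> U R (G @^-1` E) = (U R \x U R)%E E.
Proof.
have mX : measurable_fun setT (fun _ : R * R => tt) by exact: measurable_cst.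
have law_X A : measurable A -> (U R \x U R)%E ((fun _ : R * R => tt) @^-1` A) =
    (\d_tt : probability unit R) A.
  move=> mA; rewrite [RHS](_ : _ = (tt \in A)%:R%:E); last exact: diracE.
  have [Att|Att] := pselect (A tt).
    rewrite mem_set// (_ : _ @^-1` _ = setT) ?probability_setT//.
    by apply/seteqP; split.
  rewrite memNset// (_ : _ @^-1` _ = set0) ?measure0//.
  by apply/seteqP; split.
have Y01 : (U R \x U R)%E (@encode R @^-1` `[0, 1]%classic) = 1%E.
  rewrite (_ : _ @^-1` _ = setT) ?probability_setT//.
  by apply/seteqP; split => // z _ /=; rewrite in_itv/=; exact: encode01.
have [f mf fE] := disintegration mX (@measurable_encode R) law_X Y01.
pose G u := decode (f (tt, u)).
have mfu : measurable_fun setT (fun u => f (tt, u)).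
  by apply: measurableT_comp => //; exact: pair1_measurable.
have mG : measurable_fun setT G.
  exact: measurableT_comp (@measurable_decode R) mfu.
exists G => // E mE.
have mdE : measurable (@decode R @^-1` E).
  by rewrite -[X in measurable X]setTI; exact: measurable_decode.
have mdeE : measurable (@encode R @^-1` (@decode R @^-1` E)).
  by rewrite -[X in measurable X]setTI; exact: measurable_encode.
have h : (U R \x U R)%E (@encode R @^-1` (@decode R @^-1` E)) = U R (G @^-1` E).
  have := fE setT _ measurableT mdE; rewrite preimage_setT setTI => ->.
  rewrite /product_measure1 integral_dirac// diracT mul1e /=; congr (U R _).
  by apply/seteqP; split => u; rewrite /xsection/= inE/=; tauto.
rewrite -h.
pose I := (`[0, 1]%classic : set R); pose Q := I `*` I.
have mI : measurable I by exact: measurable_itv.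
have mQ : measurable Q by exact: measurableX.
have hQ : (U R \x U R)%E Q = (U R I * U R I)%E by exact: product_measure1E.
have QC : (U R \x U R)%E (~` Q) = 0%E.
  rewrite probability_setC// -[X in (_ - X)%E]/((U R \x U R)%E Q) hQ U01 mule1.
  by rewrite subee.
have mQC : measurable (~` Q) by exact: measurableC.
have capQ A : measurable A -> (U R \x U R)%E A = (U R \x U R)%E (A `&` Q).
  move=> mA; have mAQ : measurable (A `&` Q) by exact: measurableI.
  have mAQC : measurable (A `&` ~` Q) by exact: measurableI.
  have AQ0 : A `&` Q `&` (A `&` ~` Q) = set0 by rewrite setIACA setICr setI0.
  have null : (U R \x U R)%E (A `&` ~` Q) = 0%E.
    apply/eqP; rewrite eq_le measure_ge0 andbT -QC.
    by apply: le_measure; rewrite ?inE//; exact: subIsetr.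
  have AE : A = (A `&` Q) `|` (A `&` ~` Q) by rewrite -setIUr setUv setIT.
  rewrite {1}AE; apply: (etrans (measureU _ mAQ mAQC AQ0)).
  by rewrite [X in (_ + X)%E]null adde0.
rewrite (capQ E mE) (capQ _ mdeE); congr ((U R \x U R)%E _).
by apply/seteqP; split => -[x y] /= [Exy [xI yI]]; split => //; move: Exy;
  rewrite decodeK.
Qed.

End splitting.

(** * Random maps and their transition operators *)
Section integrals.
Context (R : realType).

Lemma Rintegral_indicM d (T : measurableType d) (P : probability T R)
    (A : set T) (g : T -> R) :
  \int[P]_(x in A) g x = \int[P]_x (\1_A x * g x).
Proof.
rewrite Rintegral_mkcond; apply: eq_Rintegral => x _.
by rewrite patchE indicE; case: ifP => _; rewrite ?mul1r ?mul0r.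
Qed.

Lemma Rintegral_indicP d (T : measurableType d) (P : probability T R) (A : set T) :
  measurable A -> \int[P]_x (\1_A x) = fine (P A).
Proof. by move=> mA; rewrite /Rintegral integral_indic// setIT. Qed.

Lemma eq_Rintegral_law d1 d2 dS (T1 : measurableType d1) (T2 : measurableType d2)
    (S : measurableType dS) (P1 : probability T1 R) (P2 : probability T2 R)
    (X1 : T1 -> S) (X2 : T2 -> S) :
  measurable_fun setT X1 -> measurable_fun setT X2 ->
  (forall B, measurable B -> P1 (X1 @^-1` B) = P2 (X2 @^-1` B)) ->
  forall f, bm f -> \int[P1]_w f (X1 w) = \int[P2]_w f (X2 w).
Proof.
move=> mX1 mX2 h f bf; have [mf [c fc]] := bf.
have push d (T : measurableType d) (P : probability T R) (X : T -> S) :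
    measurable_fun setT X ->
    (\int[pushforward P X]_x (f x)%:E = \int[P]_w (f (X w))%:E)%E.
  move=> mX; rewrite integral_pushforward//= ?preimage_setT//.
    by apply/measurable_EFinP; exact: mf.
  exact: (bm_integrable P (bm_comp mX bf)).
congr fine; rewrite -push// -push//.
by apply: eq_measure_integral => B mB _; exact: h.
Qed.

Lemma bm_fubini dS (S : measurableType dS) dV (V : measurableType dV)
    (mu : probability S R) (nu : probability V R) (h : S * V -> R) : bm h ->
  bm (fun x => \int[nu]_u h (x, u)) /\
  \int[(mu \x nu)%E]_z h z = \int[mu]_x \int[nu]_u h (x, u).
Proof.
move=> bh; have [mh [c hc]] := bh.
have bhx x : bm (fun u => h (x, u)).
  by apply: bm_comp bh; exact: pair1_measurable.
have ih := bm_integrable (mu \x nu)%E bh.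
have EF x : (\int[nu]_u h (x, u))%:E = fubini_F nu (EFin \o h) x.
  by rewrite /fubini_F /Rintegral fineK//; apply: integrable_fin_num => //;
    exact: bm_integrable (bhx x).
split; last first.
  rewrite /Rintegral -integral12_prod_meas1//; congr fine.
  by apply: eq_integral => x _; rewrite -EF.
split.
  apply/measurable_EFinP; have := measurable_fubini_F ih.
  by congr (measurable_fun setT _); apply/funext => x; rewrite -EF.
exists c => x; apply: (le_trans (le_normr_Rintegral measurableT _)).
  exact: bm_integrable (bhx x).
rewrite -[leRHS](Rintegral_cstP nu c); apply: le_Rintegral => //.
- exact: bm_integrable (bm_norm (bhx x)).
- exact: bm_integrable (bm_cst c).
Qed.

End integrals.

Section random_maps.
Context (R : realType).
Notation U := (U R).
Implicit Types (f g : R * R -> R) (phi psi : R -> R).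

(** The transition operator of the kernel whose value at x is the law of f(x, u),
    u uniform. *)
Definition kop f phi (x : R) : R := \int[U]_u phi (f (x, u)).

Lemma bm_section f phi x : measurable_fun setT f -> bm phi ->
  bm (fun u => phi (f (x, u))).
Proof.
move=> mf; apply: (@bm_comp _ _ _ _ _ phi (fun u => f (x, u))).
by apply: measurableT_comp => //; exact: pair1_measurable.
Qed.

Lemma kop_posop f : measurable_fun setT f -> posop (kop f).
Proof.
move=> mf; split => [phi bphi|a phi psi bphi bpsi|phi bphi phi0 x].
- by have [] := bm_fubini U U (bm_comp mf bphi).
- have i1 x := bm_integrable U (bm_section x mf bphi).
  have i2 x := bm_integrable U (bm_section x mf bpsi).
  apply/funext => x; rewrite /kop RintegralD//; first by rewrite RintegralZl.
  exact: (bm_integrable U (bmZ a (bm_section x mf bphi))).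
- by apply: Rintegral_ge0.
Qed.

Lemma kop_one f : kop f (cst 1) = cst 1.
Proof. by apply/funext => x; rewrite /kop Rintegral_cstP. Qed.

(** If x is uniform and u is independent and uniform, then f(x, u) is uniform. *)
Definition preserves_U f := measurable_fun setT f /\
  forall B, measurable B -> \int[U]_x kop f \1_B x = fine (U B).

Lemma kop_indic f B x : measurable_fun setT f -> measurable B ->
  (kop f \1_B x)%:E = U [set u | B (f (x, u))].
Proof.
move=> mf mB; have mfx : measurable_fun setT (fun u => f (x, u)).
  by apply: measurableT_comp => //; exact: pair1_measurable.
have mE : measurable [set u | B (f (x, u))].
  by rewrite -[X in measurable X]setTI; exact: mfx.
rewrite -[kop _ _ _]/(\int[U]_u \1_[set u | B (f (x, u))] u).
by rewrite Rintegral_indicP// fineK// fin_num_measure.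
Qed.

Lemma kop_joint f (A B : set R) : measurable_fun setT f -> measurable A ->
  measurable B ->
  (U \x U)%E [set z | A z.1 /\ B (f z)] = (\int[U]_(x in A) kop f \1_B x)%:E.
Proof.
move=> mf mA mB.
have mE : measurable [set z | A z.1 /\ B (f z)].
  have -> : [set z | A z.1 /\ B (f z)] = (A `*` [set: R]) `&` (f @^-1` B).
    by apply/seteqP; split => -[x u] /=; tauto.
  apply: measurableI; first exact: measurableX.
  by rewrite -[X in measurable X]setTI; exact: mf.
set E := [set z | _] in mE *.
transitivity (\int[(U \x U)%E]_z \1_E z)%:E.
  by rewrite (Rintegral_indicP _ mE) fineK// fin_num_measure.
congr EFin; have [_ ->] := bm_fubini U U (bm_indic R mE).
rewrite [RHS]Rintegral_indicM; apply: eq_Rintegral => x _.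
have [Ax|nAx] := pselect (A x).
  rewrite indicE mem_set// mul1r /kop; apply: eq_Rintegral => u _.
  by rewrite !indicE; congr (_%:R); congr nat_of_bool; apply/idP/idP;
    rewrite !inE//= => -[].
rewrite indicE memNset// mul0r -[RHS](Rintegral_cstP U 0).
by apply: eq_Rintegral => u _; rewrite indicE memNset// => -[].
Qed.

Lemma preserves_U_law f : preserves_U f -> forall B, measurable B ->
  (U \x U)%E (f @^-1` B) = U B.
Proof.
move=> [mf h] B mB.
have -> : f @^-1` B = [set z | [set: R] z.1 /\ B (f z)].
  by apply/seteqP; split => z /=; tauto.
by rewrite kop_joint// h// fineK// fin_num_measure.
Qed.

Lemma kop_markov f : preserves_U f -> markov_op U (kop f).
Proof.
move=> pf; have [mf h] := pf; split; first exact: kop_posop.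
  exact: kop_one.
move=> phi bphi; have [_ <-] := bm_fubini U U (bm_comp mf bphi).
rewrite [RHS](_ : _ = \int[U]_w phi (id w))//.
apply: (@eq_Rintegral_law _ _ _ _ _ _ _ (U \x U)%E U f id) => //.
by move=> B mB; exact: preserves_U_law.
Qed.

Definition map_section f (mf : measurable_fun setT f) (x u : R) : R := f (x, u).

Section kop_kernel.
Variables (f : R * R -> R) (mf : measurable_fun setT f).

Let measurable_map_section x : measurable_fun setT (map_section mf x).
Proof. by apply: measurableT_comp => //; exact: pair1_measurable. Qed.

HB.instance Definition _ x := isMeasurableFun.Build _ _ R R (map_section mf x)
  (measurable_map_section x).

Definition kop_kernel (x : R) : {measure set R -> \bar R} :=
  distribution U (map_section mf x).

Lemma kop_kernelE x B : measurable B -> kop_kernel x B = (kop f \1_B x)%:E.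
Proof. by move=> mB; rewrite kop_indic. Qed.

Let measurable_kop_kernel B : measurable B ->
  measurable_fun setT (kop_kernel ^~ B).
Proof.
move=> mB; rewrite (_ : kop_kernel ^~ B = EFin \o kop f \1_B).
  by apply/measurable_EFinP; case: (posop_bm (kop_posop mf) (bm_indic R mB)).
by apply/funext => x; exact: kop_kernelE.
Qed.

HB.instance Definition _ := isKernel.Build _ _ _ _ R (kop_kernel)
  measurable_kop_kernel.

Let kop_kernel_prob x : kop_kernel x setT = 1%E.
Proof. exact: (@probability_setT _ _ _ U).
Qed.

HB.instance Definition _ := Kernel_isProbability.Build _ _ _ _ R (kop_kernel)
  kop_kernel_prob.

Definition kop_pker : R.-pker R ~> R := kop_kernel.

End kop_kernel.

End random_maps.

Lemma eq_measure_rect d1 d2 (T1 : measurableType d1) (T2 : measurableType d2)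
    (R : realType) (m1 m2 : {measure set (T1 * T2) -> \bar R}) :
  (m1 setT < +oo)%E ->
  (forall A B, measurable A -> measurable B -> m1 (A `*` B) = m2 (A `*` B)) ->
  forall E, measurable E -> m1 E = m2 E.
Proof.
move=> moo h E mE.
pose C : set (set (T1 * T2)) :=
  [set C | exists A B, [/\ measurable A, measurable B & C = A `*` B]].
apply: (measure_unique C (fun=> setT)) => //.
- rewrite measurable_prod_measurableType //; congr (<<s _ >>).
  apply/seteqP; split => [_ [A mA [B mB <-]]|_ [A [B [mA mB ->]]]].
    by exists A, B.
  by exists A => //; exists B.
- move=> _ _ [A [B [mA mB ->]]] [A' [B' [mA' mB' ->]]].
  exists (A `&` A'), (B `&` B'); rewrite setXI.
  by split=> //; exact: measurableI.
- by move=> _; exists setT, setT; rewrite setXTT.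
- by apply/seteqP; split => // x _; exists 0%N.
- by move=> _ [A [B [mA mB ->]]]; exact: h.
Qed.

Lemma eq_Rintegral_pair (R : realType) d1 d2 dS dV
    (T1 : measurableType d1) (T2 : measurableType d2)
    (S : measurableType dS) (V : measurableType dV)
    (P1 : probability T1 R) (P2 : probability T2 R)
    (X1 : T1 -> S) (Y1 : T1 -> V) (X2 : T2 -> S) (Y2 : T2 -> V) :
  measurable_fun setT X1 -> measurable_fun setT Y1 ->
  measurable_fun setT X2 -> measurable_fun setT Y2 ->
  (forall A B, measurable A -> measurable B ->
    P1 (X1 @^-1` A `&` Y1 @^-1` B) = P2 (X2 @^-1` A `&` Y2 @^-1` B)) ->
  forall h : S * V -> R, bm h ->
  \int[P1]_w h (X1 w, Y1 w) = \int[P2]_w h (X2 w, Y2 w).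
Proof.
move=> mX1 mY1 mX2 mY2 XY h bh.
have m1 : measurable_fun setT (fun w => (X1 w, Y1 w)) by exact: measurable_fun_pair.
have m2 : measurable_fun setT (fun w => (X2 w, Y2 w)) by exact: measurable_fun_pair.
apply: (eq_Rintegral_law m1 m2) => // E mE.
apply: (@eq_measure_rect _ _ _ _ _ (pushforward P1 (fun w => (X1 w, Y1 w)))
  (pushforward P2 (fun w => (X2 w, Y2 w)))); last exact: mE.
  by rewrite [ltLHS](_ : _ = 1%E) ?ltry//; exact: probability_setT.
by move=> A B mA mB; exact: XY.
Qed.

Section splitting_ops.
Context (R : realType) (G : R -> R * R).
Notation U := (U R).
Hypothesis mG : measurable_fun setT G.
Hypothesis GU : forall E, measurable E -> U (G @^-1` E) = (U \x U)%E E.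
Implicit Types (f g : R * R -> R) (phi psi : R -> R).

(** Under G, one uniform variable replaces two independent ones. *)
Lemma Rintegral_splitting (h : R * R -> R) : bm h ->
  \int[U]_u h (G u) = \int[U]_v \int[U]_s h (v, s).
Proof.
move=> bh; have [_ <-] := bm_fubini U U bh.
rewrite [RHS](_ : _ = \int[(U \x U)%E]_w h (id w))//.
by apply: (@eq_Rintegral_law _ _ _ _ _ _ _ U (U \x U)%E G id).
Qed.

Let mG1 : measurable_fun setT (fun u => (G u).1).
Proof. exact: measurableT_comp measurable_fst mG. Qed.

Let mG2 : measurable_fun setT (fun u => (G u).2).
Proof. exact: measurableT_comp measurable_snd mG. Qed.

(** The noise z.2 is split by G into independent noises for the two steps. *)
Definition compose_map f g (z : R * R) := f (g (z.1, (G z.2).1), (G z.2).2).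

Lemma measurable_compose_map f g : measurable_fun setT f -> measurable_fun setT g ->
  measurable_fun setT (compose_map f g).
Proof.
move=> mf mg; have m2 h : measurable_fun setT h -> measurable_fun setT
    (fun z : R * R => h z.2 : R).
  by move=> mh; exact: measurableT_comp mh measurable_snd.
apply: (measurableT_comp mf); apply: measurable_fun_pair; last exact: m2 mG2.
apply: (measurableT_comp mg); apply: measurable_fun_pair; last exact: m2 mG1.
exact: measurable_fst.
Qed.

Lemma kop_compose f g phi : measurable_fun setT f -> measurable_fun setT g ->
  bm phi -> kop (compose_map f g) phi = kop g (kop f phi).
Proof.
move=> mf mg bphi; apply/funext => x; rewrite /kop.
apply: (@Rintegral_splitting (fun w => phi (f (g (x, w.1), w.2)))).
apply: bm_comp bphi; apply: (measurableT_comp mf).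
apply: measurable_fun_pair; last exact: measurable_snd.
apply: (measurableT_comp mg); apply: measurable_fun_pair; last exact: measurable_fst.
exact: measurable_cst.
Qed.

Fixpoint iter_map n f : R * R -> R :=
  if n is m.+1 then compose_map (iter_map m f) f else fst.

Lemma measurable_iter_map n f : measurable_fun setT f ->
  measurable_fun setT (iter_map n f).
Proof.
by move=> mf; elim: n => [|n ih]; [exact: measurable_fst|exact: measurable_compose_map].
Qed.

Lemma kop_iter_map n f phi : measurable_fun setT f -> bm phi ->
  kop (iter_map n f) phi = iter n (kop f) phi.
Proof.
move=> mf bphi; elim: n => [|n ih].
  by apply/funext => x; exact: (Rintegral_cstP U (phi x)).
by rewrite kop_compose ?ih//; exact: measurable_iter_map.
Qed.

(** A first uniform variable chooses the map, a second one drives it. *)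
Definition mix_map (a : R) f g (z : R * R) :=
  if (G z.2).1 <= a then f (z.1, (G z.2).2) else g (z.1, (G z.2).2).

Lemma measurable_mix_map a f g : measurable_fun setT f -> measurable_fun setT g ->
  measurable_fun setT (mix_map a f g).
Proof.
move=> mf mg; have m2 h : measurable_fun setT h -> measurable_fun setT
    (fun z : R * R => h z.2 : R).
  by move=> mh; exact: measurableT_comp mh measurable_snd.
have mp : measurable_fun setT (fun z : R * R => (z.1, (G z.2).2)).
  by apply: measurable_fun_pair; [exact: measurable_fst|exact: m2 mG2].
apply: measurable_fun_ifT; last 2 first.
- exact: (measurableT_comp mf mp).
- exact: (measurableT_comp mg mp).
by apply: measurable_fun_ler => //; exact: m2 mG1.
Qed.

Lemma kop_mix a f g phi x : 0 <= a <= 1 ->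
  measurable_fun setT f -> measurable_fun setT g -> bm phi ->
  kop (mix_map a f g) phi x = a * kop f phi x + (1 - a) * kop g phi x.
Proof.
move=> a01 mf mg bphi.
have [m1 [c1 h1]] := bm_section x mf bphi.
have [m2 [c2 h2]] := bm_section x mg bphi.
pose h (w : R * R) := if w.1 <= a then phi (f (x, w.2)) else phi (g (x, w.2)).
have bh : bm h.
  split.
    apply: measurable_fun_ifT.
    - by apply: measurable_fun_ler => //; exact: measurable_fst.
    - exact: (measurableT_comp m1 measurable_snd).
    - exact: (measurableT_comp m2 measurable_snd).
  exists (Num.max c1 c2) => w; rewrite /h le_max.
  by case: ifP => _; rewrite ?h1 ?h2 ?orbT.
transitivity (\int[U]_u h (G u)).
  by apply: eq_Rintegral => u _; rewrite /mix_map /h /=; case: ifP.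
rewrite (Rintegral_splitting bh).
transitivity (\int[U]_v ((kop f phi x - kop g phi x) * \1_`]-oo, a] v + kop g phi x)).
  apply: eq_Rintegral => v _; rewrite /h /=.
  have [va|va] := leP v a.
    by rewrite indicE mem_set/= ?in_itv//= mulr1 subrK; apply: eq_Rintegral.
  rewrite indicE memNset/= ?in_itv/= ?mulr0 ?add0r//.
  by apply/negP; rewrite -ltNge.
have b1 : bm (\1_(`]-oo, a]%classic) : R -> R) by exact: bm_indic.
rewrite RintegralD//; last 2 first.
  exact: (bm_integrable U (bmZ _ b1)).
  exact: (bm_integrable U (bm_cst _)).
rewrite Rintegral_cstP RintegralZl//; last exact: (bm_integrable U b1).
rewrite Rintegral_indicP// U_itv//=; ring.
Qed.

(** One component is added at a time, with the weight of the previous ones relative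
    to the new total. *)
Lemma kop_convex_sum (n : nat) (a : nat -> R) (f : nat -> R * R -> R) :
  (1 <= n)%N -> (forall k, (1 <= k <= n)%N -> measurable_fun setT (f k)) ->
  (forall k, (1 <= k <= n)%N -> 0 <= a k) -> a 1%N != 0 ->
  exists2 g, measurable_fun setT g & forall phi x, bm phi ->
    (\sum_(1 <= k < n.+1) a k) * kop g phi x =
    \sum_(1 <= k < n.+1) a k * kop (f k) phi x.
Proof.
elim: n => // n ih _ mf a0 a1.
have [n0|n0] := posnP n.
  by exists (f 1%N); [apply: mf; rewrite n0|move=> phi x _; rewrite n0 !big_nat1].
have sub k : (1 <= k <= n)%N -> (1 <= k <= n.+1)%N.
  by move=> /andP[-> /leqW].
have [g mg gE] := ih n0 (fun k kn => mf k (sub k kn)) (fun k kn => a0 k (sub k kn)) a1.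
have an0 : 0 <= a n.+1 by apply: a0; rewrite leqnn.
set s := \sum_(1 <= k < n.+1) a k in gE.
have s0 : 0 < s.
  rewrite /s big_ltn//; apply: ltr_pwDl.
    by rewrite lt_neqAle eq_sym a1 a0.
  rewrite big_nat; apply: sumr_ge0 => k /andP[k1 kn]; apply: a0.
  by rewrite (leq_trans _ k1)//= ltnW.
have t0 : 0 < s + a n.+1 by rewrite ltr_pwDl.
exists (mix_map (s / (s + a n.+1)) g (f n.+1)).
  by apply: measurable_mix_map => //; apply: mf; rewrite leqnn.
move=> phi x bphi; rewrite [in LHS]big_nat_recr//= [in RHS]big_nat_recr//= -/s -gE//.
rewrite kop_mix//; last 2 first.
- apply/andP; split; first by rewrite divr_ge0// ltW.
  by rewrite ler_pdivrMr// mul1r lerDl.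
- by apply: mf; rewrite leqnn.
have -> : 1 - s / (s + a n.+1) = a n.+1 / (s + a n.+1).
  by field; exact: lt0r_neq0.
rewrite mulrDr !mulrA; congr (_ * _ + _ * _).
  by rewrite [X in X / _]mulrC mulfK// lt0r_neq0.
by rewrite [X in X / _]mulrC mulfK// lt0r_neq0.
Qed.

End splitting_ops.

Section transitions.
Context (R : realType).
Notation U := (U R).
Implicit Types (f g : R * R -> R) (phi psi : R -> R).

(** The law of f(x, u), with u uniform, is the conditional law dC(x, .)/dx; this is
    expressed after integration over the first variable. *)
Definition transition_of (C : R -> R -> R) f := preserves_U f /\
  forall x y, 0 <= x <= 1 -> 0 <= y <= 1 ->
    \int[U]_(t in `]-oo, x]) kop f \1_`]-oo, y] t = C x y.

Lemma uniform01P d (T : measurableType d) (P : probability T R) (X : {RV P >-> R}) :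
  uniform01 X -> forall A, measurable A -> P (X @^-1` A) = U A.
Proof. by move=> uX A mA; have := uX A mA. Qed.

Lemma uniform01_itv d (T : measurableType d) (P : probability T R) (X : {RV P >-> R}) :
  uniform01 X -> P (X @^-1` `[0, 1]%classic) = 1%E.
Proof. by move=> uX; rewrite (uniform01P uX)// U01. Qed.

Lemma copula_transition (C : R -> R -> R) : is_copula C ->
  exists f, transition_of C f.
Proof.
move=> [d [T [P [X [Y [uX uY XYC]]]]]].
have mX : measurable_fun setT X by [].
have mY : measurable_fun setT Y by [].
have [f mf fE] := disintegration mX mY (uniform01P uX) (uniform01_itv uY).
have joint A B : measurable A -> measurable B ->
    P (X @^-1` A `&` Y @^-1` B) = (\int[U]_(x in A) kop f \1_B x)%:E.
  by move=> mA mB; rewrite fE// kop_joint.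
exists f; split.
  split=> // B mB; have := joint setT B measurableT mB.
  by rewrite preimage_setT setTI (uniform01P uY)// => ->.
by move=> x y x01 y01; apply: EFin_inj; rewrite -joint// -XYC//; congr (P _).
Qed.

(** Disintegrate the law of the pair (f(x, u), x) over its first component: g is a map
    for the reversed chain. *)
Lemma transition_backward f : preserves_U f -> exists2 g, preserves_U g &
  forall phi psi, bm phi -> bm psi ->
    \int[U]_x (phi x * kop f psi x) = \int[U]_x (kop g phi x * psi x).
Proof.
move=> pf; have [mf hf] := pf.
have mfst : measurable_fun setT (@fst R R) := measurable_fst.
have f01 : (U \x U)%E ((@fst R R) @^-1` `[0, 1]%classic) = 1%E.
  rewrite (_ : _ @^-1` _ = `[0, 1]%classic `*` [set: R]); last first.
    by apply/seteqP; split => -[x u] //= [].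
  rewrite product_measure1E//.
  rewrite [X in (X * _)%E](_ : _ = 1%E); last exact: U01.
  rewrite mul1e; exact: probability_setT.
have [g mg gE] := disintegration mf mfst (preserves_U_law pf) f01.
have joint A B : measurable A -> measurable B ->
    \int[U]_(x in A) kop f \1_B x = \int[U]_(x in B) kop g \1_A x.
  move=> mA mB; apply: EFin_inj; rewrite -(kop_joint mf mA mB) -(kop_joint mg mB mA).
  apply: (etrans _ (gE B A mB mA)); congr ((U \x U)%E _).
  by apply/seteqP; split => z /=; tauto.
have pg : preserves_U g.
  split=> // B mB; rewrite -(joint B setT mB measurableT) indicT kop_one.
  by rewrite -[LHS]/(\int[U]_(x in B) (cst 1 x)) Rintegral_cst// mul1r.
exists g => // phi psi bphi bpsi.
have bh : bm (fun w : R * R => phi w.1 * psi w.2).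
  by apply: bmM; [exact: (bm_comp measurable_fst bphi)|
    exact: (bm_comp measurable_snd bpsi)].
have := eq_Rintegral_pair mfst mf mg mfst _ bh => /(_ (U \x U)%E (U \x U)%E) /= h.
have lhs : \int[U]_x (phi x * kop f psi x) =
    \int[(U \x U)%E]_w (phi w.1 * psi (f w)).
  have b1 : bm (fun w => phi w.1 * psi (f w)).
    by apply: bmM; [exact: (bm_comp measurable_fst bphi)|exact: (bm_comp mf bpsi)].
  have [_ ->] := bm_fubini U U b1; apply: eq_Rintegral => x _ /=.
  by rewrite RintegralZl//; exact: (bm_integrable U (bm_section x mf bpsi)).
have rhs : \int[U]_x (kop g phi x * psi x) =
    \int[(U \x U)%E]_w (phi (g w) * psi w.1).
  have b1 : bm (fun w => phi (g w) * psi w.1).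
    by apply: bmM; [exact: (bm_comp mg bphi)|exact: (bm_comp measurable_fst bpsi)].
  have [_ ->] := bm_fubini U U b1; apply: eq_Rintegral => x _ /=.
  by rewrite RintegralZr//; exact: (bm_integrable U (bm_section x mg bphi)).
rewrite lhs rhs; apply: h => A B mA mB.
rewrite -[LHS]/((U \x U)%E [set z | A z.1 /\ B (f z)]) (kop_joint mf mA mB).
rewrite (joint A B mA mB) -(kop_joint mg mB mA).
by congr ((U \x U)%E _); apply/seteqP; split => z /=; tauto.
Qed.

End transitions.

(** * Markov chains indexed by the integers *)
Section sub_sigma_functions.
Context d (T : measurableType d) (R : realType).
Variable H : set (set T).

Lemma measurable_wrt_fun (f : T -> R) : measurable_wrt <<s H >> f ->
  measurable_fun setT (f : g_sigma_algebraType H -> R).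
Proof. by move=> mf _ Y mY; rewrite setTI; exact: mf. Qed.

Lemma fun_measurable_wrt (f : T -> R) :
  measurable_fun setT (f : g_sigma_algebraType H -> R) -> measurable_wrt <<s H >> f.
Proof. by move=> mf Y mY; have := mf measurableT Y mY; rewrite setTI. Qed.

Lemma measurable_wrtM (f g : T -> R) : measurable_wrt <<s H >> f ->
  measurable_wrt <<s H >> g -> measurable_wrt <<s H >> (fun x => f x * g x).
Proof.
move=> /measurable_wrt_fun mf /measurable_wrt_fun mg.
by apply: fun_measurable_wrt; exact: measurable_funM.
Qed.

Lemma measurable_wrt_indic (A : set T) : <<s H >> A ->
  measurable_wrt <<s H >> (\1_A : T -> R).
Proof.
move=> HA; apply: fun_measurable_wrt.
exact: (@measurable_indic _ (g_sigma_algebraType H) R setT A).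
Qed.

Lemma measurable_wrt_cst (c : R) : measurable_wrt <<s H >> (fun _ : T => c).
Proof. by apply: fun_measurable_wrt; exact: measurable_cst. Qed.

End sub_sigma_functions.

Section process_sigma.
Context (R : realType) (X : process R).
Let P := process_prob X.
Let T := process_space X.
Implicit Types (J : set int).

Lemma measurable_process (i : int) : measurable_fun setT (X i : T -> R).
Proof. by []. Qed.

Lemma measurable_process_pre (i : int) D : measurable D -> measurable (X i @^-1` D).
Proof. by move=> mD; rewrite -[Z in measurable Z]setTI; exact: measurable_process. Qed.

Lemma sigma_of_gen J i D : J i -> measurable D -> @sigma_of R X J (X i @^-1` D).
Proof.
move=> Ji mD; apply: sub_sigma_algebra; exists i => //; exists D => //.
by rewrite setTI.
Qed.

Lemma sigma_of_smallest J (F : set (set T)) : sigma_algebra setT F ->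
  (forall i D, J i -> measurable D -> F (X i @^-1` D)) -> @sigma_of R X J `<=` F.
Proof.
move=> sF h; apply: smallest_sub => //.
by move=> _ [i Ji [D mD <-]]; rewrite setTI; exact: h.
Qed.

Lemma sigma_of_measurable J : @sigma_of R X J `<=` measurable.
Proof.
apply: sigma_of_smallest; first exact: sigma_algebra_measurable.
by move=> i D _; exact: measurable_process_pre.
Qed.

Lemma sub_sigma_of J J' : J `<=` J' -> @sigma_of R X J `<=` @sigma_of R X J'.
Proof.
move=> JJ'; apply: sigma_of_smallest; first exact: smallest_sigma_algebra.
by move=> i D Ji; apply: sigma_of_gen; exact: JJ'.
Qed.

Lemma measurable_wrt_process J i (h : R -> R) : J i -> measurable_fun setT h ->
  measurable_wrt (@sigma_of R X J) (fun w => h (X i w)).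
Proof.
move=> Ji mh D mD; rewrite -[_ @^-1` _]/(X i @^-1` (h @^-1` D)).
by apply: sigma_of_gen => //; rewrite -[Z in measurable Z]setTI; exact: mh.
Qed.

(** Events about finitely many coordinates form a pi-system generating the
    sigma-field of all of them. *)
Definition block (t : nat -> int) (N : nat) (B : nat -> set R) : set T :=
  [set w | forall i, (i < N)%N -> B i (X (t i) w)].

Definition blocks (t : nat -> int) : set (set T) :=
  [set A | exists N B, (forall i, measurable (B i)) /\ A = block t N B].

Lemma block_sigma t N B : (forall i, measurable (B i)) ->
  @sigma_of R X (range t) (block t N B).
Proof.
move=> mB; have -> : block t N B = \bigcap_(i in `I_N) (X (t i) @^-1` B i) by [].
set H := \bigcup_(i in range t) preimage_set_system setT (X i) measurable.
apply: (@fin_bigcap_measurable _ (g_sigma_algebraType H)) => [|i _].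
  exact: finite_II.
by apply: sigma_of_gen => //; exists i.
Qed.

Lemma blocks_setI_closed t : setI_closed (blocks t).
Proof.
move=> _ _ [N [B [mB ->]]] [M [C [mC ->]]].
exists (maxn N M), (fun i => (if (i < N)%N then B i else setT) `&`
                             (if (i < M)%N then C i else setT)).
split=> [i|]; first by apply: measurableI; case: ifP.
apply/seteqP; split => w /=.
  by move=> [wB wC] i _; split; case: ifP => // ilt; [exact: wB|exact: wC].
move=> h; split => i ilt.
  by have := h i; rewrite leq_max ilt => /(_ isT) [].
by have := h i; rewrite leq_max ilt orbT => /(_ isT) [].
Qed.

Lemma blocks_setT t : blocks t setT.
Proof.
by exists 0%N, (fun=> setT); split => //; apply/seteqP; split.
Qed.

Lemma blocks_generate t : @sigma_of R X (range t) `<=` <<s blocks t >>.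
Proof.
apply: sigma_of_smallest; first exact: smallest_sigma_algebra.
move=> _ D [i _ <-] mD; apply: sub_sigma_algebra.
exists i.+1, (fun j => if j == i then D else setT); split.
  by move=> j; case: ifP.
apply/seteqP; split => w /=.
  by move=> Dw j _; case: eqP => [->|].
by move=> /(_ i (ltnSn i)); rewrite eqxx.
Qed.

Lemma blocks_measurable t : blocks t `<=` measurable.
Proof.
move=> _ [N [B [mB ->]]]; apply: (@sigma_of_measurable (range t)).
exact: block_sigma.
Qed.

End process_sigma.
Arguments block {R} X t N B.
Arguments blocks {R} X t.

Section markov_chain.
Context (R : realType) (X : process R) (f : R * R -> R).
Notation P := (process_prob X).
Notation T := (process_space X).
Notation U := (U R).
Notation past m := (@sigma_of R X [set i | i <= m]).
Hypothesis law_X : forall m D, measurable D -> P (X m @^-1` D) = U D.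
Hypothesis pf : preserves_U f.
Hypothesis mkv : forall m A phi, past m A -> bm phi ->
  \int[P]_(w in A) phi (X (m + 1) w) = \int[P]_(w in A) kop f phi (X m w).
Let mf : measurable_fun setT f. Proof. by case: pf. Qed.
Let mk : markov_op U (kop f). Proof. exact: kop_markov. Qed.
Implicit Types (m : int).

Lemma bm_process m (phi : R -> R) : bm phi -> bm (fun w => phi (X m w)).
Proof. by move=> bphi; exact: (bm_comp (@measurable_process R X m) bphi). Qed.

Lemma Rintegral_marginal m (phi : R -> R) : bm phi -> \int[P]_w phi (X m w) = \int[U]_x phi x.
Proof.
move=> bphi; rewrite [RHS](_ : _ = \int[U]_w phi (id w))//.
apply: (@eq_Rintegral_law _ _ _ _ _ _ _ P U (X m) id) => //.
by move=> B mB; exact: law_X.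
Qed.

(** From indicators of past events to integrable functions of the past. *)
Lemma markov_step m (psi : T -> R) (phi : R -> R) : measurable_wrt (past m) psi ->
  P.-integrable setT (EFin \o psi) -> bm phi ->
  \int[P]_w (psi w * phi (X (m + 1) w)) = \int[P]_w (psi w * kop f phi (X m w)).
Proof.
move=> mpsi ipsi bphi.
pose H := \bigcup_(i in [set i | i <= m]) preimage_set_system setT (X i) measurable.
apply: (@eq_Rintegral_sub_sigma _ _ _ P (past m) (past m)) => //.
- exact: sigma_of_measurable.
- move=> A B pA pB.
  exact: (@measurableI _ (g_sigma_algebraType H)).
- exact: (@measurableT _ (g_sigma_algebraType H)).
- exact: bm_process.
- exact: bm_process (posop_bm mk bphi).
- by move=> A pA; exact: mkv.
Qed.

Lemma markov_steps j m (psi : T -> R) (phi : R -> R) : measurable_wrt (past m) psi ->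
  P.-integrable setT (EFin \o psi) -> bm phi ->
  \int[P]_w (psi w * phi (X (m + j%:Z) w)) =
  \int[P]_w (psi w * iter j (kop f) phi (X m w)).
Proof.
move=> mpsi ipsi; elim: j phi => [|j ih] phi bphi; first by rewrite addr0.
rewrite iterSr -ih; last exact: (posop_bm mk).
have -> : m + j.+1%:Z = (m + j%:Z) + 1 by rewrite -addrA -[j.+1]addn1 PoszD.
apply: markov_step => // D mD; apply: (@sub_sigma_of _ _ [set i | i <= m]).
  by move=> i /= im; rewrite (le_trans im)// lerDl.
exact: mpsi.
Qed.

(** The conditional expectation of phi_0(X_m) ... phi_{N-1}(X_{m+N-1}) given the
    past up to m, as a function of X_m. *)
Fixpoint block_op (N : nat) (phi : nat -> R -> R) : R -> R :=
  if N is M.+1 then fun x => phi 0%N x * kop f (block_op M (fun i => phi i.+1)) x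
  else cst 1.

Lemma bm_block_op N (phi : nat -> R -> R) : (forall i, bm (phi i)) -> bm (block_op N phi).
Proof.
elim: N phi => [|N ih] phi bphi; first exact: (bm_cst 1).
by apply: bmM => //; apply: (posop_bm mk); exact: ih.
Qed.

(** Condition successively, absorbing the first factor into psi. *)
Lemma block_expectation N m (psi : T -> R) (phi : nat -> R -> R) :
  measurable_wrt (past m) psi -> bm psi -> (forall i, bm (phi i)) ->
  \int[P]_w (psi w * \prod_(i < N) phi i (X (m + i%:Z) w)) =
  \int[P]_w (psi w * block_op N phi (X m w)).
Proof.
elim: N m psi phi => [|N ih] m psi phi mpsi bpsi bphi.
  by apply: eq_Rintegral => w _; rewrite big_ord0.
pose psi' w := psi w * phi 0%N (X m w).
have mpsi' : measurable_wrt (past m) psi'.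
  apply: measurable_wrtM => //.
  by apply: measurable_wrt_process => //=; case: (bphi 0%N).
have bpsi' : bm psi' by apply: bmM => //; exact: bm_process.
transitivity (\int[P]_w (psi' w *
    \prod_(i < N) phi i.+1 (X ((m + 1) + i%:Z) w))).
  apply: eq_Rintegral => w _; rewrite big_ord_recl /= addr0 mulrA; congr (_ * _).
  by apply: eq_bigr => i _; rewrite -addrA -PoszD add1n.
rewrite (ih (m + 1) psi' (fun i => phi i.+1))//; last first.
  move=> D mD; apply: (@sub_sigma_of _ _ [set i | i <= m]); last exact: mpsi'.
  by move=> i /= im; rewrite (le_trans im)// lerDl.
rewrite markov_step//; last 2 first.
- exact: bm_integrable.
- exact: bm_block_op.
by apply: eq_Rintegral => w _; rewrite /psi' /= mulrA.
Qed.

Lemma block_indic (t : nat -> int) N (B : nat -> set R) (w : T) :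
  \prod_(i < N) (\1_(B i) (X (t i) w) : R) = \1_(block X t N B) w.
Proof.
have [wB|nwB] := pselect (block X t N B w).
  rewrite indicE mem_set// big1// => i _; rewrite indicE mem_set//.
  exact: wB.
rewrite indicE memNset//.
have /existsNP[i /not_implyP[iN nB]] := nwB.
rewrite (bigD1 (Ordinal iN))//= indicE memNset ?mul0r//.
Qed.

Lemma block_probability m N (B : nat -> set R) : (forall i, measurable (B i)) ->
  fine (P (block X (fun i => m + i%:Z) N B)) =
  \int[U]_x block_op N (fun i => \1_(B i)) x.
Proof.
move=> mB; have bB i : bm (\1_(B i) : R -> R) by exact: bm_indic.
rewrite -(Rintegral_marginal m (bm_block_op N bB)).
have mA : measurable (block X (fun i => m + i%:Z) N B).
  by apply: (@blocks_measurable _ _ (fun i => m + i%:Z)); exists N, B.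
rewrite -Rintegral_indicP//.
transitivity (\int[P]_w (1 * \prod_(i < N) \1_(B i) (X (m + i%:Z) w))).
  apply: eq_Rintegral => w _; rewrite mul1r.
  by rewrite (block_indic (fun i => m + i%:Z)).
rewrite (@block_expectation N m (fun=> 1) (fun i => \1_(B i)))//.
- by apply: eq_Rintegral => w _; rewrite mul1r.
- exact: measurable_wrt_cst.
- exact: (bm_cst 1).
Qed.

(** Any finite set of times lies in a block of consecutive integers; times that
    occur several times in t contribute the intersection of their events, and the
    missing ones contribute the whole space.  The probability of a block does not
    involve its starting time. *)
Lemma chain_stationary : stationary X.
Proof.
move=> k t B h mB.
pose m := - (\sum_(i < k) `|t i|%N)%:Z.
pose N := ((\sum_(i < k) `|t i|%N) * 2).+1.
pose D j := \bigcap_(i in [set i | t i = m + j%:Z]) B i.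
have mD j : measurable (D j) by apply: fin_bigcap_measurable.
have tm i : exists2 j, (j < N)%N & t i = m + j%:Z.
  have ti : (`|t i| <= \sum_(i < k) `|t i|)%N by rewrite (bigD1 i)//= leq_addr.
  exists `|t i - m|%N; first by rewrite /N /m; lia.
  by rewrite /m; lia.
have E (s : int) : \bigcap_(i in setT) (X (t i + s) @^-1` B i) =
    block X (fun j => (m + s) + j%:Z) N D.
  apply/seteqP; split => w wB.
    move=> j jN i /= tij; have := wB i I; rewrite /= tij.
    by rewrite addrAC.
  move=> i _ /=; have [j jN tij] := tm i.
  by have := wB j jN i tij; rewrite tij addrAC.
have E0 : \bigcap_(i in setT) (X (t i) @^-1` B i) =
    block X (fun j => (m + 0) + j%:Z) N D.
  by rewrite -E; apply: eq_bigcapr => i _; rewrite addr0.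
have mblk s : measurable (block X (fun j => (m + s) + j%:Z) N D).
  by apply: (@blocks_measurable _ _ (fun j => (m + s) + j%:Z)); exists N, D.
rewrite E0 E -[LHS]fineK ?fin_num_measure// -[RHS]fineK ?fin_num_measure//.
by rewrite !block_probability.
Qed.

End markov_chain.

(** * Existence of the two-sided chain *)
Section two_sided_chain.
Context (R : realType) (G : R -> R * R).
Notation U := (U R).
Hypothesis mG : measurable_fun setT G.
Hypothesis GU : forall E, measurable E -> U (G @^-1` E) = (U \x U)%E E.
Variables f g : R * R -> R.
Hypotheses (pf : preserves_U f) (pg : preserves_U g).
Hypothesis fg : forall phi psi, bm phi -> bm psi ->
  \int[U]_x (phi x * kop f psi x) = \int[U]_x (kop g phi x * psi x).

(** A state is a position together with unused noise; one step splits the noise and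
    spends one half of it. *)
Definition noise_step (h : R * R -> R) (z : R * R) : R * R :=
  (h (z.1, (G z.2).1), (G z.2).2).

Let mG1 : measurable_fun setT (fun u => (G u).1).
Proof. exact: measurableT_comp measurable_fst mG. Qed.

Let mG2 : measurable_fun setT (fun u => (G u).2).
Proof. exact: measurableT_comp measurable_snd mG. Qed.

Let m2 (h : R -> R) : measurable_fun setT h ->
  measurable_fun setT (fun z : R * R => h z.2 : R).
Proof. by move=> mh; exact: measurableT_comp mh measurable_snd. Qed.

Let measurable_noise_step h : measurable_fun setT h ->
  measurable_fun setT (noise_step h).
Proof.
move=> mh; apply: measurable_fun_pair; last exact: m2 mG2.
apply: (measurableT_comp mh); apply: measurable_fun_pair; last exact: m2 mG1.
exact: measurable_fst.
Qed.

Let measurable_iter_step h n : measurable_fun setT h ->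
  measurable_fun setT (iter n (noise_step h)).
Proof.
move=> mh; elim: n => [|n ih] /=; first exact: measurable_id.
exact: measurableT_comp (measurable_noise_step mh) ih.
Qed.

Let average (K : R * R -> R) (y : R) := \int[U]_t K (y, t).

Let bm_average K : bm K -> bm (average K).
Proof. by move=> bK; case: (bm_fubini U U bK). Qed.

Let average_step h K y : measurable_fun setT h -> bm K ->
  \int[U]_s K (noise_step h (y, s)) = kop h (average K) y.
Proof.
move=> mh bK.
apply: (Rintegral_splitting mG GU (h := fun v => K (h (y, v.1), v.2))).
apply: bm_comp bK; apply: measurable_fun_pair; last exact: measurable_snd.
apply: (measurableT_comp mh); apply: measurable_fun_pair; last exact: measurable_fst.
exact: measurable_cst.
Qed.

(** After a step the position is uniform and independent of the remaining noise. *)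
Let step_invariant h K : preserves_U h -> bm K ->
  \int[(U \x U)%E]_z K (noise_step h z) = \int[(U \x U)%E]_z K z.
Proof.
move=> ph bK; have [mh _] := ph.
have [_ ->] := bm_fubini U U (bm_comp (measurable_noise_step mh) bK).
have [_ ->] := bm_fubini U U bK.
rewrite -(markov_int (kop_markov ph) (bm_average bK)).
by apply: eq_Rintegral => y _; exact: average_step.
Qed.

Let iter_step_invariant h n K : preserves_U h -> bm K ->
  \int[(U \x U)%E]_z K (iter n (noise_step h) z) = \int[(U \x U)%E]_z K z.
Proof.
move=> ph bK; have [mh _] := ph; elim: n => // n <-.
have bKi := bm_comp (measurable_iter_step n mh) bK.
rewrite -(step_invariant ph bKi); apply: eq_Rintegral => z _ /=.
by rewrite -iterSr.
Qed.

Let start (w : R) := (G w).1.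
Let seed_f (w : R) := (G (G w).2).1.
Let seed_b (w : R) := (G (G w).2).2.

Let measurable_seed_f : measurable_fun setT seed_f.
Proof. exact: measurableT_comp mG1 mG2. Qed.

Let measurable_seed_b : measurable_fun setT seed_b.
Proof. exact: measurableT_comp mG2 mG2. Qed.

Let expect_start (H : R * (R * R) -> R) : bm H ->
  \int[U]_w H (start w, (seed_f w, seed_b w)) =
  \int[U]_x \int[U]_s \int[U]_t H (x, (s, t)).
Proof.
move=> bH.
pose H' (z : R * R) := H (z.1, G z.2).
have bH' : bm H'.
  apply: bm_comp bH; apply: measurable_fun_pair; first exact: measurable_fst.
  exact: measurableT_comp mG measurable_snd.
transitivity (\int[U]_w H' (G w)).
  by apply: eq_Rintegral => w _; rewrite /H' /start /seed_f /seed_b; case: (G _.2).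
rewrite (Rintegral_splitting mG GU bH'); apply: eq_Rintegral => x _.
apply: (Rintegral_splitting mG GU (h := fun v => H (x, v))).
by apply: bm_comp bH; exact: pair1_measurable.
Qed.

Let fwd (n : nat) (w : R) := iter n (noise_step f) (start w, seed_f w).
Let bwd (n : nat) (w : R) := iter n (noise_step g) (start w, seed_b w).

Let mf : measurable_fun setT f. Proof. by case: pf. Qed.
Let mg : measurable_fun setT g. Proof. by case: pg. Qed.

Let measurable_fwd n : measurable_fun setT (fwd n).
Proof.
apply: (measurableT_comp (measurable_iter_step n mf)).
exact: measurable_fun_pair.
Qed.

Let measurable_bwd n : measurable_fun setT (bwd n).
Proof.
apply: (measurableT_comp (measurable_iter_step n mg)).
exact: measurable_fun_pair.
Qed.

Let expect_fwd n K : bm K -> \int[U]_w K (fwd n w) = \int[(U \x U)%E]_z K z.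
Proof.
move=> bK; rewrite -(iter_step_invariant n pf bK).
have bKi := bm_comp (measurable_iter_step n mf) bK.
have [_ ->] := bm_fubini U U bKi.
rewrite (@expect_start (fun v => K (iter n (noise_step f) (v.1, v.2.1)))); last first.
  apply: (bm_comp _ bKi); apply: measurable_fun_pair; first exact: measurable_fst.
  exact: measurableT_comp measurable_fst measurable_snd.
apply: eq_Rintegral => x _; apply: eq_Rintegral => s _.
exact: (Rintegral_cstP U (K (iter n (noise_step f) (x, s)))).
Qed.

Let expect_bwd n K : bm K -> \int[U]_w K (bwd n w) = \int[(U \x U)%E]_z K z.
Proof.
move=> bK; rewrite -(iter_step_invariant n pg bK).
have bKi := bm_comp (measurable_iter_step n mg) bK.
have [_ ->] := bm_fubini U U bKi.
rewrite (@expect_start (fun v => K (iter n (noise_step g) (v.1, v.2.2)))); last first.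
  apply: (bm_comp _ bKi); apply: measurable_fun_pair; first exact: measurable_fst.
  exact: measurableT_comp measurable_snd measurable_snd.
apply: eq_Rintegral => x _.
exact: (Rintegral_cstP U (\int[U]_t K (iter n (noise_step g) (x, t)))).
Qed.

(** From a uniform starting point, the nonnegative times are driven forwards by f and the negative
    times backwards by g, with independent noises. *)
Definition chain_var (i : int) (w : R) : R :=
  match i with Posz n => (fwd n w).1 | Negz n => (bwd n.+1 w).1 end.

Let measurable_chain_var i : measurable_fun setT (chain_var i).
Proof.
case: i => n; apply: (measurableT_comp measurable_fst).
  exact: measurable_fwd.
exact: measurable_bwd.
Qed.

Let chain_varN n w : chain_var (- n%:Z) w = (bwd n w).1.
Proof. by case: n => [|n] //=; rewrite -NegzE. Qed.

HB.instance Definition _ i := isMeasurableFun.Build _ _ R R (chain_var i)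
  (measurable_chain_var i).

Definition chain : process R :=
  @Process R _ R U (fun i => [the {mfun R >-> R} of chain_var i]).

Let chain_law m D : measurable D -> process_prob chain (chain m @^-1` D) = U D.
Proof.
move=> mD.
have mD2 : measurable (D `*` [set: R]) by exact: measurableX.
have bD : bm (\1_(D `*` [set: R]) : R * R -> R) by exact: bm_indic.
have UD : \int[(U \x U)%E]_z \1_(D `*` [set: R]) z = fine (U D).
  rewrite (Rintegral_indicP (U \x U)%E mD2); congr fine.
  apply: (etrans (product_measure1E _ _ mD measurableT)).
  by rewrite [X in (_ * X)%E](_ : _ = 1%E) ?mule1//; exact: probability_setT.
have mE : measurable (chain_var m @^-1` D).
  by rewrite -[Z in measurable Z]setTI; exact: measurable_chain_var.
rewrite -[LHS]/(U (chain_var m @^-1` D)).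
rewrite -[LHS]fineK ?fin_num_measure// -[RHS]fineK ?fin_num_measure//; congr EFin.
rewrite -UD -Rintegral_indicP//.
case: m {mE} => n; [rewrite -(expect_fwd n bD)|rewrite -(expect_bwd n.+1 bD)];
  apply: eq_Rintegral => w _; rewrite !indicE; congr (_%:R); congr nat_of_bool;
  by apply/idP/idP; rewrite !inE//= => -[].
Qed.

(** Variables that do not depend on the noise used after time m, expressed by the
    fact that this noise can be averaged out. *)
Let adapted (m : nat) (Z : R -> R) := bm Z /\ forall h, bm h ->
  \int[U]_w (Z w * h (fwd m w)) = \int[U]_w (Z w * average h (fwd m w).1).

Let bm_fwd m (h : R * R -> R) : bm h -> bm (fun w => h (fwd m w)).
Proof. by move=> bh; exact: (bm_comp (measurable_fwd m) bh). Qed.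

Let bm_fst (h : R -> R) : bm h -> bm (fun z : R * R => h z.1).
Proof. by move=> bh; exact: (bm_comp measurable_fst bh). Qed.

Let adaptedM m Z (theta : R -> R) : adapted m Z -> bm theta ->
  adapted m (fun w => Z w * theta (fwd m w).1).
Proof.
move=> [bZ aZ] bt; split.
  by apply: bmM => //; exact: (bm_fwd m (bm_fst bt)).
move=> h bh.
have bth : bm (fun z : R * R => theta z.1 * h z) by apply: bmM => //; exact: bm_fst.
transitivity (\int[U]_w (Z w * (fun z => theta z.1 * h z) (fwd m w))).
  by apply: eq_Rintegral => w _; rewrite mulrA.
apply: (etrans (aZ _ bth)); apply: eq_Rintegral => w _; rewrite -mulrA; congr (_ * _).
rewrite /average /= RintegralZl//.
by apply: bm_integrable; apply: bm_comp bh; exact: pair1_measurable.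
Qed.

Let adaptedS m Z : adapted m Z -> adapted m.+1 Z.
Proof.
move=> [bZ aZ]; split; first exact: bZ.
move=> h bh; have bs : bm (fun z => h (noise_step f z)).
  exact: (bm_comp (measurable_noise_step mf) bh).
have bs2 : bm (fun z => average h (noise_step f z).1).
  exact: (bm_comp (measurable_noise_step mf) (bm_fst (bm_average bh))).
transitivity (\int[U]_w (Z w * (fun z => h (noise_step f z)) (fwd m w))).
  by apply: eq_Rintegral.
apply: (etrans (aZ _ bs)).
transitivity (\int[U]_w (Z w * (fun z => average h (noise_step f z).1) (fwd m w))).
  apply: (etrans _ (esym (aZ _ bs2))); apply: eq_Rintegral => w _; congr (_ * _).
  have lhs := average_step (fwd m w).1 mf bh.
  have rhs := average_step (fwd m w).1 mf (bm_fst (bm_average bh)).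
  apply: (etrans lhs); apply: (etrans _ (esym rhs)).
  apply: (congr1 (fun q => kop f q (fwd m w).1)); apply/funext => y.
  exact: (esym (Rintegral_cstP U (average h y))).
by apply: eq_Rintegral => w _.
Qed.

(** The backward half of the chain only depends on the starting point and on its own
    noise. *)
Let adapted0 (z : R * R -> R) : bm z -> adapted 0 (fun w => z (start w, seed_b w)).
Proof.
move=> bz; split.
  by apply: bm_comp bz; apply: measurable_fun_pair.
move=> h bh.
have mst : measurable_fun setT (fun v : R * (R * R) => (v.1, v.2.2)).
  apply: measurable_fun_pair; first exact: measurable_fst.
  exact: measurableT_comp measurable_snd measurable_snd.
have mss : measurable_fun setT (fun v : R * (R * R) => (v.1, v.2.1)).
  apply: measurable_fun_pair; first exact: measurable_fst.
  exact: measurableT_comp measurable_fst measurable_snd.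
have bzv := bm_comp mst bz; have bhv := bm_comp mss bh.
have bav : bm (fun v : R * (R * R) => average h v.1).
  by exact: (bm_comp measurable_fst (bm_average bh)).
have sec_z x : bm (fun t => z (x, t)) by apply: bm_comp bz; exact: pair1_measurable.
have sec_h x : bm (fun t => h (x, t)) by apply: bm_comp bh; exact: pair1_measurable.
have := expect_start (bmM bzv bhv); rewrite /= => ->.
have := expect_start (bmM bzv bav); rewrite /= => ->.
apply: eq_Rintegral => x _.
transitivity (\int[U]_s (average z x * h (x, s))).
  apply: eq_Rintegral => s _ /=; rewrite RintegralZr//.
  exact: bm_integrable (sec_z x).
rewrite RintegralZl//; last exact: bm_integrable (sec_h x).
rewrite -[LHS](Rintegral_cstP U); apply: eq_Rintegral => s _ /=.
rewrite RintegralZr//; exact: bm_integrable (sec_z x).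
Qed.

Let bm_prod N (F : nat -> R * R -> R) : (forall i, bm (F i)) ->
  bm (fun z => \prod_(i < N) F i z).
Proof.
move=> bF; elim: N => [|N ih].
  by under eq_fun do rewrite big_ord0; exact: (bm_cst 1).
by under eq_fun do rewrite big_ord_recr/=; exact: bmM.
Qed.

Let adapted_past m N (theta : nat -> R -> R) : (forall i, bm (theta i)) ->
  adapted m (fun w => \prod_(i < N) theta i (chain_var (m%:Z - i%:Z) w)).
Proof.
elim: m N theta => [|m ih] N theta bt.
  pose z (v : R * R) := \prod_(i < N) theta i (iter i (noise_step g) v).1.
  have bz : bm z.
    apply: (@bm_prod N (fun i v => theta i (iter i (noise_step g) v).1)) => i.
    exact: (bm_comp (measurable_iter_step i mg) (bm_fst (bt i))).
  have := adapted0 bz; congr adapted; apply/funext => w; apply: eq_bigr => i _.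
  by rewrite sub0r chain_varN.
case: N => [|N].
  have := adaptedS (ih 0%N theta bt); congr adapted.
  by apply/funext => w; rewrite !big_ord0.
have := adaptedM (adaptedS (ih N (fun i => theta i.+1) (fun i => bt i.+1))) (bt 0%N).
congr adapted; apply/funext => w; rewrite big_ord_recl mulrC; congr (_ * _).
  by have -> : m.+1%:Z - (@ord0 N)%:Z = m.+1%:Z by rewrite /=; lia.
apply: eq_bigr => i _; congr (theta _ (chain_var _ _)).
by rewrite lift0; lia.
Qed.

Let chain_markov_nonneg (m : nat) N (theta : nat -> R -> R) (phi : R -> R) :
  (forall i, bm (theta i)) -> bm phi ->
  \int[U]_w ((\prod_(i < N) theta i (chain_var (m%:Z - i%:Z) w)) *
             phi (chain_var (m%:Z + 1) w)) =
  \int[U]_w ((\prod_(i < N) theta i (chain_var (m%:Z - i%:Z) w)) *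
             kop f phi (chain_var m%:Z w)).
Proof.
move=> bt bphi; have [bZ aZ] := adapted_past m N bt.
have -> : m%:Z + 1 = m.+1%:Z by lia.
have bs : bm (fun z => phi (noise_step f z).1).
  exact: (bm_comp (measurable_noise_step mf) (bm_fst bphi)).
have := aZ _ bs; rewrite /= => ->; apply: eq_Rintegral => w _; congr (_ * _).
apply: (etrans (average_step (fwd m w).1 mf (bm_fst bphi))).
apply: (congr1 (fun q => kop f q (fwd m w).1)); apply/funext => y.
exact: (Rintegral_cstP U (phi y)).
Qed.

(** Before time 0 the chain is built backwards, and the Markov property in the
    forward direction is the duality between f and g. *)
Let chain_markov_neg (k : nat) N (theta : nat -> R -> R) (phi : R -> R) :
  (forall i, bm (theta i)) -> bm phi ->
  \int[U]_w ((\prod_(i < N) theta i (chain_var (Negz k - i%:Z) w)) *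
             phi (chain_var (Negz k + 1) w)) =
  \int[U]_w ((\prod_(i < N) theta i (chain_var (Negz k - i%:Z) w)) *
             kop f phi (chain_var (Negz k) w)).
Proof.
move=> bt bphi.
pose z (v : R * R) := \prod_(i < N) theta i (iter i (noise_step g) v).1.
have bz : bm z.
  apply: (@bm_prod N (fun i v => theta i (iter i (noise_step g) v).1)) => i.
  exact: (bm_comp (measurable_iter_step i mg) (bm_fst (bt i))).
have zE w : \prod_(i < N) theta i (chain_var (Negz k - i%:Z) w) = z (bwd k.+1 w).
  apply: eq_bigr => i _; congr (theta _ _).
  have -> : Negz k - i%:Z = - (i + k.+1)%N%:Z by lia.
  by rewrite chain_varN /bwd iterD.
have bk : bm (kop f phi) by exact: (posop_bm (kop_posop mf)).
have bzs := bm_comp (measurable_noise_step mg) bz.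
transitivity (\int[U]_w ((fun v => z (noise_step g v) * phi v.1) (bwd k w))).
  apply: eq_Rintegral => w _; rewrite zE; congr (_ * phi _).
  have -> : Negz k + 1 = - k%:Z by lia.
  by rewrite chain_varN.
apply: (etrans (expect_bwd k (bmM bzs (bm_fst bphi)))).
transitivity (\int[U]_w ((fun v => z v * kop f phi v.1) (bwd k.+1 w))); last first.
  by apply: eq_Rintegral => w _; rewrite zE.
apply: (etrans _ (esym (expect_bwd k.+1 (bmM bz (bm_fst bk))))).
have [_ ->] := bm_fubini U U (bmM bzs (bm_fst bphi)).
have [_ ->] := bm_fubini U U (bmM bz (bm_fst bk)).
transitivity (\int[U]_y (kop g (average z) y * phi y)).
  apply: eq_Rintegral => y _ /=; rewrite RintegralZr//.
    by rewrite average_step.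
  by apply: bm_integrable; apply: bm_comp bzs; exact: pair1_measurable.
rewrite -fg//; last exact: bm_average.
apply: eq_Rintegral => y _ /=; rewrite RintegralZr//.
by apply: bm_integrable; apply: bm_comp bz; exact: pair1_measurable.
Qed.

Let chain_markov_cyl m N (theta : nat -> R -> R) (phi : R -> R) :
  (forall i, bm (theta i)) -> bm phi ->
  \int[U]_w ((\prod_(i < N) theta i (chain_var (m - i%:Z) w)) *
             phi (chain_var (m + 1) w)) =
  \int[U]_w ((\prod_(i < N) theta i (chain_var (m - i%:Z) w)) *
             kop f phi (chain_var m w)).
Proof.
by case: m => k bt bphi; [exact: chain_markov_nonneg|exact: chain_markov_neg].
Qed.

Let past_range (m : int) : [set i | i <= m] = range (fun i : nat => m - i%:Z).
Proof.
apply/seteqP; split => [i /= im|_ [i _ <-] /=]; last by rewrite gerBl.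
by exists `|m - i|%N => //; lia.
Qed.

(** It suffices to test on blocks of consecutive times ending at m. *)
Lemma chain_mkv m A (phi : R -> R) : @sigma_of R chain [set i | i <= m] A -> bm phi ->
  \int[process_prob chain]_(w in A) phi (chain (m + 1) w) =
  \int[process_prob chain]_(w in A) kop f phi (chain m w).
Proof.
move=> sA bphi; pose t (i : nat) : int := m - i%:Z.
have bk : bm (kop f phi) by exact: (posop_bm (kop_posop mf)).
have bv i (h : R -> R) : bm h -> bm (fun w => h (chain_var i w)).
  by move=> bh; exact: (bm_comp (measurable_chain_var i) bh).
apply: (etrans (Rintegral_indicM _ _ _)).
apply: (etrans _ (esym (Rintegral_indicM _ _ _))).
apply: (@eq_Rintegral_sub_sigma _ (process_space chain) _ (process_prob chain) (blocks chain t)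
    (@sigma_of R chain [set i | i <= m])).
- exact: blocks_measurable.
- exact: blocks_setI_closed.
- exact: blocks_setT.
- by rewrite past_range; exact: blocks_generate.
- exact: bv.
- exact: bv.
- move=> _ [N [B [mB ->]]].
  have bB i : bm (\1_(B i) : R -> R) by exact: bm_indic.
  have := @chain_markov_cyl m N (fun i => \1_(B i)) phi bB bphi.
  have ind w : \prod_(i < N) (\1_(B i) (chain_var (m - i%:Z) w) : R) =
      \1_(block chain t N B) w by rewrite -(@block_indic R chain t).
  under eq_Rintegral do rewrite ind.
  under [in RHS]eq_Rintegral do rewrite ind.
  move=> h; apply: (etrans (Rintegral_indicM _ _ _)).
  exact: (etrans h (esym (Rintegral_indicM _ _ _))).
- exact: measurable_wrt_indic.
- apply: bm_integrable; apply: bm_indic.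
  exact: (sigma_of_measurable sA).
Qed.

Lemma chain_lawE m D : measurable D -> process_prob chain (chain m @^-1` D) = U D.
Proof. exact: chain_law. Qed.

End two_sided_chain.

(** * Chains generated by a copula *)
Section markov_consequences.
Context (R : realType) (X : process R) (f : R * R -> R).
Notation P := (process_prob X).
Notation T := (process_space X).
Notation U := (U R).
Notation past m := (@sigma_of R X [set i | i <= m]).
Hypothesis law_X : forall m D, measurable D -> P (X m @^-1` D) = U D.
Hypothesis pf : preserves_U f.
Hypothesis mkv : forall m A (phi : R -> R), past m A -> bm phi ->
  \int[P]_(w in A) phi (X (m + 1) w) = \int[P]_(w in A) kop f phi (X m w).
Let mf : measurable_fun setT f. Proof. by case: pf. Qed.
Let mk : markov_op U (kop f). Proof. exact: kop_markov. Qed.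

Lemma markov_event j m A B : past m A -> measurable B ->
  fine (P (A `&` X (m + j%:Z) @^-1` B)) =
  \int[P]_(w in A) iter j (kop f) \1_B (X m w).
Proof.
move=> pA mB; have bB : bm (\1_B : R -> R) by exact: bm_indic.
have mA : measurable A by exact: (sigma_of_measurable pA).
have bA : bm (\1_A : T -> R) by exact: bm_indic.
have mXB : measurable (X (m + j%:Z) @^-1` B) by exact: measurable_process_pre.
rewrite -Rintegral_indicP; last exact: measurableI.
have h := @markov_steps R X f pf mkv j m \1_A \1_B (measurable_wrt_indic pA)
  (bm_integrable P bA) bB.
apply: (etrans _ (esym (Rintegral_indicM _ _ _))); apply: (etrans _ h).
by apply: eq_Rintegral => w _; rewrite indicI.
Qed.

(** The same function of X_m serves for every J between m and the whole past. *)
Lemma markov_cond_prob (J : set int) j m B : J m -> J `<=` [set i | i <= m] ->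
  measurable B ->
  is_cond_prob P (@sigma_of R X J) (X (m + j%:Z) @^-1` B)
    (fun w => iter j (kop f) \1_B (X m w)).
Proof.
move=> Jm Jpast mB.
have bB : bm (\1_B : R -> R) by exact: bm_indic.
have bk : bm (iter j (kop f) \1_B) by exact: (posop_bm (posop_iter j mk)).
have bkX := bm_process X m bk.
split.
- by apply: measurable_wrt_process => //; case: bk.
- exact: (bm_integrable P bkX).
move=> A sA.
have pA : past m A by exact: (sub_sigma_of Jpast).
have mA : measurable A by exact: (sigma_of_measurable pA).
have mXB : measurable (X (m + j%:Z) @^-1` B) by exact: measurable_process_pre.
have mI : measurable (X (m + j%:Z) @^-1` B `&` A) by exact: measurableI.
rewrite -[RHS]fineK ?fin_num_measure// setIC markov_event//.
rewrite /Rintegral fineK//; apply: integrable_fin_num => //.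
by apply: (integrableS measurableT) => //; exact: (bm_integrable P bkX).
Qed.

Lemma joint_law j m A B : measurable A -> measurable B ->
  P (X m @^-1` A `&` X (m + j%:Z) @^-1` B) =
  (\int[U]_(x in A) iter j (kop f) \1_B x)%:E.
Proof.
move=> mA mB; have bB : bm (\1_B : R -> R) by exact: bm_indic.
have bA : bm (\1_A : R -> R) by exact: bm_indic.
have bk : bm (iter j (kop f) \1_B) by exact: (posop_bm (posop_iter j mk)).
have mI : measurable (X m @^-1` A `&` X (m + j%:Z) @^-1` B).
  by apply: measurableI; exact: measurable_process_pre.
have pA : past m (X m @^-1` A) by apply: sigma_of_gen => /=.
rewrite -[LHS]fineK ?fin_num_measure//; congr EFin.
rewrite markov_event// [LHS]Rintegral_indicM [RHS]Rintegral_indicM.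
by rewrite -(Rintegral_marginal law_X m (bmM bA bk)).
Qed.

Lemma markov_generated_by (C : R -> R -> R) : transition_of C f -> generated_by C X.
Proof.
move=> [_ fC]; split.
- exact: (chain_stationary law_X pf mkv).
- move=> m B mB; exists (fun w => kop f \1_B (X m w)); split.
    by apply: (@markov_cond_prob [set m] 1) => // i /= ->.
  by apply: (@markov_cond_prob [set i | i <= m] 1) => //=.
- by move=> m A mA; exact: law_X.
- move=> m x y x01 y01; rewrite -fC//.
  rewrite -[RHS](@joint_law 1 m) //; congr (P _).
Qed.

End markov_consequences.

Lemma U01C (R : realType) : U R (~` `[0, 1]%classic) = 0%E.
Proof.
have mI : measurable (`[0, 1]%classic : set R) by exact: measurable_itv.
apply: (etrans (probability_setC (U R) mI)).
by rewrite [X in (_ - X)%E](_ : _ = 1%E) ?subee//; exact: U01.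
Qed.

(** A copula only specifies the joint distribution function on the unit square. *)
Lemma eq_measure_rays01 (R : realType) (m1 m2 : {measure set R -> \bar R}) :
  (m1 setT < +oo)%E -> (m2 setT < +oo)%E ->
  m1 (~` `[0, 1]%classic) = 0%E -> m2 (~` `[0, 1]%classic) = 0%E ->
  (forall y, 0 <= y <= 1 -> m1 `]-oo, y]%classic = m2 `]-oo, y]%classic) ->
  forall B, measurable B -> m1 B = m2 B.
Proof.
move=> oo1 oo2 out1 out2 h.
have mI : measurable (~` `[0, 1]%classic : set R) by exact: measurableC.
have null (m : {measure set R -> \bar R}) (A : set R) : m (~` `[0, 1]%classic) = 0%E ->
    measurable A -> A `<=` ~` `[0, 1]%classic -> m A = 0%E.
  move=> m0 mA A01; apply/eqP; rewrite eq_le measure_ge0 andbT -m0.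
  by apply: le_measure; rewrite ?inE.
have tot (m : {measure set R -> \bar R}) (y : R) : m (~` `[0, 1]%classic) = 0%E ->
    1 <= y -> m `]-oo, y]%classic = m setT.
  move=> m0 y1.
  have -> : [set: R] = `]-oo, y]%classic `|` `]y, +oo[%classic.
    by apply/seteqP; split => // x _ /=; rewrite !in_itv/= andbT; case: (leP x y); [left|right].
  rewrite measureU//; last first.
    by rewrite -subset0 => x [/=]; rewrite !in_itv/= andbT leNgt => /negP.
  rewrite [X in (_ + X)%E](_ : _ = 0%E) ?adde0//; apply: null => // x /=.
  rewrite !in_itv/= andbT => yx /andP[_ x1].
  by move: (lt_le_trans yx x1); rewrite ltNge y1.
have totE : m1 setT = m2 setT.
  by rewrite -(tot m1 1)// -(tot m2 1)// h// ler01 lexx.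
have closed y : m1 `]-oo, y]%classic = m2 `]-oo, y]%classic.
  have [y0|y0] := ltP y 0.
    have sub : `]-oo, y]%classic `<=` ~` `[0, 1]%classic.
      move=> x /=; rewrite !in_itv/= => xy /andP[x0 _].
      by move: (le_lt_trans xy y0); rewrite ltNge x0.
    rewrite (null m1 _ out1 _ sub)//; apply: esym; exact: (null m2 _ out2 _ sub).
  have [y1|y1] := leP y 1; first by apply: h; rewrite y0.
  rewrite (tot m1 _ out1)//; last exact: ltW.
  by rewrite (tot m2 _ out2)//; exact: ltW.
have mE : (measurable : set (set R)) = <<s @RGenOInfty.G R >>.
  exact: (@RGenOInfty.measurableE R).
have open y : m1 `]y, +oo[%classic = m2 `]y, +oo[%classic.
  have -> : `]y, +oo[%classic = ~` `]-oo, y]%classic.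
    by apply/seteqP; split => x /=; rewrite !in_itv/= andbT ltNge => /negP.
  have mD (m : {measure set R -> \bar R}) : (m setT < +oo)%E ->
      m (~` `]-oo, y]%classic) = (m setT - m `]-oo, y]%classic)%E.
    by move=> moo; rewrite -setTD measureD// setTI.
  by rewrite !mD// closed totE.
move=> B mB.
apply: (measure_unique (@RGenOInfty.G R) (fun n => `]- n%:R, +oo[%classic)) => //.
- move=> _ _ [x ->] [y ->]; exists (Num.max x y).
  by apply/seteqP; split => z /=; rewrite !in_itv/= !andbT gt_max => /andP.
- by move=> n; exists (- n%:R).
- apply/seteqP; split => // x _; exists (Num.truncn (- x)).+1 => //=.
  by rewrite in_itv/= andbT ltrNl truncnS_gt.
- by move=> _ [y ->]; exact: open.
- by move=> n; apply: le_lt_trans oo1; apply: le_measure; rewrite ?inE//.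
Qed.

Section generated_chain.
Context (R : realType) (X : process R) (C : R -> R -> R) (f : R * R -> R).
Notation P := (process_prob X).
Notation T := (process_space X).
Notation U := (U R).
Notation past m := (@sigma_of R X [set i | i <= m]).
Hypothesis gX : generated_by C X.
Hypothesis tf : transition_of C f.
Let pf : preserves_U f. Proof. by case: tf. Qed.
Let mf : measurable_fun setT f. Proof. by case: pf. Qed.
Let mk : markov_op U (kop f). Proof. exact: kop_markov. Qed.

Lemma generated_law m D : measurable D -> P (X m @^-1` D) = U D.
Proof. by case: gX => _ _ uX _ mD; exact: uniform01P. Qed.

Let mX m D : measurable D -> measurable (X m @^-1` D).
Proof. exact: measurable_process_pre. Qed.

Let null01 m (A : set T) : measurable A -> P (A `&` X m @^-1` (~` `[0, 1]%classic)) = 0%E.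
Proof.
move=> mA; have mI : measurable (~` `[0, 1]%classic : set R) by exact: measurableC.
apply/eqP; rewrite eq_le measure_ge0 andbT.
have <- : P (X m @^-1` (~` `[0, 1]%classic)) = 0%E.
  by rewrite generated_law//; exact: U01C.
apply: le_measure; rewrite ?inE//; [|exact: mX].
by apply: measurableI => //; exact: mX.
Qed.

Let nullU (A : set (R * R)) (k : R * R -> R) : preserves_U k -> measurable A ->
  (U \x U)%E (A `&` k @^-1` (~` `[0, 1]%classic)) = 0%E.
Proof.
move=> pk mA; have mI : measurable (~` `[0, 1]%classic : set R) by exact: measurableC.
have mkI : measurable (k @^-1` (~` `[0, 1]%classic)).
  by rewrite -[X in measurable X]setTI; apply: (pk.1).
apply/eqP; rewrite eq_le measure_ge0 andbT.
have <- : (U \x U)%E (k @^-1` (~` `[0, 1]%classic)) = 0%E.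
  by apply: (etrans (preserves_U_law pk _)) => //; exact: U01C.
apply: le_measure; rewrite ?inE//.
by apply: measurableI.
Qed.

Let preserves_U_fst : preserves_U (@fst R R).
Proof.
split; first exact: measurable_fst.
move=> B mB; rewrite -Rintegral_indicP//; apply: eq_Rintegral => x _.
exact: (Rintegral_cstP U (\1_B x)).
Qed.

Let fin_P (A : set T) : measurable A -> (P A < +oo)%E.
Proof. by move=> mA; rewrite -ge0_fin_numE// fin_num_measure. Qed.

Let fin_UU (A : set (R * R)) : measurable A -> ((U \x U)%E A < +oo)%E.
Proof.
by move=> mA; apply: (le_lt_trans (probability_le1 (U \x U)%E mA)); rewrite ltry.
Qed.

Let mfB B : measurable B -> measurable (f @^-1` B).
Proof. by move=> mB; rewrite -[Z in measurable Z]setTI; exact: mf. Qed.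

(** Two passages from distribution functions to Borel sets, one for each coordinate:
    here the first one. *)
Let joint_half m y A : 0 <= y <= 1 -> measurable A ->
  P (X m @^-1` A `&` X (m + 1) @^-1` `]-oo, y]%classic) =
  (U \x U)%E [set z | A z.1 /\ `]-oo, y]%classic (f z)].
Proof.
move=> y01 mA.
have mV : measurable (X (m + 1) @^-1` `]-oo, y]%classic) by exact: mX.
have mF : measurable (f @^-1` `]-oo, y]%classic) by exact: mfB.
apply: (@eq_measure_rays01 R (pushforward (mrestr P mV) (X m))
  (pushforward (mrestr (U \x U)%E mF) fst)) => //.
- exact: (fin_P (measurableI _ _ measurableT mV)).
- exact: (fin_UU (measurableI _ _ measurableT mF)).
- rewrite -[LHS]/(P (X m @^-1` (~` `[0, 1]%classic) `&` _)) setIC.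
  exact: null01.
- rewrite -[LHS]/((U \x U)%E (fst @^-1` (~` `[0, 1]%classic) `&` _)) setIC.
  exact: nullU.
move=> x x01.
rewrite -[RHS]/((U \x U)%E [set z | `]-oo, x]%classic z.1 /\ `]-oo, y]%classic (f z)]).
rewrite kop_joint//.
have [_ ->] := tf => //.
have [_ _ _ jX] := gX.
by rewrite -(jX m)//.
Qed.

Lemma generated_joint m A B : measurable A -> measurable B ->
  P (X m @^-1` A `&` X (m + 1) @^-1` B) = (\int[U]_(x in A) kop f \1_B x)%:E.
Proof.
move=> mA mB; rewrite -kop_joint//.
have mXA : measurable (X m @^-1` A) by exact: mX.
have mAT : measurable (A `*` [set: R]) by exact: measurableX.
transitivity (pushforward (mrestr (U \x U)%E mAT) f B); last first.
  rewrite -[LHS]/((U \x U)%E (f @^-1` B `&` (A `*` [set: R]))).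
  by congr ((U \x U)%E _); apply/seteqP; split => z /=; tauto.
rewrite setIC.
apply: (@eq_measure_rays01 R (pushforward (mrestr P mXA) (X (m + 1)))
  (pushforward (mrestr (U \x U)%E mAT) f)) => //.
- exact: (fin_P (measurableI _ _ measurableT mXA)).
- exact: (fin_UU (measurableI _ _ measurableT mAT)).
- rewrite -[LHS]/(P (X (m + 1) @^-1` (~` `[0, 1]%classic) `&` _)) setIC.
  exact: null01.
- rewrite -[LHS]/((U \x U)%E (f @^-1` (~` `[0, 1]%classic) `&` _)) setIC.
  exact: nullU.
move=> y y01; rewrite -[LHS]/(P (X (m + 1) @^-1` `]-oo, y]%classic `&` X m @^-1` A)).
rewrite setIC (joint_half m y01 mA).
rewrite -[RHS]/((U \x U)%E (f @^-1` `]-oo, y]%classic `&` (A `*` [set: R]))).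
by congr ((U \x U)%E _); apply/seteqP; split => z /=; tauto.
Qed.

Let sigma_one m (A : set T) : @sigma_of R X [set m] A ->
  exists2 D, measurable D & A = X m @^-1` D.
Proof.
move=> sA; have : preimage_set_system setT (X m) measurable A.
  apply: sA; split.
    apply: sigma_algebra_preimage; exact: sigma_algebra_measurable.
  by move=> _ [i /= -> [D mD <-]]; exists D.
by move=> [D mD <-]; exists D => //; rewrite setTI.
Qed.

(** The version p of the conditional probability provided by the Markov property
    need not be the one given by f, but both are densities of the same
    measure on sigma(X_m), so they are almost surely equal. *)
Let mkv_event m A B : past m A -> measurable B ->
  P (X (m + 1) @^-1` B `&` A) = (\int[P]_(w in A) (kop f \1_B (X m w))%:E)%E.
Proof.
move=> pA mB; have [_ markovX _ _] := gX.
have [p [[mp ip pE] [_ _ pastE]]] := markovX m B mB.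
have mA : measurable A by exact: (sigma_of_measurable pA).
have bB : bm (\1_B : R -> R) by exact: bm_indic.
have bk : bm (kop f \1_B) by exact: (posop_bm mk).
pose q w := kop f \1_B (X m w).
have bq : bm q by exact: bm_process.
have iq := bm_integrable P bq.
have mq : measurable_wrt (@sigma_of R X [set m]) q.
  by apply: measurable_wrt_process => //; case: bk.
have qE E : @sigma_of R X [set m] E ->
    (\int[P]_(w in E) (q w)%:E)%E = P (X (m + 1) @^-1` B `&` E).
  move=> /sigma_one[D mD ->]; rewrite setIC generated_joint//.
  have fin : (\int[P]_(w in X m @^-1` D) (q w)%:E)%E =
      (\int[P]_(w in X m @^-1` D) q w)%:E.
    rewrite /Rintegral fineK//; apply: integrable_fin_num; first exact: mX.
    by apply: (integrableS measurableT) => //; exact: mX.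
  rewrite fin; congr EFin; rewrite [LHS]Rintegral_indicM [RHS]Rintegral_indicM.
  have bD : bm (\1_D : R -> R) by exact: bm_indic.
  exact: (Rintegral_marginal generated_law m (bmM bD bk)).
pose H := \bigcup_(i in [set m]) preimage_set_system setT (X i) measurable.
have N1 : P [set w | q w < p w] = 0%E.
  apply: null_of_le_integral => //.
  rewrite pE ?qE//; apply: (@measurable_lt_fun _ (g_sigma_algebraType H) R);
    exact: measurable_wrt_fun.
have N2 : P [set w | p w < q w] = 0%E.
  apply: null_of_le_integral => //.
  rewrite pE ?qE//; apply: (@measurable_lt_fun _ (g_sigma_algebraType H) R);
    exact: measurable_wrt_fun.
have mpT : measurable_fun setT p by apply/measurable_EFinP; exact: measurable_int ip.
have mqT : measurable_fun setT q by case: bq.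
rewrite -pastE//; apply: ae_eq_integral => //.
- by apply/measurable_EFinP/measurable_funTS.
- by apply/measurable_EFinP/measurable_funTS.
have mN1 : measurable [set w | q w < p w] by exact: measurable_lt_fun.
have mN2 : measurable [set w | p w < q w] by exact: measurable_lt_fun.
exists ([set w | q w < p w] `|` [set w | p w < q w]); split.
- exact: measurableU.
- apply/eqP; rewrite eq_le measure_ge0 andbT.
  apply: (le_trans (measureU2 _ mN1 mN2)).
  rewrite [X in (X + _)%E](_ : _ = 0%E); last exact: N1.
  by rewrite add0e [leLHS](_ : _ = 0%E)//; exact: N2.
move=> w /= /not_implyP[_ pq].
by case: (ltgtP (p w) (q w)) => [|//|pqE]; [by right|by left|case: pq; rewrite pqE].
Qed.

(** The pairs (1_A, X_{m+1}) and (1_A, f(X_m, u)), with u independent of the chain,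
    have the same law.  The factor 1_A is clamped to [0,1] to become a bounded function of
    the pair. *)
Lemma generated_mkv m A (phi : R -> R) : past m A -> bm phi ->
  \int[P]_(w in A) phi (X (m + 1) w) = \int[P]_(w in A) kop f phi (X m w).
Proof.
move=> pA bphi; have mA : measurable A by exact: (sigma_of_measurable pA).
have bA : bm (\1_A : T -> R) by exact: bm_indic.
pose Y (z : T * R) := f (X m z.1, z.2).
have mY : measurable_fun setT Y.
  apply: (measurableT_comp mf); apply: measurable_fun_pair; last exact: measurable_snd.
  exact: measurableT_comp (@measurable_process R X m) measurable_fst.
pose I (w : T) : R := \1_A w.
have mI : measurable_fun setT I by case: bA.
have mI1 : measurable_fun setT (fun z : T * R => I z.1).
  exact: measurableT_comp mI measurable_fst.
have bh : bm (fun v : R * R => Num.min 1 (Num.max 0 v.1) * phi v.2).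
  apply: bmM; last exact: (bm_comp measurable_snd bphi).
  split.
    by apply: measurable_minr => //; apply: measurable_maxr.
  exists 1 => v; rewrite ger0_norm; first by rewrite ge_min lexx.
  by rewrite le_min ler01 le_max lexx.
have clampI w : Num.min 1 (Num.max 0 (I w)) = I w.
  by rewrite /I indicE; case: (_ \in _); rewrite ?max_r// ?min_r.
have sub_past D : measurable D -> past m (I @^-1` D).
  move=> mD; exact: (measurable_wrt_indic pA).
have := @eq_Rintegral_pair R _ _ _ _ T (T * R)%type R R P (P \x U)%E
  I (X (m + 1)) (fun z => I z.1) Y mI (@measurable_process R X (m + 1)) mI1 mY _ _ bh.
move=> /(_ _) h.
apply: (etrans (Rintegral_indicM _ _ _)).
apply: (etrans _ (esym (Rintegral_indicM _ _ _))).
transitivity (\int[P]_w (Num.min 1 (Num.max 0 (I w)) * phi (X (m + 1) w))).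
  by apply: eq_Rintegral => w _; rewrite clampI.
apply: (etrans (h _)).
  move=> D B mD mB; have pD := sub_past D mD.
  have mID : measurable (I @^-1` D) by exact: (sigma_of_measurable pD).
  rewrite setIC mkv_event//.
  have mE : measurable [set z : T * R | (I @^-1` D) z.1 /\ B (Y z)].
    have -> : [set z : T * R | (I @^-1` D) z.1 /\ B (Y z)] =
      ((I @^-1` D) `*` [set: R]) `&` (Y @^-1` B).
      by apply/seteqP; split => z /=; tauto.
    apply: measurableI; first exact: measurableX.
    by rewrite -[Z in measurable Z]setTI; exact: mY.
  rewrite -[RHS]/((P \x U)%E [set z : T * R | (I @^-1` D) z.1 /\ B (Y z)]).
  rewrite [RHS]/product_measure1 integral_mkcond; apply: eq_integral => w _.
  rewrite patchE; have [wD|nwD] := pselect ((I @^-1` D) w).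
    rewrite mem_set// kop_indic//; congr (U _).
    apply/seteqP; split => u; rewrite /xsection/=.
      by move=> Bu; apply/mem_set.
    by move=> /set_mem[].
  rewrite memNset//; have E0 : xsection [set z : T * R | (I @^-1` D) z.1 /\ B (Y z)] w = set0.
    by rewrite -subset0 => u; rewrite /xsection/= => /set_mem[].
  by rewrite /= E0 measure0.
have bIY : bm (fun z : T * R => Num.min 1 (Num.max 0 (I z.1)) * phi (Y z)).
  exact: (bm_comp (measurable_fun_pair mI1 mY) bh).
have [_ ->] := bm_fubini P U bIY.
apply: eq_Rintegral => w _ /=; rewrite clampI RintegralZl//.
exact: (bm_integrable U (bm_section (X m w) mf bphi)).
Qed.

End generated_chain.

(** * Mixtures of transitions *)
Lemma transition_generates (R : realType) (C : R -> R -> R) (f : R * R -> R) :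
  transition_of C f -> exists X, generated_by C X.
Proof.
move=> tf; have pf : preserves_U f by case: tf.
have [G mG GU] := uniform_splitting R.
have [g pg fg] := transition_backward pf.
exists (chain mG pf pg); apply: (@markov_generated_by R _ f) => //.
- exact: chain_lawE.
- exact: chain_mkv.
Qed.

Section convex_combination.
Context (R : realType).
Notation U := (U R).
Variables (n : nat) (a : nat -> R).
Hypothesis n1 : (1 <= n)%N.
Hypothesis a0 : forall k, (1 <= k <= n)%N -> 0 <= a k.
Hypothesis a_sum : \sum_(1 <= k < n.+1) a k = 1.
Hypothesis a1 : a 1%N != 0.

Let Rintegral_sum (A : set R) (s : seq nat) (F : nat -> R -> R) : measurable A ->
  (forall k, k \in s -> bm (F k)) ->
  \int[U]_(x in A) (\sum_(k <- s) F k x) = \sum_(k <- s) \int[U]_(x in A) F k x.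
Proof.
move=> mA; elim: s => [|k s ih] bF.
  rewrite big_nil; under eq_Rintegral do rewrite big_nil.
  by rewrite Rintegral_cst// mul0r.
rewrite big_cons -ih; last by move=> i si; apply: bF; rewrite inE si orbT.
under eq_Rintegral do rewrite big_cons.
rewrite RintegralD//.
  apply: (integrableS measurableT) => //; apply: (bm_integrable U).
  by apply: bF; rewrite inE eqxx.
apply: (integrableS measurableT) => //; apply: (bm_integrable U).
have : forall i, i \in s -> bm (F i) by move=> i si; apply: bF; rewrite inE si orbT.
elim: s {ih bF} => [|i s ih] bF.
  by under eq_fun do rewrite big_nil; exact: (bm_cst 0).
under eq_fun do rewrite big_cons.
by apply: bmD; [apply: bF; rewrite inE eqxx|apply: ih => j sj; apply: bF; rewrite inE sj orbT].
Qed.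

Let in_range k : k \in index_iota 1 n.+1 -> (1 <= k <= n)%N.
Proof. by rewrite mem_index_iota ltnS. Qed.

(** Distribution functions and operators are both linear in the transition. *)
Lemma mixture_transition (C : nat -> R -> R -> R) (f : nat -> R * R -> R) :
  (forall k, (1 <= k <= n)%N -> transition_of (C k) (f k)) ->
  exists2 g, transition_of (fun x y => \sum_(1 <= k < n.+1) a k * C k x y) g &
    forall phi x, bm phi -> kop g phi x = \sum_(1 <= k < n.+1) a k * kop (f k) phi x.
Proof.
move=> tf; have [G mG GU] := uniform_splitting R.
have mf k : (1 <= k <= n)%N -> measurable_fun setT (f k) by move=> /tf[[]].
have [g mg gE] := kop_convex_sum mG GU n1 mf a0 a1.
have {}gE phi x : bm phi -> kop g phi x = \sum_(1 <= k < n.+1) a k * kop (f k) phi x.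
  by move=> /gE <-; rewrite a_sum mul1r.
have intE (A B : set R) : measurable A -> measurable B ->
    \int[U]_(x in A) kop g \1_B x =
    \sum_(1 <= k < n.+1) a k * \int[U]_(x in A) kop (f k) \1_B x.
  move=> mA mB; have bB : bm (\1_B : R -> R) by exact: bm_indic.
  have bk k : (1 <= k <= n)%N -> bm (kop (f k) \1_B).
    by move=> /mf mfk; exact: (posop_bm (kop_posop mfk)).
  under eq_Rintegral do rewrite gE//.
  rewrite Rintegral_sum//; last by move=> k /in_range /bk bk1; exact: bmZ.
  apply: eq_big_seq => k /in_range /bk bk1; rewrite RintegralZl//.
  by apply: (integrableS measurableT) => //; exact: (bm_integrable U bk1).
exists g => //; split.
  split=> // B mB; rewrite intE//.
  under eq_big_seq => k /in_range /tf [[_ h] _] do rewrite h//.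
  by rewrite -mulr_suml a_sum mul1r.
move=> x y x01 y01; rewrite intE//.
by apply: eq_big_seq => k /in_range /tf [_ h]; rewrite h.
Qed.

(** The components other than the first have total weight 1 - a_1 and do not expand
    the norm. *)
Lemma mixture_close (k : (R -> R) -> R -> R) (f : nat -> R * R -> R) :
  (forall i, (1 <= i <= n)%N -> preserves_U (f i)) ->
  (forall phi x, bm phi -> k phi x = \sum_(1 <= i < n.+1) a i * kop (f i) phi x) ->
  forall phi, bm phi ->
  n2 U (fun x => k phi x - a 1%N * kop (f 1%N) phi x) <= (1 - a 1%N) * n2 U phi.
Proof.
move=> pf kE phi bphi.
have -> : (fun x => k phi x - a 1%N * kop (f 1%N) phi x) =
    (fun x => \sum_(2 <= i < n.+1) a i * kop (f i) phi x).
  by apply/funext => x; rewrite kE// big_ltn// addrAC subrr add0r.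
have -> : 1 - a 1%N = \sum_(2 <= i < n.+1) a i.
  by rewrite -a_sum big_ltn// addrAC subrr add0r.
have : forall i, i \in index_iota 2 n.+1 -> (1 <= i <= n)%N.
  by move=> i; rewrite mem_index_iota ltnS => /andP[/ltnW -> ->].
set s := index_iota _ _ => sP.
suff [] : bm (fun x => \sum_(i <- s) a i * kop (f i) phi x) /\
  n2 U (fun x => \sum_(i <- s) a i * kop (f i) phi x) <= (\sum_(i <- s) a i) * n2 U phi by [].
elim: s sP => [|i s ih] sP.
  split; first by under eq_fun do rewrite big_nil; exact: (bm_cst 0).
  by under eq_fun do rewrite big_nil; rewrite big_nil mul0r n2_cst normr0.
have [bs hs] := ih (fun j sj => sP j (mem_behead (s := i :: s) sj)).
have ir : (1 <= i <= n)%N by apply: sP; rewrite inE eqxx.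
have mk := kop_markov (pf _ ir).
have bi : bm (fun x => a i * kop (f i) phi x) by apply: bmZ; exact: (posop_bm mk).
under eq_fun do rewrite big_cons.
split; first exact: bmD.
rewrite big_cons mulrDl; apply: (le_trans (n2D (bm_sqint U bi) (bm_sqint U bs))).
rewrite lerD// n2Z; last exact/bm_sqint/(posop_bm mk).
by rewrite ger0_norm ?a0// ler_wpM2l ?a0// markov_n2.
Qed.

End convex_combination.

(** * Correlations and the spectral gap *)
Section correlation.
Context d (T : measurableType d) (R : realType) (P : probability T R).
Implicit Types f g : T -> R.

Lemma corrE f g (fc := fun x => f x - \int[P]_y f y)
    (gc := fun x => g x - \int[P]_y g y) :
  corr P f g = (\int[P]_x (fc x * gc x)) / (n2 P fc * n2 P gc).
Proof.
by rewrite /corr /variance /n2 !(covariance.unlock, expectation.unlock).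
Qed.

Lemma bm_Lfun2 f : bm f -> f \in Lfun P 2%:E.
Proof.
move=> bf; have [mf _] := bf.
rewrite inE; apply/andP; split; rewrite inE//=.
rewrite /finite_norm unlock.
apply: poweR_lty.
have := bm_integrable P (bm_sqr bf) => /integrableP[_].
congr (_ < _)%E; apply: eq_integral => x _ /=.
by rewrite -poweR_EFin ?poweR_EFin normrX powR_mulrn.
Qed.

Lemma Lfun2_sqint f : f \in Lfun P 2%:E -> sqint P f.
Proof.
move=> fL; split; last exact: Lfun2_integrable_sqr.
by move: fL; rewrite inE => /andP[+ _]; rewrite inE.
Qed.

End correlation.

Section rho_contraction.
Context (R : realType) (X : process R) (C : R -> R -> R) (f : R * R -> R).
Notation P := (process_prob X).
Notation T := (process_space X).
Notation U := (U R).
Hypothesis gX : generated_by C X.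
Hypothesis tf : transition_of C f.
Let pf : preserves_U f. Proof. by case: tf. Qed.
Let mk : markov_op U (kop f). Proof. exact: kop_markov. Qed.
Let law_X := generated_law gX.

(** With F = (k^m phi)(X_0) and G = phi(X_m), the Markov property gives
    E(F G) = |k^m phi|^2, so the correlation of F and G is |k^m phi| / |phi|. *)
Lemma rho_contraction m (c : R) : 0 <= c -> (rho_mix X m <= c%:E)%E ->
  forall phi, bm phi -> \int[U]_x phi x = 0 ->
  n2 U (iter m (kop f) phi) <= c * n2 U phi.
Proof.
move=> c0 rho_c phi bphi phi0.
set h := iter m (kop f) phi.
have bh : bm h by exact: (posop_bm (posop_iter m mk)).
have h0 : \int[U]_x h x = 0 by rewrite (markov_int (markov_iter m mk)).
have hphi : n2 U h <= n2 U phi by exact: (markov_n2 (markov_iter m mk)).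
have [hz|hp] := leP (n2 U h) 0.
  by rewrite (le_trans hz)// mulr_ge0// n2_ge0.
have phip : 0 < n2 U phi by exact: lt_le_trans hp hphi.
pose F w := h (X 0 w); pose Gm w := phi (X m%:Z w).
have bF : bm F by exact: bm_process.
have bG : bm Gm by exact: bm_process.
have F0 : \int[P]_w F w = 0 by rewrite (Rintegral_marginal law_X 0 bh).
have G0 : \int[P]_w Gm w = 0 by rewrite (Rintegral_marginal law_X m bphi).
have : ((corr P F Gm)%:E <= rho_mix X m)%E.
  apply: ereal_sup_ubound; exists F, Gm; split => //; split.
  - by apply: measurable_wrt_process => //=; case: bh.
  - exact: bm_Lfun2.
  - by apply: measurable_wrt_process => //=; case: bphi.
  - exact: bm_Lfun2.
move=> /le_trans /(_ rho_c); rewrite lee_fin corrE F0 G0.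
have n2F (g : R -> R) i : bm g -> n2 P (fun w => g (X i w) - 0) = n2 U g.
  move=> bg; rewrite /n2 -(Rintegral_marginal law_X i (bm_sqr bg)); congr Num.sqrt.
  by apply: eq_Rintegral => w _; rewrite subr0.
rewrite (n2F h 0 bh) (n2F phi m%:Z bphi).
have -> : \int[P]_w ((F w - 0) * (Gm w - 0)) = n2 U h ^+ 2.
  have mF : measurable_wrt (@sigma_of R X [set i | i <= 0]) F.
    by apply: measurable_wrt_process => //=; case: bh.
  have := @markov_steps R X f pf (generated_mkv gX tf) m 0 F phi mF
    (bm_integrable P bF) bphi.
  rewrite add0r => hs.
  transitivity (\int[P]_w (F w * phi (X m w))).
    by apply: eq_Rintegral => w _; rewrite !subr0.
  rewrite hs sqr_n2 -(Rintegral_marginal law_X 0 (bm_sqr bh)).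
  by apply: eq_Rintegral => w _; rewrite expr2.
rewrite ler_pdivrMr ?mulr_gt0// => hle.
rewrite -(ler_pM2l hp) -expr2; apply: (le_trans hle).
by rewrite mulrCA.
Qed.

End rho_contraction.

Section regression.
Context d dS (T : measurableType d) (S : measurableType dS) (R : realType).
Variables (P : probability T R) (mu : probability S R) (Y : T -> S).
Hypothesis mY : measurable_fun setT Y.
Hypothesis law_Y : forall B, measurable B -> P (Y @^-1` B) = mu B.

Let preY B : measurable B -> measurable (Y @^-1` B).
Proof. by move=> mB; rewrite -[X in measurable X]setTI; exact: mY. Qed.

(** h is the conditional expectation E(F | Y = x), the bounded density of the image
    under Y of the signed measure F dP; a constant is added to F to make it positive. *)
Lemma bounded_regression (F : T -> R) : bm F -> exists2 h : S -> R, bm h &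
  forall phi, bm phi -> \int[P]_w (F w * phi (Y w)) = \int[mu]_x (h x * phi x).
Proof.
move=> bF; have [mF [c0 Fc0]] := bF.
pose c := `|c0|; have c_ge0 : 0 <= c by exact: normr_ge0.
have Fc w : `|F w| <= c by rewrite (le_trans (Fc0 w))// ler_norm.
pose g w := F w + c.
have g0 w : 0 <= g w by rewrite /g -lerBlDr sub0r; have := Fc w; rewrite ler_norml => /andP[].
have g2 w : g w <= 2 * c.
  by rewrite mulr_natl mulr2n lerD2r; have := Fc w; rewrite ler_norml => /andP[].
have bg : bm g by apply: bmD => //; exact: (bm_cst c).
have mg : measurable_fun setT g by case: bg.
pose nu := pushforward (wmeas P g0 mg) Y.
have numu A : measurable A -> (nu A <= (2 * c)%:E * mu A)%E.
  move=> mA; rewrite -law_Y// -[leLHS]/(\int[P]_(w in Y @^-1` A) (g w)%:E)%E.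
  apply: (@le_trans _ _ (\int[P]_(w in Y @^-1` A) (cst (2 * c)%:E w))%E).
    apply: ge0_le_integral => //.
    - exact: preY.
    - by move=> w _; rewrite lee_fin.
    - by apply/measurable_EFinP/measurable_funTS.
    - by move=> w _; rewrite lee_fin.
  by rewrite integral_cst//; exact: preY.
have [h [mh hb hE]] := bounded_density (mulr_ge0 (ler0n R 2) c_ge0) numu.
have h0 x : 0 <= h x by case/andP: (hb x).
have bh : bm h.
  split => //; exists (2 * c) => x; rewrite ger0_norm//; by case/andP: (hb x).
have pos phi : bm phi -> (forall x, 0 <= phi x) ->
    \int[P]_w (g w * phi (Y w)) = \int[mu]_x (h x * phi x).
  move=> bphi phi0; have [mphi _] := bphi; congr fine.
  transitivity (\int[nu]_x (phi x)%:E)%E.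
    rewrite (ge0_integral_pushforward mY)//; last 2 first.
    - by apply/measurable_EFinP.
    - by move=> y _; rewrite lee_fin.
    rewrite preimage_setT integral_wmeas//.
    - by apply: eq_integral => w _; rewrite -EFinM mulrC.
    - by move=> w /=; rewrite lee_fin.
    - by apply/measurable_EFinP; exact: measurableT_comp mphi mY.
  transitivity (\int[wmeas mu h0 mh]_x (phi x)%:E)%E.
    by apply: eq_measure_integral => A mA _; exact: hE.
  rewrite integral_wmeas//; last by apply/measurable_EFinP.
  by apply: eq_integral => x _; rewrite -EFinM mulrC.
have all phi : bm phi -> \int[P]_w (g w * phi (Y w)) = \int[mu]_x (h x * phi x).
  move=> bphi; have [_ [M phiM]] := bphi.
  have bM : bm (fun x : S => phi x + M) by apply: bmD => //; exact: (bm_cst M).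
  have M0 (x : S) : 0 <= M by rewrite (le_trans _ (phiM x)).
  have pM x : 0 <= phi x + M.
    by rewrite -lerBlDr sub0r; have := phiM x; rewrite ler_norml => /andP[].
  have e1 := pos _ bM pM.
  have bphiY : bm (fun w => phi (Y w)) by exact: (bm_comp mY bphi).
  have e2 : \int[P]_w (g w * M) = \int[mu]_x (h x * M).
    by apply: (pos (cst M)) => //; exact: bm_cst.
  have -> : \int[P]_w (g w * phi (Y w)) =
      \int[P]_w (g w * (phi (Y w) + M)) - \int[P]_w (g w * M).
    rewrite -RintegralB//; last 2 first.
    - by apply: (bm_integrable P); apply: bmM => //; apply: bmD => //; exact: (bm_cst M).
    - by apply: (bm_integrable P); apply: bmM => //; exact: (bm_cst M).
    by apply: eq_Rintegral => w _; rewrite mulrDr addrK.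
  rewrite e1 e2 -RintegralB//; last 2 first.
  - by apply: (bm_integrable mu); exact: bmM.
  - by apply: (bm_integrable mu); apply: bmM => //; exact: (bm_cst M).
  by apply: eq_Rintegral => w _; rewrite mulrDr addrK.
exists (fun x => h x - c); first by apply: bmB => //; exact: (bm_cst c).
move=> phi bphi.
have bphiY : bm (fun w => phi (Y w)) by exact: (bm_comp mY bphi).
have e3 : \int[P]_w (c * phi (Y w)) = \int[mu]_x (c * phi x).
  have bc : bm (fun x => c * phi x) by exact: bmZ.
  rewrite [RHS](_ : _ = \int[mu]_w (fun x => c * phi x) (id w))//.
  by apply: (@eq_Rintegral_law _ _ _ _ _ _ _ P mu Y id mY _ _ (fun x => c * phi x)).
transitivity (\int[P]_w (g w * phi (Y w)) - \int[P]_w (c * phi (Y w))).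
  rewrite -RintegralB//; last 2 first.
  - by apply: (bm_integrable P); exact: bmM.
  - by apply: (bm_integrable P); exact: bmZ.
  by apply: eq_Rintegral => w _; rewrite /g mulrDl addrK.
rewrite all// e3 -RintegralB//; last 2 first.
- by apply: (bm_integrable mu); exact: bmM.
- by apply: (bm_integrable mu); exact: bmZ.
by apply: eq_Rintegral => x _; rewrite mulrBl.
Qed.

End regression.

Section truncation.
Context d (T : measurableType d) (R : realType) (P : probability T R).
Implicit Types f g : T -> R.

Definition truncate (n : nat) (f : T -> R) (w : T) : R :=
  Num.max (- n%:R) (Num.min n%:R (f w)).

Lemma le_norm_truncate n f w : `|truncate n f w| <= `|f w|.
Proof.
rewrite /truncate; have n0 : 0 <= n%:R :> R by [].
case: (leP (n%:R : R) (f w)) => h1; case: (leP (- n%:R : R) _) => h2 //.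
- by rewrite !ger0_norm// (le_trans n0).
- by rewrite normrN (le_trans _ (ler_norm _))// ger0_norm.
- by move: h2 => /ltW h2; rewrite normrN (ger0_norm n0) -normrN (le_trans _ (ler_norm _))// lerNr.
Qed.

Lemma bm_truncate n f : measurable_fun setT f -> bm (truncate n f).
Proof.
move=> mf; split; first by apply: measurable_maxr => //; exact: measurable_minr.
exists n%:R => w; rewrite /truncate ler_norml le_max lexx/= ge_max ge_min lexx/= andbT.
by rewrite (le_trans _ (ler0n R n))// oppr_le0.
Qed.

(** Dominated convergence, with the bound |f g|. *)
Lemma cvg_Rintegral_truncate f g : sqint P f -> sqint P g ->
  \int[P]_w (truncate n f w * g w) @[n --> \oo] --> \int[P]_w (f w * g w).
Proof.
move=> sf sg; have [mf _] := sf; have [mg _] := sg.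
have ifg := sqint_mul sf sg.
have fin : (\int[P]_w (f w * g w)%:E)%E \is a fin_num by exact: integrable_fin_num.
suff h : (\int[P]_w (truncate n f w * g w)%:E)%E @[n --> \oo] -->
    (fine (\int[P]_w (f w * g w)%:E)%E)%:E by exact: fine_cvg h.
rewrite fineK//.
have [] := @dominated_convergence _ _ _ P setT measurableT
  (fun n w => (truncate n f w * g w)%:E) (fun w => (f w * g w)%:E)
  (fun w => `|(f w * g w)%:E|%E) _ _ _ _ _; last by move=> _ _; exact.
- move=> n; apply/measurable_EFinP; apply: measurable_funM => //.
  by case: (bm_truncate n mf).
- by apply/measurable_EFinP; exact: measurable_funM.
- apply: aeW => w _; apply: cvg_near_cst.
  near=> n; have fn : `|f w| <= n%:R.
    by near: n; exact: nbhs_infty_ger.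
  move: fn; rewrite ler_norml => /andP[h1 h2].
  by rewrite /truncate min_r// max_r.
- exact: integrable_abse.
- apply: aeW => w n _ /=; rewrite lee_fin !normrM ler_wpM2r//.
  exact: le_norm_truncate.
Unshelve. all: by end_near.
Qed.

End truncation.

Section gap_to_rho.
Context (R : realType) (X : process R) (f : R * R -> R).
Notation P := (process_prob X).
Notation T := (process_space X).
Notation U := (U R).
Notation past m := (@sigma_of R X [set i | i <= m]).
Hypothesis law_X : forall m D, measurable D -> P (X m @^-1` D) = U D.
Hypothesis pf : preserves_U f.
Hypothesis mkv : forall m A (phi : R -> R), past m A -> bm phi ->
  \int[P]_(w in A) phi (X (m + 1) w) = \int[P]_(w in A) kop f phi (X m w).
Let mf : measurable_fun setT f. Proof. by case: pf. Qed.
Let mk : markov_op U (kop f). Proof. exact: kop_markov. Qed.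
Variables (m : nat) (l : R).
Hypothesis l0 : 0 <= l.
Hypothesis contraction : forall phi, bm phi -> \int[U]_x phi x = 0 ->
  n2 U (iter m (kop f) phi) <= l * n2 U phi.
Notation future := (@sigma_of R X [set i | m%:Z <= i]).

Let n2_marginal i phi : bm phi -> n2 P (fun w => phi (X i w)) = n2 U phi.
Proof.
move=> bphi; rewrite /n2 -(Rintegral_marginal law_X i (bm_sqr bphi)).
by [].
Qed.

Let past0 (F : T -> R) : measurable_wrt (past 0) F -> measurable_wrt (past m%:Z) F.
Proof.
move=> mF D mD; apply: (@sub_sigma_of _ _ [set i | i <= 0]); last exact: mF.
by move=> i /= i0; exact: le_trans i0 _.
Qed.

(** Let h(X_m) be the regression of F on X_m.  By duality |h|^2 = E(F (k^m h)(X_0)),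
    which is at most |F| l |h|; and for g in the future E(F g) = E(h(X_m) g). *)
Lemma bounded_decorrelation (F g : T -> R) : measurable_wrt (past 0) F -> bm F ->
  \int[P]_w F w = 0 -> measurable_wrt future g -> sqint P g ->
  `|\int[P]_w (F w * g w)| <= l * n2 P F * n2 P g.
Proof.
move=> mF bF F0 mg sg.
have [h bh hE] := bounded_regression (@measurable_process R X m%:Z) (fun B mB => law_X m%:Z mB) bF.
have bhX : bm (fun w => h (X m%:Z w)) by exact: bm_process.
have iF := bm_integrable P bF.
have h0 : \int[U]_x h x = 0.
  rewrite -F0; have := hE (cst 1) (bm_cst 1).
  by under eq_Rintegral do rewrite mulr1; under [RHS]eq_Rintegral do rewrite mulr1.
have bkh : bm (iter m (kop f) h) by exact: (posop_bm (posop_iter m mk)).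
(* The regression of F on X_m inherits the contraction of the operator by duality. *)
have nh : n2 U h <= l * n2 P F.
  have [hz|hp] := leP (n2 U h) 0; first by rewrite (le_trans hz)// mulr_ge0// n2_ge0.
  rewrite -(ler_pM2r hp) -expr2 sqr_n2.
  have -> : \int[U]_x (h x ^+ 2) = \int[P]_w (F w * iter m (kop f) h (X 0 w)).
    transitivity (\int[P]_w (F w * h (X m%:Z w))).
      by rewrite hE//; apply: eq_Rintegral => x _; rewrite expr2.
    have := markov_steps pf mkv m mF iF bh; rewrite add0r => <-.
    by [].
  have sF := bm_sqint P bF.
  have skh := bm_sqint P (bm_process X 0 bkh).
  apply: (le_trans (ler_norm _)); apply: (le_trans (cauchy_schwarz sF skh)).
  rewrite (n2_marginal 0 bkh) mulrAC mulrC ler_wpM2r ?n2_ge0//.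
  exact: contraction.
have mhX : measurable_wrt (past m%:Z) (fun w => h (X m%:Z w)).
  by apply: measurable_wrt_process => //=; case: bh.
have key : \int[P]_w (g w * F w) = \int[P]_w (g w * h (X m%:Z w)).
  pose t (i : nat) : int := m%:Z + i%:Z.
  apply: (@eq_Rintegral_sub_sigma _ _ _ P (blocks X t) future) => //.
  - exact: blocks_measurable.
  - exact: blocks_setI_closed.
  - exact: blocks_setT.
  - apply: (@subset_trans _ (@sigma_of R X (range t))); last exact: blocks_generate.
    apply: sub_sigma_of => i /= mi; exists `|i - m%:Z|%N => //.
    by rewrite /t; lia.
  - move=> A [N [B [mB ->]]].
    apply: (etrans (Rintegral_indicM _ _ _)).
    apply: (etrans _ (esym (Rintegral_indicM _ _ _))).
    have bB i : bm (\1_(B i) : R -> R) by exact: bm_indic.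
    have bb := bm_block_op pf N bB.
    have e (psi : T -> R) : measurable_wrt (past m%:Z) psi -> bm psi ->
        \int[P]_w (\1_(block X t N B) w * psi w) =
        \int[P]_w (psi w * block_op f N (fun i => \1_(B i)) (X m%:Z w)).
      move=> mpsi bpsi; rewrite -(block_expectation pf mkv N mpsi bpsi bB).
      by apply: eq_Rintegral => w _; rewrite (block_indic t) mulrC.
    rewrite e//; last exact: past0.
    rewrite e// hE// -(Rintegral_marginal law_X m%:Z (bmM bh bb)).
    by [].
  - exact: sqint_int.
under eq_Rintegral do rewrite mulrC.
rewrite key; apply: (le_trans (cauchy_schwarz sg (bm_sqint P bhX))).
by rewrite (n2_marginal m%:Z bh) mulrC ler_wpM2r// n2_ge0.
Qed.

(** F is truncated and recentred; recentring decreases the norm and is invisible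
    against a g of mean zero. *)
Lemma decorrelation (F g : T -> R) : measurable_wrt (past 0) F -> sqint P F ->
  measurable_wrt future g -> sqint P g -> \int[P]_w g w = 0 ->
  `|\int[P]_w (F w * g w)| <= l * n2 P F * n2 P g.
Proof.
move=> mF sF mg sg g0.
have [mFT _] := sF.
have lim : `|\int[P]_w (truncate n F w * g w)| @[n --> \oo] --> `|\int[P]_w (F w * g w)|.
  exact: cvg_norm (cvg_Rintegral_truncate sF sg).
rewrite -(cvg_lim (@Rhausdorff R) lim); apply: limr_le.
  by apply/cvg_ex; eexists; exact: lim.
apply: nearW => n.
have bt := bm_truncate n mFT.
pose c := \int[P]_w truncate n F w.
have bFc : bm (fun w => truncate n F w - c) by apply: bmB => //; exact: (bm_cst c).
have mFc : measurable_wrt (past 0) (fun w => truncate n F w - c).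
  move=> D mD; have mh : measurable_fun setT
      (fun x : R => Num.max (- n%:R) (Num.min n%:R x) - c).
    apply: measurable_funB => //; apply: measurable_maxr => //; exact: measurable_minr.
  rewrite -[X in past 0 X]/(F @^-1` ((fun x : R => Num.max (- n%:R) (Num.min n%:R x) - c) @^-1` D)).
  by apply: mF; rewrite -[X in measurable X]setTI; exact: mh.
have st := bm_sqint P bt.
have Fc0 : \int[P]_w (truncate n F w - c) = 0.
  rewrite RintegralB//; last 2 first.
  - exact: (bm_integrable P bt).
  - exact: (bm_integrable P (bm_cst c)).
  by rewrite Rintegral_cstP subrr.
have -> : \int[P]_w (truncate n F w * g w) = \int[P]_w ((truncate n F w - c) * g w).
  under [RHS]eq_Rintegral do rewrite mulrBl.
  rewrite RintegralB//; last 2 first.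
  - exact: (sqint_mul st sg).
  - exact: (sqint_int (sqintZ c sg)).
  rewrite RintegralZl//; last exact: sqint_int.
  by rewrite g0 mulr0 subr0.
apply: (le_trans (bounded_decorrelation mFc bFc Fc0 mg sg)).
rewrite ler_wpM2r ?n2_ge0// ler_wpM2l//.
apply: (le_trans (n2_center st)); apply: le_n2 => // w.
exact: le_norm_truncate.
Qed.

Lemma rho_mix_le : (rho_mix X m <= l%:E)%E.
Proof.
apply: ge_ereal_sup => _ [F [g [[mF /Lfun2_sqint sF] [mg /Lfun2_sqint sg] ->]]].
rewrite lee_fin corrE.
set c := \int[P]_y F y; set e := \int[P]_y g y.
have sc (a : R) : sqint P (fun=> a) by exact: (bm_sqint P (bm_cst a)).
have shift a J (h : T -> R) : measurable_wrt (@sigma_of R X J) h ->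
    measurable_wrt (@sigma_of R X J) (fun w => h w - a).
  move=> mh D mD; have ms : measurable_fun setT (fun x : R => x - a).
    exact: measurable_funB.
  apply: (mh ((fun x : R => x - a) @^-1` D)).
  by rewrite -[Z in measurable Z]setTI; exact: ms.
have g0 : \int[P]_w (g w - e) = 0.
  rewrite RintegralB//; last 2 first.
  - exact: sqint_int.
  - exact: (bm_integrable P (bm_cst e)).
  by rewrite Rintegral_cstP subrr.
have := decorrelation (shift c _ _ mF) (sqintB sF (sc c)) (shift e _ _ mg)
  (sqintB sg (sc e)) g0.
set nF := n2 P _; set ng := n2 P _ => h.
have [z|nz] := eqVneq (nF * ng) 0; first by rewrite z invr0 mulr0.
have pos : 0 < nF * ng by rewrite lt_neqAle eq_sym nz mulr_ge0// n2_ge0.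
by rewrite ler_pdivrMr// mulrA (le_trans _ h)// ler_norm.
Qed.

End gap_to_rho.

(** The constants of the spectral gap bound the mixing coefficients. *)
Lemma gapped_exp_rho_mixing (R : realType) (X : process R) (C : R -> R -> R)
    (f : R * R -> R) : generated_by C X -> transition_of C f ->
  gapped (U R) (kop f) -> exp_rho_mixing X.
Proof.
move=> gX tf [K [r [K0 r01 h]]]; exists K, r; split => // m _.
apply: (@rho_mix_le R X f (generated_law gX) tf.1 (generated_mkv gX tf) m).
- by rewrite mulr_ge0// exprn_ge0//; case/andP: r01 => /ltW.
- exact: h.
Qed.

(** * Absolute regularity yields a minorization *)

(** In the Hahn decomposition of nu - M mu, the density of nu is at most M on the
    negative set N.  If nu did not charge N, the positive set Q would have nu Q = 1
    and mu Q <= 1 / M, so that 1 <= 1 / M + b; the value M = 2 / (1 - b)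
    excludes this. *)
Lemma common_part d (T : measurableType d) (R : realType) (nu mu : probability T R)
    (b : R) : b < 1 ->
  (forall S, measurable S -> (nu S <= mu S + b%:E)%E) ->
  exists q : T -> R, exists M : R, [/\ measurable_fun setT q,
    forall z, 0 <= q z <= M, 0 < \int[mu]_z q z &
    forall S, measurable S -> \int[mu]_(z in S) q z <= fine (nu S)].
Proof.
move=> b1 tv.
pose M := 2 / (1 - b).
have M0 : 0 < M by rewrite divr_gt0// subr_gt0.
pose sigma := cadd (charge_of_finite_measure nu) (cscale (- M) (charge_of_finite_measure mu)).
have [Q [N [[mQ posQ] [mN negN] QN QN0]]] := Hahn_decomposition sigma.
have fin (m : probability T R) A : measurable A -> m A = (fine (m A))%:E.
  by move=> mA; rewrite fineK// fin_num_measure.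
have nuN : 0 < fine (nu N).
  rewrite lt0r fine_ge0// andbT; apply/negP => /eqP N0.
  have QC : Q = ~` N.
    apply/seteqP; split => [z Qz Nz|z nNz].
      by have : (Q `&` N) z by []; rewrite QN0.
    by have : (Q `|` N) z; [rewrite QN|case].
  have nuQ : nu Q = 1%E.
    by rewrite QC probability_setC// (fin nu)// N0 sube0.
  have := posQ Q mQ (@subset_refl _ Q); rewrite -[X in (_ <= X)%E]/(nu Q + (- M)%:E * mu Q)%E nuQ (fin mu)//.
  rewrite -EFinM -EFinD lee_fin => h1.
  have := tv Q mQ; rewrite nuQ (fin mu)// -EFinD lee_fin => h2.
  have : M * fine (mu Q) <= 1 by lra.
  have : fine (mu Q) >= 1 - b by lra.
  rewrite /M => h3; rewrite mulrAC ler_pdivrMr ?subr_gt0// mul1r; lra.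
have dom A : measurable A -> (mrestr nu mN A <= M%:E * mu A)%E.
  move=> mA; have mAN : measurable (A `&` N) by exact: measurableI.
  apply: (@le_trans _ _ (M%:E * mu (A `&` N))%E); last first.
    by rewrite lee_pmul2l// ?lte_fin//; apply: le_measure; rewrite ?inE.
  have := negN _ mAN (@subIsetr _ A N); rewrite /mrestr.
  rewrite -[X in (X <= _)%E]/(nu (A `&` N) + (- M)%:E * mu (A `&` N))%E (fin nu)// (fin mu)//.
  rewrite -!EFinM -EFinD !lee_fin; lra.
have [q [mq qM qE]] := bounded_density (ltW M0) dom.
have bq : bm q.
  by split => //; exists M => z; have /andP[h1 h2] := qM z; rewrite ger0_norm.
have intq S : measurable S -> \int[mu]_(z in S) q z = fine (nu (S `&` N)).
  by move=> mS; rewrite /Rintegral -qE.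
exists q, M; split => //.
  by rewrite intq// setTI.
move=> S mS; rewrite intq// fine_le// ?fin_num_measure//; try exact: measurableI.
by apply: le_measure; rewrite ?inE//; exact: measurableI.
Qed.

Section graph_law.
Context (R : realType) (h : R * R -> R).
Notation U := (U R).
Hypothesis mh : measurable_fun setT h.

Definition graph_map (mh : measurable_fun setT h) (z : R * R) : R * R := (z.1, h z).

Let measurable_graph_map : measurable_fun setT (graph_map mh).
Proof. by apply: measurable_fun_pair => //; exact: measurable_fst. Qed.

HB.instance Definition _ := isMeasurableFun.Build _ _ (R * R)%type (R * R)%type
  (graph_map mh) measurable_graph_map.

Definition graph_law : probability (R * R)%type R :=
  distribution (U \x U)%E (graph_map mh).

Lemma graph_lawE S : measurable S ->
  fine (graph_law S) = \int[U]_x \int[U]_u \1_S (x, h (x, u)).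
Proof.
move=> mS; have mpS : measurable (graph_map mh @^-1` S).
  by rewrite -[X in measurable X]setTI; exact: measurable_graph_map.
transitivity (fine ((U \x U)%E (graph_map mh @^-1` S))) => //.
rewrite -(Rintegral_indicP _ mpS).
by have [_ ->] := bm_fubini U U (bm_indic R mpS).
Qed.

(** The density of the common part bounds the transition probabilities from below,
    simultaneously for all events and almost all starting points; on the
    exceptional starting points it is replaced by 0. *)
Lemma minorant_of_overlap (b : R) : b < 1 ->
  (forall S, measurable S -> (graph_law S <= (U \x U)%E S + b%:E)%E) ->
  exists q : R * R -> R, exists M : R, [/\ measurable_fun setT q,
    forall z, 0 <= q z <= M, 0 < \int[U]_x \int[U]_y q (x, y) &
    forall x B, measurable B ->
      (\int[U]_(y in B) (q (x, y))%:E <= kop_kernel mh x B)%E].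
Proof.
move=> b1 tv; have [q0 [M [mq0 q0M q0pos q0nu]]] := common_part b1 tv.
have bq0 : bm q0.
  by split => //; exists M => z; have /andP[h1 h2] := q0M z; rewrite ger0_norm.
have q00 z : 0 <= q0 z by case/andP: (q0M z).
have sect (q : R * R -> R) x : bm q -> bm (fun y => q (x, y)).
  by move=> bq; apply: bm_comp bq; exact: pair1_measurable.
have bray n : bm (\1_(@ray_algebra R n) : R -> R).
  by apply: bm_indic; exact: ray_algebra_measurable.
pose g n x := \int[U]_y (\1_(@ray_algebra R n) y * q0 (x, y)).
have bg n : bm (g n).
  have b2 : bm (fun z : R * R => \1_(@ray_algebra R n) z.2 * q0 z).
    by apply: bmM => //; exact: (bm_comp measurable_snd (bray n)).
  by have [] := bm_fubini U U b2.
pose k n := kop h \1_(@ray_algebra R n).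
have bk n : bm (k n) by exact: (posop_bm (kop_posop mh)).
pose N n := [set x | k n x < g n x].
have mN n : measurable (N n).
  by apply: measurable_lt_fun; [case: (bk n)|case: (bg n)].
have N0 n : U (N n) = 0%E.
  apply: null_of_le_integral; [exact: (bm_integrable U (bg n))|exact: (bm_integrable U (bk n))|].
  have fin (a : R -> R) : bm a -> (\int[U]_(x in N n) (a x)%:E = (\int[U]_(x in N n) a x)%:E)%E.
    move=> ba; rewrite /Rintegral fineK//; apply: integrable_fin_num => //.
    by apply: (integrableS measurableT) => //; exact: (bm_integrable U ba).
  rewrite !fin// lee_fin.
  have mS : measurable (N n `*` @ray_algebra R n).
    by apply: measurableX => //; exact: ray_algebra_measurable.
  have -> : \int[U]_(x in N n) g n x = \int[(U \x U)%E]_(z in N n `*` @ray_algebra R n) q0 z.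
    rewrite [LHS]Rintegral_indicM; apply: esym; rewrite [LHS]Rintegral_indicM.
    have [_ ->] := bm_fubini U U (bmM (bm_indic R mS) bq0).
    apply: eq_Rintegral => x _; rewrite /g -RintegralZl//; last first.
      by apply: (bm_integrable U); apply: bmM => //; exact: sect.
    apply: eq_Rintegral => y _; rewrite mulrA; congr (_ * _).
    by rewrite !indicE in_setX /=; case: (_ \in _); case: (_ \in _);
      rewrite ?mulr1 ?mulr0.
  apply: (le_trans (q0nu _ mS)); rewrite graph_lawE// [leRHS]Rintegral_indicM.
  apply: le_Rintegral => //.
  - have b3 := bm_comp measurable_graph_map (bm_indic R mS).
    by have [b4 _] := bm_fubini U U b3; exact: (bm_integrable U b4).
  - by apply: (bm_integrable U); apply: bmM => //; exact: bm_indic.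
  move=> x _; rewrite /k /kop -RintegralZl//; last first.
    by apply: (bm_integrable U); exact: (bm_section x mh (bray n)).
  rewrite le_eqVlt; apply/orP; left; apply/eqP; apply: eq_Rintegral => u _.
  by rewrite !indicE in_setX /=; case: (_ \in _); case: (_ \in _);
      rewrite ?mulr1 ?mulr0.
pose Z := \bigcup_n N n.
have mZ : measurable Z by exact: bigcup_measurable.
have Z0 : U Z = 0%E.
  apply/eqP; rewrite eq_le measure_ge0 andbT.
  apply: (le_trans (measure_sigma_subadditive _ mN mZ (@subset_refl _ Z))).
  by rewrite eseries0// => i _ _; exact: N0.
have mZC : measurable (~` Z) by exact: measurableC.
pose q (z : R * R) := \1_(~` Z) z.1 * q0 z.
have bq : bm q by apply: bmM => //; exact: (bm_comp measurable_fst (bm_indic R mZC)).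
have q01 z : 0 <= q z <= M.
  have /andP[h1 h2] := q0M z; have M0 := le_trans h1 h2.
  by rewrite /q indicE; case: (_ \in _); rewrite ?mul1r ?mul0r ?h1 ?lexx.
exists q, M; split => //.
- by case: bq.
- have <- // : \int[(U \x U)%E]_z q0 z = \int[U]_x \int[U]_y q (x, y).
  have [b5 ->] := bm_fubini U U bq0; have [b6 _] := bm_fubini U U bq.
  congr fine; apply: ae_eq_integral => //.
  + by apply/measurable_EFinP; case: b5.
  + by apply/measurable_EFinP; case: b6.
  exists Z; split => // x /= h1; apply: contrapT => nZx; apply: h1 => _.
  congr EFin; apply: eq_Rintegral => y _.
  by rewrite /q indicE mem_set// mul1r.
move=> x B mB; have [Zx|nZx] := pselect (Z x).
  rewrite integral0_eq ?measure_ge0// => y _.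
  by rewrite /q indicE memNset ?mul0r// => /(_ Zx).
have mqx : measurable_fun setT (fun y => q (x, y)) by case: (sect _ x bq).
have qx0 y : 0 <= q (x, y) by case/andP: (q01 (x, y)).
have finx B' : measurable B' -> (\int[U]_(y in B') (q (x, y))%:E = (\int[U]_(y in B') q (x, y))%:E)%E.
  move=> mB'; rewrite /Rintegral fineK//; apply: integrable_fin_num => //.
  by apply: (integrableS measurableT) => //; exact: (bm_integrable U (sect _ x bq)).
rewrite -[leRHS]adde0.
apply: (@ray_algebra_le R (wmeas U qx0 mqx) (kop_kernel mh x) 0) => //.
- by rewrite [ltLHS]finx// ltry.
- by rewrite kop_kernelE// ltry.
move=> n; rewrite adde0 [leLHS]finx; last exact: ray_algebra_measurable.
rewrite kop_kernelE; last exact: ray_algebra_measurable.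
rewrite lee_fin leNgt; apply/negP => lt; apply: nZx; exists n => //.
rewrite /N /=; apply: (lt_le_trans lt); rewrite [leLHS]Rintegral_indicM /g.
apply: le_Rintegral => //.
- by apply: (bm_integrable U); apply: bmM => //; exact: sect.
- by apply: (bm_integrable U); apply: bmM => //; exact: sect.
move=> y _; rewrite /q indicE mulrA ler_wpM2r// -[leRHS]mulr1 ler_wpM2l//.
Qed.

End graph_law.

(** True whether the essential supremum was found or has its default value +oo. *)
Lemma ess_supremum_ub d (T : measurableType d) (R : realType) (P : probability T R)
    (S : set (T -> \bar R)) : measurable_fun setT (ess_supremum P S) /\
  forall f, S f -> {ae P, forall w, (f w <= ess_supremum P S w)%E}.
Proof.
rewrite /ess_supremum; case: xgetP => [s _ [ms us _]|_]; first by split.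
split; first exact: measurable_cst.
by move=> f _; apply: aeW => w; exact: leey.
Qed.

Lemma ae_forall_nat d (T : measurableType d) (R : realType) (P : probability T R)
    (Q : nat -> T -> Prop) : (forall n, {ae P, forall w, Q n w}) ->
  {ae P, forall w, forall n, Q n w}.
Proof.
move=> h; apply: negligibleS (negligible_bigcup h).
by move=> w /= /existsNP[n nQ]; exists n.
Qed.

Section beta_bound.
Context (R : realType) (X : process R) (C : R -> R -> R) (f h : R * R -> R) (N : nat).
Notation P := (process_prob X).
Notation T := (process_space X).
Notation U := (U R).
Hypothesis gX : generated_by C X.
Hypothesis tf : transition_of C f.
Hypothesis mh : measurable_fun setT h.
Hypothesis hE : forall phi, bm phi -> kop h phi = iter N (kop f) phi.
Let pf : preserves_U f. Proof. by case: tf. Qed.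
Let law_X := generated_law gX.

Let family : set (T -> \bar R) := [set F : T -> \bar R | exists B p, [/\ @sigma_of R X [set i | N%:Z <= i] B,
     is_cond_prob P (@sigma_of R X [set i | i <= 0]) B p &
     F = (fun w => `| (p w)%:E - P B |%E)]].
Let s := ess_supremum P family.

Let ms : measurable_fun setT s.
Proof. by case: (ess_supremum_ub P family). Qed.

Let event_bound B : measurable B ->
  {ae P, forall w, (`|(kop h \1_B (X 0 w))%:E - U B| <= s w)%E}.
Proof.
move=> mB; have [_ ub] := ess_supremum_ub P family; rewrite -(law_X 0 mB); apply: ub.
exists (X N%:Z @^-1` B), (fun w => kop h \1_B (X 0 w)); split.
- by apply: sigma_of_gen => //=.
- rewrite hE; last exact: bm_indic.
  have := @markov_cond_prob R X f pf (generated_mkv gX tf) [set i | i <= 0] N 0 B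
    (lexx _) (@subset_refl _ _) mB.
  by rewrite add0r.
- by rewrite !law_X.
Qed.

(** Simultaneously for all Borel sets B, by the countable algebra. *)
Let kernel_bound : {ae P, forall w, (0 <= s w)%E /\
  forall B, measurable B -> (kop_kernel mh (X 0%R w) B <= U B + s w)%E}.
Proof.
have := ae_forall_nat (fun n => event_bound (@ray_algebra_measurable R n)).
apply: filterS => w sw; have s0 : (0 <= s w)%E.
  by apply: le_trans (sw 0%N); exact: abse_ge0.
split=> //; case: (s w) s0 sw => [c c0 sw|_ _|//]; last first.
  by move=> B mB; rewrite addey ?leey// -ltNye (lt_le_trans _ (measure_ge0 U B)).
move=> B mB; apply: ray_algebra_le => //.
- by rewrite kop_kernelE// ltry.
- by rewrite [ltLHS](_ : _ = 1%E) ?ltry//; exact: probability_setT.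
move=> n; have mr := @ray_algebra_measurable R n.
rewrite kop_kernelE//; have := sw n.
have -> : U (ray_algebra n) = (fine (U (ray_algebra n)))%:E by rewrite fineK// fin_num_measure.
rewrite [X in (_ -> _ <= X + _)%E](_ : _ = (fine (U (ray_algebra n)))%:E); last first.
  by rewrite fineK// fin_num_measure.
rewrite -EFinB -EFinD !lee_fin => /(le_trans (ler_norm _)); lra.
Qed.

(** Slice S: the kernel from X_0 gives to the section of S at X_0 at most its uniform
    measure plus the essential supremum, whose expectation is the beta coefficient. *)
Lemma beta_graph_law S : measurable S ->
  (graph_law mh S <= (U \x U)%E S + beta_mix X N)%E.
Proof.
move=> mS.
have bS : bm (\1_S : R * R -> R) by exact: bm_indic.
pose A x := \int[U]_u \1_S (x, h (x, u)); pose D x := \int[U]_u \1_S (x, u) : R.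
have mg : measurable_fun setT (fun z : R * R => (z.1, h z)).
  by apply: measurable_fun_pair => //; exact: measurable_fst.
have [bA _] := bm_fubini U U (bm_comp mg bS).
have [bD DE] := bm_fubini U U bS.
have fin (m : probability (R * R)%type R) : m S = (fine (m S))%:E.
  by rewrite fineK// fin_num_measure.
have finX (a : R -> R) : bm a -> (\int[U]_x a x)%:E = (\int[P]_w (a (X 0%R w))%:E)%E.
  move=> ba; rewrite -(Rintegral_marginal law_X 0 ba) /Rintegral fineK//.
  by apply: integrable_fin_num => //; exact: (bm_integrable P (bm_process X 0 ba)).
rewrite (fin (graph_law mh)) graph_lawE// (fin (U \x U)%E).
rewrite -(Rintegral_indicP (U \x U)%E mS) DE finX// finX//.
have A0 x : 0 <= A x by apply: Rintegral_ge0.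
have D0 x : 0 <= D x by apply: Rintegral_ge0.
have mAX : measurable_fun setT (fun w => (A (X 0 w))%:E).
  by apply/measurable_EFinP; case: (bm_process X 0 bA).
have mDX : measurable_fun setT (fun w => (D (X 0 w))%:E).
  by apply/measurable_EFinP; case: (bm_process X 0 bD).
pose s' w := maxe 0%E (s w).
have ms' : measurable_fun setT s' by apply: measurable_maxe.
have s'0 w : (0 <= s' w)%E by rewrite /s' le_max lexx.
have -> : beta_mix X N = (\int[P]_w s' w)%E.
  apply: ae_eq_integral => //; move: kernel_bound; apply: filterS => w [sw _] _.
  by rewrite /s' max_r.
have DX0 w : (0 <= (D (X 0%R w))%:E)%E by rewrite lee_fin.
have AX0 w : (0 <= (A (X 0%R w))%:E)%E by rewrite lee_fin.
rewrite -ge0_integralD//; last by move=> w _; exact: DX0.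
apply: ae_ge0_le_integral => //.
- by move=> w _; exact: AX0.
- by move=> w _; apply: adde_ge0 => //; exact: DX0.
- exact: emeasurable_funD.
move: kernel_bound; apply: filterS => w [sw kw] _.
pose x := X 0 w; pose Sx := [set y | S (x, y)].
have mSx : measurable Sx.
  have mp : measurable_fun setT (fun y : R => (x, y)) by exact: pair1_measurable.
  by rewrite -[Z in measurable Z]setTI; exact: mp.
have := kw Sx mSx; rewrite kop_kernelE// /s' max_r//.
have -> : U Sx = (D x)%:E.
  rewrite -[LHS]fineK ?fin_num_measure//; congr EFin.
  exact: (esym (Rintegral_indicP U mSx)).
by [].
Qed.

End beta_bound.

Section minorant.
Context (R : realType).
Notation U := (U R).

Definition integral_op (q : R * R -> R) (phi : R -> R) (x : R) : R :=
  \int[U]_y (q (x, y) * phi y).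

Let bm_slice (q : R * R -> R) x : bm q -> bm (fun y => q (x, y)).
Proof. by move=> bq; apply: bm_comp bq; exact: pair1_measurable. Qed.

Lemma integral_op_posop (q : R * R -> R) : bm q -> (forall z, 0 <= q z) ->
  posop (integral_op q).
Proof.
move=> bq q0; split => [phi bphi|a phi psi bphi bpsi|phi bphi phi0 x].
- by have [] := bm_fubini U U (bmM bq (bm_comp measurable_snd bphi)).
- apply/funext => x; rewrite /integral_op.
  have i1 := bm_integrable U (bmM (bm_slice x bq) bphi).
  have i2 := bm_integrable U (bmM (bm_slice x bq) bpsi).
  rewrite -RintegralZl// -RintegralD//; last first.
    exact: (bm_integrable U (bmZ a (bmM (bm_slice x bq) bphi))).
  by apply: eq_Rintegral => y _; rewrite mulrDr mulrCA.
- by apply: Rintegral_ge0 => y _; exact: mulr_ge0.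
Qed.

(** It is enough that the beta coefficient be less than 1 at some time N. *)
Lemma absolutely_regular_minorant (X : process R) (C : R -> R -> R) (f : R * R -> R) :
  generated_by C X -> transition_of C f -> absolutely_regular X ->
  exists N (q : R * R -> R) (M : R), [/\ (0 < N)%N, measurable_fun setT q,
    forall z, 0 <= q z <= M, 0 < \int[U]_x \int[U]_y q (x, y) &
    forall phi, bm phi -> (forall x, 0 <= phi x) ->
      forall x, integral_op q phi x <= iter N (kop f) phi x].
Proof.
move=> gX tf aX; have [mf _] := tf.1.
have [N N0 [b b1 Nb]] : exists2 N, (0 < N)%N & exists2 b : R, b < 1 &
    (beta_mix X N <= b%:E)%E.
  have h2 : \forall m \near \oo, (beta_mix X m < (2^-1 : R)%:E)%E.
    have := aX [set u | (u < (2^-1 : R)%:E)%E]; apply.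
    by apply: open_ereal_lt'; rewrite lte_fin invr_gt0.
  have [N _ hN] := h2.
  exists N.+1 => //; exists 2^-1; first by rewrite invf_lt1// ltr1n.
  by apply: ltW; apply: hN => /=.
have [G mG GU] := uniform_splitting R.
have mh := measurable_iter_map mG N mf.
have hE phi : bm phi -> kop (iter_map G N f) phi = iter N (kop f) phi.
  by move=> bphi; rewrite (kop_iter_map mG GU).
have tv S : measurable S -> (graph_law mh S <= (U \x U)%E S + b%:E)%E.
  move=> mS; apply: (le_trans (beta_graph_law gX tf mh hE mS)).
  exact: leeD2l.
have [q [M [mq qM qpos qh]]] := minorant_of_overlap b1 tv.
exists N, q, M; split => // phi bphi phi0 x.
have [mphi _] := bphi.
have bq : bm q.
  by split => //; exists M => z; have /andP[h1 h2] := qM z; rewrite ger0_norm.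
have qx0 y : 0 <= q (x, y) by case/andP: (qM (x, y)).
have mqx : measurable_fun setT (fun y => q (x, y)) by case: (bm_slice x bq).
have bh := bm_section x mh bphi.
have fin (a : R -> R) : bm a -> (\int[U]_y a y)%:E = (\int[U]_y (a y)%:E)%E.
  move=> ba; rewrite /Rintegral fineK//; apply: integrable_fin_num => //.
  exact: (bm_integrable U ba).
rewrite -hE// -lee_fin [leLHS]fin; last exact: bmM (bm_slice x bq) bphi.
rewrite [leRHS]fin//.
have mx : measurable_fun setT (map_section mh x).
  by apply: measurableT_comp => //; exact: pair1_measurable.
have -> : (\int[U]_u (phi (iter_map G N f (x, u)))%:E =
    \int[kop_kernel mh x]_y (phi y)%:E)%E.
  rewrite [RHS](@ge0_integral_pushforward _ _ _ _ _ (map_section mh x) mx) ?preimage_setT//.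
  - by apply/measurable_EFinP.
  - by move=> y _; rewrite lee_fin.
have -> : (\int[U]_y (q (x, y) * phi y)%:E = \int[wmeas U qx0 mqx]_y (phi y)%:E)%E.
  rewrite integral_wmeas//; last by apply/measurable_EFinP.
  by apply: eq_integral => y _; rewrite -EFinM mulrC.
apply: ge0_le_measure_integral => //; last by apply/measurable_EFinP.
by move=> B mB; exact: qh.
Qed.

End minorant.

(** * Geometric ergodicity *)
Lemma geometric_series_lty (R : realType) (c t : R) : 0 <= c -> 0 <= t < 1 ->
  (\sum_(0 <= i <oo) (c * t ^+ i)%:E < +oo)%E.
Proof.
move=> c0 /andP[t0 t1]; apply: (@le_lt_trans _ _ (c / (1 - t))%:E); last exact: ltry.
apply: lime_le.
  by apply: is_cvg_nneseries => i _ _; rewrite lee_fin mulr_ge0// exprn_ge0.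
apply: nearW => n; rewrite sumEFin lee_fin ler_pdivlMr ?subr_gt0//.
have -> : (\sum_(0 <= i < n) c * t ^+ i) * (1 - t) = c * (1 - t ^+ n).
  elim: n => [|n ih]; first by rewrite big_nil expr0 subrr mulr0 mul0r.
  by rewrite big_nat_recr//= mulrDl ih exprS; ring.
by rewrite -[leRHS]mulr1 ler_wpM2l// gerBl exprn_ge0.
Qed.

(** W is the sum of the series of the functions b^(-m) v_m, whose integrals are
    dominated by the geometric series of ratio r / b. *)
Lemma geometric_weight d (T : measurableType d) (R : realType) (P : probability T R)
    (v : nat -> T -> R) (K r b : R) : 0 < r -> r < b -> 0 <= K ->
  (forall m, bm (v m)) -> (forall m x, 0 <= v m x) ->
  (forall m, \int[P]_x v m x <= K * r ^+ m) ->
  exists W : T -> R, [/\ measurable_fun setT W, P.-integrable setT (EFin \o W) &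
    {ae P, forall x, forall m, v m x <= b ^+ m * W x}].
Proof.
move=> r0 rb K0 bv v0 vK; have b0 : 0 < b by exact: lt_trans rb.
pose w m x := ((b ^+ m)^-1 * v m x)%:E.
have w0 m x : (0 <= w m x)%E by rewrite lee_fin mulr_ge0// invr_ge0 exprn_ge0// ltW.
have mw m : measurable_fun setT (w m).
  by apply/measurable_EFinP; case: (bmZ (b ^+ m)^-1 (bv m)).
pose S x := (\sum_(0 <= m <oo) w m x)%E.
have S0 x : (0 <= S x)%E by exact: nneseries_ge0.
have mS : measurable_fun setT S by apply: ge0_emeasurable_sum.
have intS : (\int[P]_x S x < +oo)%E.
  rewrite integral_nneseries//.
  apply: (@le_lt_trans _ _ (\sum_(0 <= m <oo) (K * (r / b) ^+ m)%:E)%E); last first.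
    apply: geometric_series_lty => //.
    by rewrite divr_ge0/= ?ltr_pdivrMr ?mul1r//; exact: ltW.
  apply: lee_nneseries => [m _ _|m _]; first by apply: integral_ge0.
  have i1 := bm_integrable P (bmZ (b ^+ m)^-1 (bv m)).
  have -> : (\int[P]_x w m x)%E = (\int[P]_x ((b ^+ m)^-1 * v m x))%:E.
    by rewrite /Rintegral fineK//; exact: integrable_fin_num.
  rewrite lee_fin RintegralZl//; last exact: (bm_integrable P (bv m)).
  rewrite expr_div_n mulrA [leLHS]mulrC ler_wpM2r ?invr_ge0 ?exprn_ge0// ?ltW//.
have iS : P.-integrable setT S.
  by apply/integrableP; split => //; under eq_integral do rewrite gee0_abs//.
exists (fine \o S); split.
- exact: measurableT_comp.
- apply: (le_integrable measurableT _ _ iS).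
    by apply/measurable_EFinP; exact: measurableT_comp.
  move=> x _ /=; rewrite gee0_abs// ger0_norm ?fine_ge0//.
  by case: (S x) (S0 x) => //=.
move: (integrable_ae measurableT iS); apply: filterS => x /(_ I) Sfin m.
rewrite -ler_pdivrMl ?exprn_gt0// -lee_fin /= fineK//.
apply: (@le_trans _ _ (\sum_(0 <= i < m.+1) w i x)%E); last exact: nneseries_lim_ge.
by rewrite big_nat_recr//= leeDr// sume_ge0.
Qed.

Section geometric_ergodicity.
Context (R : realType) (X : process R) (C : R -> R -> R) (g : R * R -> R).
Notation P := (process_prob X).
Notation U := (U R).
Hypothesis gX : generated_by C X.
Hypothesis tg : transition_of C g.
Variables (v : nat -> R -> R) (K r : R).
Hypotheses (bv : forall m, bm (v m)) (v0 : forall m x, 0 <= v m x).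
Hypotheses (K0 : 0 <= K) (r01 : 0 < r < 1).
Hypothesis vK : forall m, \int[U]_x v m x <= K * r ^+ m.
Hypothesis vP : forall m phi, bm phi -> \int[U]_x phi x = 0 ->
  (forall x, `|phi x| <= 1) -> forall x, `|iter m (kop g) phi x| <= v m x.
Let pg : preserves_U g. Proof. by case: tg. Qed.
Let mg : measurable_fun setT g. Proof. by case: pg. Qed.
Let mk : markov_op U (kop g). Proof. exact: kop_markov. Qed.
Let law_X := generated_law gX.

Let total_variation m x B : measurable B ->
  `|iter m (kop g) \1_B x - fine (U B)| <= v m x.
Proof.
move=> mB; have bB : bm (\1_B : R -> R) by exact: bm_indic.
set c := fine (U B); have bc : bm (cst c : R -> R) by exact: bm_cst.
have c01 : 0 <= c <= 1.
  rewrite /c fine_ge0//= -lee_fin fineK ?fin_num_measure//.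
  exact: probability_le1.
have mkm := markov_iter m mk.
have := @vP m (fun y => \1_B y - cst c y) (bmB bB bc) _ _ x.
rewrite (posopB mkm)// (markov_cst c mkm); apply.
- rewrite RintegralB//; last 2 first.
  + exact: (bm_integrable U bB).
  + exact: (bm_integrable U bc).
  by rewrite Rintegral_indicP// Rintegral_cstP subrr.
move=> y; rewrite indicE /cst ler_norml; case/andP: c01 => ? ?.
by case: (_ \in _) => /=; lra.
Qed.

(** The kernels are those of the iterated map, and the bounds v_m do not depend on
    the event. *)
Lemma geometrically_ergodic_of_bound : geometrically_ergodic X.
Proof.
have /andP[r0 r1] := r01.
pose b := (r + 1) / 2.
have rb : r < b by rewrite /b; lra.
have b1 : b < 1 by rewrite /b; lra.
have [W [mW iW Wv]] := geometric_weight r0 rb K0 bv v0 vK.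
have lawE B : measurable B -> distribution P (X 0) B = U B by exact: law_X.
exists b, W; split => //.
- by rewrite b1 (lt_trans r0 rb).
- have /integrableP[_ fW] := iW; apply/integrableP; split.
    by apply/measurable_EFinP; exact: measurableT_comp mW (measurable_process 0).
  apply: le_lt_trans fW.
  rewrite -(ge0_integral_distribution (X 0) (f := fun x => `|(W x)%:E|%E))//; last first.
    by apply: measurableT_comp => //; apply/measurable_EFinP.
  by rewrite le_eqVlt; apply/orP; left; apply/eqP;
    apply: eq_measure_integral => A mA _; exact: lawE.
have [G mG GU] := uniform_splitting R.
move=> m; have mh := measurable_iter_map mG m mg.
have kE x B : measurable B -> kop_pker mh x B = (iter m (kop g) \1_B x)%:E.
  move=> mB; rewrite -[LHS]/(kop_kernel mh x B) kop_kernelE//.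
  by rewrite (kop_iter_map mG GU)//; exact: bm_indic.
exists (kop_pker mh).
  move=> A B mA mB.
  have := joint_law law_X pg (generated_mkv gX tg) m 0 mA mB; rewrite add0r => ->.
  have bB : bm (\1_B : R -> R) by exact: bm_indic.
  have bkB : bm (iter m (kop g) \1_B) by exact: (posop_bm (posop_iter m mk)).
  transitivity (\int[distribution P (X 0%R)]_(x in A) (iter m (kop g) \1_B x)%:E)%E.
    rewrite (eq_measure_integral U) => [|D mD _]; last exact: lawE.
    rewrite /Rintegral fineK//; apply: integrable_fin_num => //.
    by apply: (integrableS measurableT) => //; exact: (bm_integrable U bkB).
  by apply: eq_integral => x _; rewrite kE.
have [Z [mZ Z0 ZW]] := Wv; exists Z; split => //.
  by rewrite lawE.
apply: subset_trans ZW => x /= nx Wx; apply: nx.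
apply: ge_ereal_sup => _ [B mB <-].
rewrite law_X// [X in `|X - _|%E](_ : _ = (iter m (kop g) \1_B x)%:E); last exact: kE.
rewrite -(@fineK _ (U B)) ?fin_num_measure// -EFinB lee_fin.
exact: le_trans (total_variation m x mB) (Wx m).
Qed.

End geometric_ergodicity.

(** * Convex combinations of copulas *)
Lemma posop_iter_ge d (T : measurableType d) (R : realType) (k k' : (T -> R) -> T -> R)
    (a : R) : posop k -> posop k' -> 0 <= a ->
  (forall phi, bm phi -> (forall x, 0 <= phi x) -> forall x, a * k' phi x <= k phi x) ->
  forall N phi, bm phi -> (forall x, 0 <= phi x) ->
  forall x, a ^+ N * iter N k' phi x <= iter N k phi x.
Proof.
move=> pk pk' a0 kk'; elim=> [|N ih] phi bphi phi0 x; first by rewrite expr0 mul1r.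
have pN := posop_iter N pk; have pN' := posop_iter N pk'.
have bN := posop_bm pN bphi; have bN' := posop_bm pN' bphi.
apply: le_trans (posop_le pk (bmZ (a ^+ N) bN') bN (ih _ bphi phi0) x).
rewrite posopZ// exprSr -mulrA ler_wpM2l ?exprn_ge0//.
by apply: kk' => // y; exact: (posop_ge0 pN').
Qed.

Lemma generates_of_transition (R : realType) (C : R -> R -> R) (f : R * R -> R)
    (Q : process R -> Prop) : transition_of C f ->
  (forall X, generated_by C X -> Q X) -> generates C Q.
Proof. by move=> tf h; split => //; exact: transition_generates tf. Qed.

Section mixture.
Context (R : realType) (n : nat) (a : nat -> R) (C : nat -> R -> R -> R).
Notation U := (U R).
Hypothesis n1 : (1 <= n)%N.
Hypothesis a0 : forall k, (1 <= k <= n)%N -> 0 <= a k.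
Hypothesis a_sum : \sum_(1 <= k < n.+1) a k = 1.
Hypothesis a1 : a 1%N != 0.
Variables (f : nat -> R * R -> R) (g : R * R -> R).
Hypothesis tf : forall k, (1 <= k <= n)%N -> transition_of (C k) (f k).
Hypothesis pg : preserves_U g.
Hypothesis gE : forall phi x, bm phi ->
  kop g phi x = \sum_(1 <= k < n.+1) a k * kop (f k) phi x.
Let mk : markov_op U (kop g). Proof. exact: kop_markov. Qed.

Let a_le1 j : (1 <= j <= n)%N -> a j <= 1.
Proof.
move=> jn; rewrite -a_sum (bigD1_seq j) ?mem_index_iota ?iota_uniq//= lerDl.
rewrite big_seq_cond; apply: sumr_ge0 => i; rewrite mem_index_iota ltnS => /andP[ir _].
exact: a0.
Qed.

Lemma mixture_ge j phi : (1 <= j <= n)%N -> bm phi -> (forall x, 0 <= phi x) ->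
  forall x, a j * kop (f j) phi x <= kop g phi x.
Proof.
move=> jn bphi phi0 x; rewrite gE// (bigD1_seq j) ?mem_index_iota ?iota_uniq//= lerDl.
rewrite big_seq_cond; apply: sumr_ge0 => i; rewrite mem_index_iota ltnS => /andP[ir _].
have [[mfi _] _] := tf ir.
by rewrite mulr_ge0 ?a0//; exact: (posop_ge0 (kop_posop mfi)).
Qed.

(** Apply [gapped_mixture] at a time m when K r^m < 1; K is replaced by |K| since the
    definition of exponential mixing does not make it nonnegative. *)
Lemma mixture_gapped : generates_a (C 1%N) (@exp_rho_mixing R) -> gapped U (kop g).
Proof.
move=> [X [gX [K [r [/andP[r0 r1] rhoX]]]]].
have r1n : (1 <= 1 <= n)%N by [].
have [m m0 ml] : exists2 m, (0 < m)%N & `|K| * r ^+ m < 1.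
  have : geometric `|K| r i @[i --> \oo] --> (0 : R).
    by apply: cvg_geometric; rewrite ger0_norm// ltW.
  move=> /cvgrPdist_lt /(_ 1 ltr01) [N _ hN]; exists N.+1 => //.
  have := hN N.+1 (leqnSn N); rewrite /= sub0r normrN; apply: le_lt_trans.
  exact: ler_norm.
have l0 : 0 <= `|K| * r ^+ m by rewrite mulr_ge0// exprn_ge0// ltW.
apply: (@gapped_mixture _ _ _ U (kop g) (kop (f 1%N)) (a 1%N) (`|K| * r ^+ m) m) => //.
- by apply: kop_markov; case: (tf r1n).
- by rewrite lt_neqAle eq_sym a1 a0// a_le1.
- by apply: (mixture_close n1 a0 a_sum _ gE) => i /tf[].
- by rewrite l0.
apply: (rho_contraction gX (tf r1n) l0).
apply: (le_trans (rhoX m m0)); rewrite lee_fin ler_wpM2r ?ler_norm//.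
by rewrite exprn_ge0// ltW.
Qed.

(** The minorization of the second component, with weight a_2^N, meets the spectral
    gap given by the first. *)
Lemma mixture_geometrically_ergodic (D : R -> R -> R) (X : process R) :
  (2 <= n)%N -> a 2%N != 0 ->
  transition_of D g -> generated_by D X -> gapped U (kop g) ->
  generates_a (C 2%N) (@absolutely_regular R) -> geometrically_ergodic X.
Proof.
move=> n2' a2 tg gX gk [X2 [gX2 aX2]].
have r2 : (1 <= 2 <= n)%N by [].
have a2pos : 0 < a 2%N by rewrite lt_neqAle eq_sym a2 a0.
have [N [q [M [N0 mq qM qpos qN]]]] := absolutely_regular_minorant gX2 (tf r2) aX2.
have q0 z : 0 <= q z by case/andP: (qM z).
have M0 : 0 <= M by have /andP[h1 h2] := qM (0, 0); exact: le_trans h1 h2.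
have bq : bm q by split => //; exists M => z; rewrite ger0_norm//; case/andP: (qM z).
have pq := integral_op_posop bq q0.
set A := a 2%N ^+ N; have A0 : 0 < A by exact: exprn_gt0.
have A1 : A <= 1 by rewrite exprn_ile1// ?a_le1// ltW.
pose Q phi x := A * integral_op q phi x.
have pQ : posop Q.
  split => [phi bphi|c phi psi bphi bpsi|phi bphi phi0 x].
  - by apply: bmZ; exact: (posop_bm pq).
  - by apply/funext => x; rewrite /Q (posop_lin pq)// mulrDr mulrCA.
  - by apply: mulr_ge0; [exact: ltW|exact: (posop_ge0 pq)].
have mkN := markov_iter N mk.
have pS : posop (fun phi x => iter N (kop g) phi x - Q phi x).
  split => [phi bphi|c phi psi bphi bpsi|phi bphi phi0 x].
  - by apply: bmB; [exact: (posop_bm mkN)|exact: (posop_bm pQ)].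
  - by apply/funext => x; rewrite (posop_lin mkN)// (posop_lin pQ)//; ring.
  rewrite subr_ge0; have [[mf2 _] _] := tf r2.
  have := posop_iter_ge mk (kop_posop mf2) (ltW a2pos)
    (fun phi bphi phi0 => mixture_ge r2 bphi phi0) N bphi phi0 x.
  by apply: le_trans; rewrite ler_wpM2l ?qN// ltW.
have QM phi : bm phi -> forall x, `|Q phi x| <= M * n2 U phi.
  move=> bphi x; rewrite /Q normrM gtr0_norm//.
  have bn := bm_norm bphi.
  have bqx : bm (fun y => q (x, y)) by apply: bm_comp bq; exact: pair1_measurable.
  apply: (@le_trans _ _ `|integral_op q phi x|); first by rewrite ler_piMl.
  apply: (le_trans (posop_norm pq bphi x)).
  apply: (@le_trans _ _ (M * \int[U]_y `|phi y|)); last first.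
    rewrite ler_wpM2l// -[n2 _ _]n2_norm.
    exact: le_trans (ler_norm _) (norm_Rintegral_le_n2 (bm_sqint U bn)).
  rewrite -RintegralZl//; last exact: (bm_integrable U bn).
  apply: le_Rintegral => //.
  - exact: (bm_integrable U (bmM bqx bn)).
  - exact: (bm_integrable U (bmZ M bn)).
  by move=> y _; rewrite ler_wpM2r//; case/andP: (qM (x, y)).
have Q1 : 0 < \int[U]_x Q (cst 1) x.
  rewrite RintegralZl//; last exact: (bm_integrable U (posop_bm pq (bm_cst 1))).
  rewrite mulr_gt0//; apply: (lt_le_trans qpos); rewrite le_eqVlt; apply/orP; left.
  apply/eqP; apply: eq_Rintegral => x _; rewrite /integral_op.
  by apply: eq_Rintegral => y _; rewrite mulr1.
have [v [bv v0 [K [r [K0 r01 vK]]] vP]] := minorization_bound mk gk N0 pQ M0 QM Q1 pS.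
exact: (geometrically_ergodic_of_bound gX tg bv v0 K0 r01 vK vP).
Qed.

End mixture.

Theorem theorem8 (R : realType) (n : nat) (C : nat -> R -> R -> R)
    (copC : forall k : nat, (1 <= k <= n)%N -> is_copula (C k)) :
  ((1 <= n)%N ->
   generates_a (C 1%N) (@exp_rho_mixing R) ->
   forall a : nat -> R,
     (forall k : nat, (1 <= k <= n)%N -> 0 <= a k) ->
     \sum_(1 <= k < n.+1) a k = 1 ->
     a 1%N != 0 ->
     generates (fun x y => \sum_(1 <= k < n.+1) a k * C k x y)
       (@exp_rho_mixing R))
  /\
  ((2 <= n)%N ->
   generates_a (C 2%N) (@absolutely_regular R) ->
   generates_a (C 1%N) (@exp_rho_mixing R) ->
   forall a : nat -> R,
     (forall k : nat, (1 <= k <= n)%N -> 0 <= a k) ->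
     \sum_(1 <= k < n.+1) a k = 1 ->
     a 1%N != 0 -> a 2%N != 0 ->
     generates (fun x y => \sum_(1 <= k < n.+1) a k * C k x y)
       (fun X => geometrically_ergodic X /\ exp_rho_mixing X)).
Proof.
have /choice[f tf] : forall k, exists f, (1 <= k <= n)%N -> transition_of (C k) f.
  move=> k; have [kn|_] := boolP (1 <= k <= n)%N; last by exists fst.
  by have [f tf] := copula_transition (copC k kn); exists f.
split=> [n1 rho1 a a0 a_sum a1|n2' reg2 rho1 a a0 a_sum a1 a2].
  have [g tg gE] := mixture_transition n1 a0 a_sum a1 tf.
  apply: (generates_of_transition tg) => X gX.
  exact: gapped_exp_rho_mixing gX tg (mixture_gapped n1 a0 a_sum a1 tf tg.1 gE rho1).
have n1 : (1 <= n)%N by exact: ltnW.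
have [g tg gE] := mixture_transition n1 a0 a_sum a1 tf.
have gk := mixture_gapped n1 a0 a_sum a1 tf tg.1 gE rho1.
apply: (generates_of_transition tg) => X gX; split.
  exact: (mixture_geometrically_ergodic a0 a_sum tf tg.1 gE n2' a2 tg gX gk reg2).
exact: gapped_exp_rho_mixing gX tg gk.
Qed.
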